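(* DOMINATING MANIPULATION with partial orders is NP-hard for maximin, even when the number of unknown pairs in each partial order of the non-manipulators' profile is at most $4$.
   Context: Alternatives $\mathcal C$, ties broken according to a fixed order on alternatives. For a profile $P$, $D_P(a,b)$ is the number of votes ranking $a$ above $b$ minus the number ranking $b$ above $a$. Maximin: the winner is the alternative $c$ maximizing $\min_{c'\ne c}D_P(c,c')$. There are $n$ non-manipulators and a manipulator with true linear order $V_M$. The manipulator's information is a profile $P_{po}$ of $n$ partial orders; the information set $E$ is the set of all profiles of linear orders extending $P_{po}$ componentwise. DOMINATING MANIPULATION: given $P_{po}$ and $V_M$, does there exist a linear order $V'$ such that for every $P\in E$, $r(P\cup\{V'\})$ is ranked weakly above $r(P\cup\{V_M\})$ in $V_M$, and for some $P'\in E$ strictly above? The number of unknown pairs of a partial order is the number of pairs of alternatives incomparable in it. *)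

(* Defs.v *)
From HB Require Import structures.
From mathcomp Require Import all_boot all_order all_algebra.
Set Implicit Arguments. Unset Strict Implicit. Unset Printing Implicit Defensive.
Import Order.TTheory GRing.Theory Num.Theory.

Inductive Sym := Blank | S0 | S1 | Sep.
Inductive Move := MLeft | MRight | MStay.

Record TM := mkTM {
  tm_state : finType;
  tm_start : tm_state;
  tm_delta : tm_state -> Sym -> option (tm_state * Sym * Move) }.

(* configuration: state, tape left of the head (nearest cell first),
   scanned symbol, tape right of the head; all other cells are blank *)
Record config (M : TM) := Cfg {
  cf_state : tm_state M; cf_left : seq Sym; cf_cur : Sym; cf_right : seq Sym }.

Definition move_head (M : TM) (q : tm_state M) (a : Sym) (mv : Move)
    (l r : seq Sym) : config M :=
  match mv with
  | MLeft => match l with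
             | [::] => Cfg q [::] Blank (a :: r)
             | b :: l' => Cfg q l' b (a :: r) end
  | MRight => match r with
              | [::] => Cfg q (a :: l) Blank [::]
              | b :: r' => Cfg q (a :: l) b r' end
  | MStay => Cfg q l a r
  end.

Definition step (M : TM) (c : config M) : option (config M) :=
  match tm_delta (cf_state c) (cf_cur c) with
  | None => None
  | Some (q, a, mv) => Some (move_head q a mv (cf_left c) (cf_right c))
  end.

Fixpoint run (M : TM) (k : nat) (c : config M) : option (config M) :=
  match k with
  | 0 => Some c
  | k'.+1 => match step c with None => None | Some c' => @run M k' c' end
  end.
Arguments run : clear implicits.

Definition halted (M : TM) (c : config M) : Prop :=
  tm_delta (cf_state c) (cf_cur c) = None.

Definition init (M : TM) (w : seq Sym) : config M :=
  match w with
  | [::] => Cfg (tm_start M) [::] Blank [::]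
  | a :: w' => Cfg (tm_start M) [::] a w'
  end.
Arguments init : clear implicits.

Definition sym_of_bit (b : bool) : Sym := if b then S1 else S0.
Definition enc (x : seq bool) : seq Sym := map sym_of_bit x.
Definition pair_enc (x y : seq bool) : seq Sym := enc x ++ Sep :: enc y.

Fixpoint read_bits (s : seq Sym) : seq bool :=
  match s with
  | S0 :: t => false :: read_bits t
  | S1 :: t => true :: read_bits t
  | _ => [::]
  end.
Definition output (M : TM) (c : config M) : seq bool :=
  read_bits (cf_cur c :: cf_right c).

Definition poly (c n : nat) : nat := c * n ^ c + c.

Definition halts_within (M : TM) (w : seq Sym) (t : nat) : Prop :=
  exists k c, k <= t /\ run M k (init M w) = Some c /\ halted c.

Definition accepts (M : TM) (w : seq Sym) : Prop :=
  exists k c, run M k (init M w) = Some c /\ halted c /\ output c = [:: true].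

Definition polytime_computable (f : seq bool -> seq bool) : Prop :=
  exists (M : TM) (d : nat), forall x : seq bool,
    exists k c, k <= poly d (size x) /\ run M k (init M (enc x)) = Some c /\
                halted c /\ output c = f x.

Definition language := seq bool -> Prop.

Definition in_NP (L : language) : Prop :=
  exists (V : TM) (d : nat),
    (forall x y : seq bool, halts_within V (pair_enc x y) (poly d (size x + size y))) /\
    (forall x : seq bool,
        L x <-> exists y : seq bool, size y <= poly d (size x) /\ accepts V (pair_enc x y)).

Definition poly_reduces (L1 L2 : language) : Prop :=
  exists f, polytime_computable f /\ forall x, L1 x <-> L2 (f x).

Definition NP_hard (L : language) : Prop :=
  forall L', in_NP L' -> poly_reduces L' L.

(* Alternatives are 'I_m; ties are broken by the fixed order             *)
(* 0 < 1 < ... < m-1 (smaller index preferred).                          *)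
(* A (strict) order is a relation r with r a b meaning "a above b".      *)

Section Voting.
Variable m : nat.
Local Notation alt := 'I_m.

Definition is_partial_order (r : rel alt) : bool :=
  [forall a, ~~ r a a] && [forall a, forall b, forall c, r a b ==> r b c ==> r a c].

Definition is_linear_order (r : rel alt) : bool :=
  is_partial_order r && [forall a, forall b, (a != b) ==> r a b || r b a].

Definition extends (L p : rel alt) : bool := [forall a, forall b, p a b ==> L a b].

Definition unknown_pairs (p : rel alt) : nat :=
  #|[set ab : alt * alt | (ab.1 < ab.2)%N && ~~ p ab.1 ab.2 && ~~ p ab.2 ab.1]|.

Variable n : nat.
Definition D (P : 'I_n -> rel alt) (V : rel alt) (a b : alt) : int :=
  (\sum_(i < n) ((Posz (P i a b)) - (Posz (P i b a))) + ((Posz (V a b)) - (Posz (V b a))))%R.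

(* maximin score min_{c' <> c} D(c,c'); the default n+1 is an upper
   bound for every D value, so it is only attained when m = 1 *)
Definition maximin_score (P : 'I_n -> rel alt) (V : rel alt) (c : alt) : int :=
  \big[Order.min/(Posz (n.+1))]_(c' | c' != c) D P V c c'.

Definition maximin_winner (P : 'I_n -> rel alt) (V : rel alt) (w : alt) : Prop :=
  forall c, c != w ->
    (maximin_score P V c < maximin_score P V w)%R \/
    (maximin_score P V c = maximin_score P V w /\ (w < c)%N).

Definition in_info_set (Ppo P : 'I_n -> rel alt) : Prop :=
  forall i, is_linear_order (P i) /\ extends (P i) (Ppo i).

Definition weakly_above (VM : rel alt) (x y : alt) : Prop := x = y \/ VM x y.

Definition dominating_manipulation (Ppo : 'I_n -> rel alt) (VM : rel alt) : Prop :=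
  exists V' : rel alt, is_linear_order V' /\
    (forall P, in_info_set Ppo P -> forall w' w,
        maximin_winner P V' w' -> maximin_winner P VM w -> weakly_above VM w' w) /\
    (exists P, in_info_set Ppo P /\ exists w' w,
        maximin_winner P V' w' /\ maximin_winner P VM w /\ VM w' w).

End Voting.

(* Instance: unary(m) unary(n) then n+1 row-major m*m adjacency matrices *)
(* (bit a*m+b of a matrix says "a above b"): the n partial orders of the *)
(* non-manipulators, then the manipulator's order V_M.                   *)
(* unary(k) = 1^k 0.                                                     *)

Fixpoint dec_unary (s : seq bool) : option (nat * seq bool) :=
  match s with
  | [::] => None
  | false :: t => Some (0, t)
  | true :: t => match dec_unary t with
                 | None => None
                 | Some (k, r) => Some (k.+1, r) end
  end.

Record instance := Inst {
  inst_m : nat; inst_n : nat;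
  inst_po : 'I_inst_n -> rel 'I_inst_m;
  inst_vm : rel 'I_inst_m }.
Arguments inst_po : clear implicits.
Arguments inst_vm : clear implicits.

Definition decode (s : seq bool) : option instance :=
  match dec_unary s with
  | None => None
  | Some (m, s1) =>
    match dec_unary s1 with
    | None => None
    | Some (n, s2) =>
      if size s2 == (n.+1 * (m * m))%N then
        Some (@Inst m n
                (fun (i : 'I_n) (a b : 'I_m) => nth false s2 (i * (m * m) + (a * m + b)))
                (fun (a b : 'I_m) => nth false s2 (n * (m * m) + (a * m + b))))
      else None
    end
  end.

Definition valid_instance (I : instance) : Prop :=
  (forall i, is_partial_order (inst_po I i)) /\ is_linear_order (inst_vm I).

Definition DM_maximin_4 : language := fun s =>
  exists I, decode s = Some I /\ valid_instance I /\
    (forall i, unknown_pairs (inst_po I i) <= 4) /\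
    dominating_manipulation (inst_po I) (inst_vm I).

(* Main.v *)
(* Acceptance of a nondeterministic polynomial-time computation is encoded, in the manner of Cook and
   Levin, as a choice of tiles on a line of cells avoiding finitely many kinds of conflicts: the rows
   of the tableau are laid end to end, so that each cell is a function of three earlier cells.
   Copying the choice made at a cell once per conflict turns this into a satisfiability problem in
   which every variable occurs once positively, in its head clause, and at most twice negatively.

   In the election the clauses are alternatives, and a clause is satisfied when its maximin score is
   low because some pairwise margin is low. A variable is a vote in which the position of its head
   relative to its two bodies and an auxiliary alternative [z] is unknown: three unknown pairs. Up, it
   lowers a margin of each body; down, it lowers a margin of the head. If all clauses are satisfied,
   the manipulator makes [w] win instead of [d] by moving [d] down one place; otherwise the same
   unsatisfied clause wins before and after. Conversely, tie-breaking is opposite to the manipulator's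
   preference among clauses, so a vote that replaces the winning unsatisfied clause by a better
   alternative must raise the score of some clause. This backfires on the profile given by a
   rejecting computation, which violates only the favourite clause [top].

   Turing machines enter through programs of nested bounded loops over arithmetic expressions: each
   is compiled to stacks of bits, these to a tape on which they are interleaved, and the reduction is
   written as such a program. *)
Require Import Defs.
From HB Require Import structures.
From mathcomp Require Import all_boot all_order all_algebra.
From mathcomp Require Import zify boolp.
From Stdlib Require Import FunctionalExtensionality.
Set Implicit Arguments. Unset Strict Implicit. Unset Printing Implicit Defensive.
Import Order.TTheory GRing.Theory Num.Theory.


(** * Turing machines on an integer-indexed tape *)

(** All margins are odd, the number of votes being odd. Under [VM], an unsatisfied clause scores
    exactly -1 and a satisfied one at most -3, while [w] and [d] score -3; [d] drops to at most -5
    once it stands below [e]. Indices matter: a body has a smaller index than its head, so a margin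
    can be changed in one direction only, and [VM] is already against the body there.

    The obstacle of the converse is that the manipulator's vote [V'] is arbitrary. An alternative
    that overtakes the winning unsatisfied clause has a score above -1, so all its margins are at
    least 1 in that profile. If the fallback profile lowers each margin at most once, the same
    alternative still has all margins at least -1 there. But [top] scores at most -1 and loses all
    ties, so it would no longer win there, although it is first in [VM].

    This is why the fallback may violate only [top] and chooses at most one tile per cell. Both are
    obtained by adding one cell outside the tableau, with clause [top]: every acceptance conflict
    contains a tile of this cell, so leaving it empty makes any computation free of conflicts. *)

Definition sym_code (s : Sym) : 'I_4 :=
  @Ordinal 4 (match s with Blank => 0 | S0 => 1 | S1 => 2 | Sep => 3 end)
    (match s with Blank | S0 | S1 | Sep => isT end).
Definition sym_decode (i : 'I_4) : Sym :=
  match val i with 0 => Blank | 1 => S0 | 2 => S1 | _ => Sep end.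
Lemma sym_codeK : cancel sym_code sym_decode.
Proof. by case. Qed.
HB.instance Definition _ := Equality.copy Sym (can_type sym_codeK).
HB.instance Definition _ := Choice.copy Sym (can_type sym_codeK).
HB.instance Definition _ := Countable.copy Sym (can_type sym_codeK).
HB.instance Definition _ := Finite.copy Sym (can_type sym_codeK).

Definition upd (T : eqType) (U : Type) (f : T -> U) (x : T) (u : U) : T -> U :=
  fun y => if y == x then u else f y.

Definition disp (mv : Move) : int :=
  match mv with MLeft => -1%:Z | MRight => 1%:Z | MStay => 0%:Z end%R.

Definition cell (M : TM) (c : config M) (z : int) : Sym :=
  match z with
  | Posz 0 => cf_cur c
  | Posz j.+1 => nth Blank (cf_right c) j
  | Negz j => nth Blank (cf_left c) j
  end.

(** Tape positions are absolute here, so writing is a pointwise update and moving changes only [h];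
    lists that differ by trailing blanks describe the same tape. *)
Definition conf (M : TM) (c : config M) (q : tm_state M) (f : int -> Sym) (h : int) : Prop :=
  cf_state c = q /\ forall z, f z = cell c (z - h)%R.

Lemma conf_cur M (c : config M) q f h : conf c q f h -> cf_cur c = f h.
Proof. by case=> _ ->; rewrite subrr. Qed.

Lemma conf_right M (c : config M) q f h : conf c q f h -> nth Blank (cf_right c) 0 = f (h + 1)%R.
Proof. by case=> _ ->; rewrite addrAC subrr add0r. Qed.

Lemma move_head_conf (M : TM) (q q' : tm_state M) l s r f h a mv :
  conf (Cfg q l s r) q f h ->
  conf (move_head q' a mv l r) q' (upd f h a) (h + disp mv)%R.
Proof.
case=> _ Hf; split; first by case: mv; [case: l Hf|case: r Hf|].
move=> z; rewrite /upd; case: eqP => [->|nz].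
  have -> : (h - (h + disp mv) = - disp mv)%R by lia.
  by case: mv => //=; [case: l Hf|case: r Hf].
rewrite Hf; move: nz.
have -> : z = (z - h + h)%R by lia.
move: (z - h)%R => y; rewrite addrK => nz.
have -> : (y + h - (h + disp mv) = y - disp mv)%R by lia.
case: mv => /=.
- rewrite opprK; case: y nz => [[|j]|j] nz.
  + by case: nz; rewrite add0r.
  + by rewrite -PoszD addn1; case: l Hf.
  + case: j nz => [|j] nz; first by case: l Hf.
    have -> : (Negz j.+1 + 1 = Negz j)%R by lia.
    by case: l Hf => [|b l] _ //=; rewrite nth_nil.
- case: y nz => [[|j]|j] nz.
  + by case: nz; rewrite add0r.
  + have -> : (Posz j.+1 - 1 = Posz j)%R by lia.
    by case: r Hf => [|b r] _ //=; case: j nz => [|j] nz //=; rewrite nth_nil.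
  + have -> : (Negz j - 1 = Negz j.+1)%R by lia.
    by case: r Hf.
- rewrite subr0; case: y nz => [[|j]|j] nz //.
  by case: nz; rewrite add0r.
Qed.

Lemma step_conf (M : TM) (c : config M) q f h q' a mv :
  conf c q f h -> tm_delta q (f h) = Some (q', a, mv) ->
  exists2 c', step c = Some c' & conf c' q' (upd f h a) (h + disp mv)%R.
Proof.
move=> Hc Hd; have [E _] := Hc; case: c E Hc => p l s r /= E; rewrite {}E => Hc.
have Hs : s = f h by rewrite -(conf_cur Hc).
rewrite /step /= Hs Hd; eexists; first by [].
exact: move_head_conf Hc.
Qed.

Definition word_tape (w : seq Sym) (z : int) : Sym :=
  if z is Posz j then nth Blank w j else Blank.

Lemma init_conf (M : TM) w : conf (init M w) (tm_start M) (word_tape w) 0%R.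
Proof.
case: w => [|a w]; split=> // z; rewrite subr0; case: z => [[|j]|j] //=; by rewrite nth_nil.
Qed.

Lemma run_add (M : TM) a b (c c' : config M) :
  run M a c = Some c' -> run M (a + b) c = run M b c'.
Proof.
elim: a c => [|a IH] c /=; first by case=> ->.
by case: (step c) => [d|] //; apply: IH.
Qed.

Lemma run_trans M a b (c c' : config M) x :
  run M a c = Some c' -> run M b c' = x -> run M (a + b) c = x.
Proof. by move=> H <-; apply: run_add. Qed.

(** * Structured tape programs *)

Inductive tprog :=
| TAct of (Sym -> Sym * Move)
| TSeq of tprog & tprog
| TIf of pred Sym & tprog & tprog
| TWhile of pred Sym & tprog.

Definition tape := ((int -> Sym) * int)%type.
Definition act (g : Sym -> Sym * Move) (t : tape) : tape :=
  let: (a, mv) := g (t.1 t.2) in (upd t.1 t.2 a, (t.2 + disp mv)%R).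

(** The step counts are exact for the compiled code: a true branch pays for its test and for the
    jump over the other branch, a round of a loop for its test and the jump back. *)
Inductive texec : tprog -> tape -> nat -> tape -> Prop :=
| XAct g t : texec (TAct g) t 1 (act g t)
| XSeq p q t t1 t2 n m : texec p t n t1 -> texec q t1 m t2 -> texec (TSeq p q) t (n + m) t2
| XIfT (P : pred Sym) p q t t' n : P (t.1 t.2) -> texec p t n t' -> texec (TIf P p q) t n.+2 t'
| XIfF (P : pred Sym) p q t t' n : ~~ P (t.1 t.2) -> texec q t n t' -> texec (TIf P p q) t n.+1 t'
| XWhileT (P : pred Sym) p t t1 t2 n m : P (t.1 t.2) -> texec p t n t1 ->
    texec (TWhile P p) t1 m t2 -> texec (TWhile P p) t (n + m).+2 t2
| XWhileF (P : pred Sym) p t : ~~ P (t.1 t.2) -> texec (TWhile P p) t 1 t.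

Definition instr := Sym -> Sym * Move * nat.

Fixpoint tsize (p : tprog) : nat :=
  match p with
  | TAct _ => 1
  | TSeq p q => tsize p + tsize q
  | TIf _ p q => (tsize p + tsize q).+2
  | TWhile _ p => (tsize p).+2
  end.

Definition test (P : pred Sym) (a b : nat) : instr := fun s => (s, MStay, if P s then a else b).

Fixpoint tcomp (p : tprog) (o : nat) : seq instr :=
  match p with
  | TAct g => [:: fun s => (g s, o.+1)]
  | TSeq p q => tcomp p o ++ tcomp q (o + tsize p)
  | TIf P p q =>
      test P o.+1 (o + (tsize p).+2) ::
      rcons (tcomp p o.+1) (test predT (o + (tsize p + tsize q).+2) 0)
      ++ tcomp q (o + (tsize p).+2)
  | TWhile P p =>
      test P o.+1 (o + (tsize p).+2) :: rcons (tcomp p o.+1) (test predT o 0)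
  end.

Lemma size_tcomp p o : size (tcomp p o) = tsize p.
Proof.
elim: p o => //= [p IHp q IHq|P p IHp q IHq|P p IHp] o;
  rewrite ?size_cat ?size_rcons ?IHp ?IHq //; lia.
Qed.

(** The state is a program counter. The one state past the end of the code has no transition, so
    running off the end is halting. *)
Definition tm_of (code : seq instr) : TM :=
  @mkTM ('I_(size code).+1 : finType) ord0
    (fun q s => match drop q code with
                | [::] => None
                | i :: _ => let: (a, mv, q') := i s in Some (inord q', a, mv)
                end).

Definition pc (code : seq instr) (o : nat) : tm_state (tm_of code) := @inord (size code) o.

Lemma instr_step pre (i : instr) post o (c : config (tm_of (pre ++ i :: post))) f h a mv o' :
  size pre = o -> conf c (pc _ o) f h -> i (f h) = (a, mv, o') ->
  exists2 c', run _ 1 c = Some c' & conf c' (pc _ o') (upd f h a) (h + disp mv)%R.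
Proof.
move=> So Hc Hi.
have Hd : tm_delta (pc (pre ++ i :: post) o) (f h) = Some (pc _ o', a, mv).
  rewrite /= /pc inordK; last by rewrite size_cat /=; lia.
  by rewrite drop_cat So ltnn subnn drop0 Hi.
by have [c' /= -> H] := step_conf Hc Hd; exists c'.
Qed.

Lemma upd_id (T : eqType) U (f : T -> U) x : upd f x (f x) = f.
Proof. by apply: functional_extensionality => y; rewrite /upd; case: eqP => [->|]. Qed.

Lemma test_step pre P a b post o (c : config (tm_of (pre ++ test P a b :: post))) f h :
  size pre = o -> conf c (pc _ o) f h ->
  exists2 c', run _ 1 c = Some c' & conf c' (pc _ (if P (f h) then a else b)) f h.
Proof.
move=> So Hc; have [c' R Hc'] := @instr_step _ _ _ _ _ _ _ (f h) MStay _ So Hc (erefl _).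
by exists c'; rewrite //; move: Hc'; rewrite upd_id addr0.
Qed.

(** Jumps are absolute, so a subprogram is followed inside the whole code, with arbitrary
    instructions before and after it. The decomposition of [code] is an equation because the type of
    configurations depends on [code]. *)
Lemma texec_run p t n t' : texec p t n t' -> forall code pre post,
  code = pre ++ tcomp p (size pre) ++ post ->
  forall c : config (tm_of code), conf c (pc _ (size pre)) t.1 t.2 ->
  exists2 c', run _ n c = Some c' & conf c' (pc _ (size pre + tsize p)) t'.1 t'.2.
Proof.
elim=> {p t n t'}.
- move=> g [f h] code pre post -> c Hc; rewrite addn1.
  case E: (g (f h)) => [a mv]; rewrite /act /= E /=.
  by apply: (@instr_step pre _ post _ c) => //; rewrite E.
- move=> p q t t1 t2 n m _ IHp _ IHq code pre post Ec c Hc.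
  have [|c1 R1 H1] := IHp code pre (tcomp q (size pre + tsize p) ++ post) _ c Hc.
    by rewrite Ec /= -catA.
  have Es : size (pre ++ tcomp p (size pre)) = size pre + tsize p by rewrite size_cat size_tcomp.
  have [||c2 R2 H2] := IHq code (pre ++ tcomp p (size pre)) post _ c1.
  + by rewrite Es Ec /= -!catA.
  + by rewrite Es.
  exists c2; first by exact: run_trans R2.
  by rewrite /= addnA -Es.
- move=> P p q [f h] t' n HP _ IH code pre post Ec c Hc.
  rewrite /= in HP.
  set tail := rcons (tcomp p (size pre).+1) (test predT (size pre + (tsize p + tsize q).+2) 0)
      ++ tcomp q (size pre + (tsize p).+2) ++ post.
  have E0 : code = pre ++ test P (size pre).+1 (size pre + (tsize p).+2) :: tail.
    by rewrite Ec /= -catA.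
  move: IH c Hc; rewrite {Ec}E0 => IH c Hc.
  have [c1 R1] := test_step (erefl _) Hc; rewrite HP => H1.
  set pre1 := rcons pre (test P (size pre).+1 (size pre + (tsize p).+2)).
  have S1 : size pre1 = (size pre).+1 by rewrite size_rcons.
  have [||c2 R2 H2] := IH _ pre1 (test predT (size pre + (tsize p + tsize q).+2) 0 ::
     tcomp q (size pre + (tsize p).+2) ++ post) _ c1.
  + by rewrite S1 /pre1 cat_rcons /tail cat_rcons.
  + by rewrite S1.
  (* The configurations are generalized first, as their type mentions the list that is now regrouped
     around the closing jump. *)
  move: c c1 c2 Hc R1 H1 R2 H2.
  have -> : pre ++ test P (size pre).+1 (size pre + (tsize p).+2) :: tail =
     (pre1 ++ tcomp p (size pre1)) ++ test predT (size pre + (tsize p + tsize q).+2) 0 ::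
       (tcomp q (size pre + (tsize p).+2) ++ post).
    by rewrite S1 /pre1 -catA cat_rcons /tail cat_rcons.
  move=> c c1 c2 Hc R1 H1 R2 H2.
  have [|c3 R3 H3] := test_step _ H2; first by rewrite size_cat size_tcomp.
  exists c3; last by rewrite /= in H3.
  apply: (run_trans (a := 1) R1); have := run_trans R2 R3; by rewrite addn1.
- move=> P p q [f h] t' n HP _ IH code pre post Ec c Hc.
  rewrite /= in HP.
  set tail := rcons (tcomp p (size pre).+1) (test predT (size pre + (tsize p + tsize q).+2) 0)
      ++ tcomp q (size pre + (tsize p).+2) ++ post.
  have E0 : code = pre ++ test P (size pre).+1 (size pre + (tsize p).+2) :: tail.
    by rewrite Ec /= -catA.
  move: IH c Hc; rewrite {Ec}E0 => IH c Hc.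
  have [c1 R1] := test_step (erefl _) Hc; rewrite (negbTE HP) => H1.
  set pre1 := pre ++ test P (size pre).+1 (size pre + (tsize p).+2) ::
     rcons (tcomp p (size pre).+1) (test predT (size pre + (tsize p + tsize q).+2) 0).
  have S1 : size pre1 = size pre + (tsize p).+2 by rewrite size_cat /= size_rcons size_tcomp; lia.
  have [||c2 R2 H2] := IH _ pre1 post _ c1.
  + by rewrite S1 /pre1 -catA.
  + by rewrite S1.
  exists c2; first exact: (run_trans (a := 1) R1).
  by move: H2; rewrite S1 -addnA.
- move=> P p [f h] t1 t2 n m HP _ IH1 _ IH2 code pre post Ec c Hc.
  rewrite /= in HP.
  have IH2' := IH2 _ _ _ Ec.
  set tail := rcons (tcomp p (size pre).+1) (test predT (size pre) 0) ++ post.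
  have E0 : code = pre ++ test P (size pre).+1 (size pre + (tsize p).+2) :: tail by rewrite Ec.
  move: IH1 c Hc IH2'; rewrite {Ec}E0 => IH c Hc IH2'.
  have [c1 R1] := test_step (erefl _) Hc; rewrite HP => H1.
  set pre1 := rcons pre (test P (size pre).+1 (size pre + (tsize p).+2)).
  have S1 : size pre1 = (size pre).+1 by rewrite size_rcons.
  have [||c2 R2 H2] := IH _ pre1 (test predT (size pre) 0 :: post) _ c1.
  + by rewrite S1 /pre1 cat_rcons /tail cat_rcons.
  + by rewrite S1.
  have [c3 R3 H3] : exists2 c3, run _ 1 c2 = Some c3 & conf c3 (pc _ (size pre)) t1.1 t1.2.
    move: c2 {R2} H2.
    have -> : pre ++ test P (size pre).+1 (size pre + (tsize p).+2) :: tail =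
       (pre1 ++ tcomp p (size pre1)) ++ test predT (size pre) 0 :: post.
      by rewrite S1 /pre1 -catA cat_rcons /tail cat_rcons.
    by move=> c2 H2; have [|c3 R3 H3] := test_step _ H2; [rewrite size_cat size_tcomp|exists c3].
  have [c4 R4 H4] := IH2' _ H3.
  exists c4 => //.
  apply: (run_trans (a := 1) R1); rewrite -addnS; apply: (run_trans R2).
  exact: (run_trans (a := 1) R3).
- move=> P p [f h] HP code pre post Ec c Hc.
  rewrite /= in HP.
  rewrite /= in Ec; move: c Hc; rewrite {}Ec => c Hc.
  have [c1 R1] := test_step (erefl _) Hc; rewrite (negbTE HP) => H1.
  by exists c1.
Qed.

Theorem texec_halt p w n f h :
  texec p (word_tape w, 0%R) n (f, h) ->
  exists c, [/\ run (tm_of (tcomp p 0)) n (init _ w) = Some c, halted c,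
     cf_cur c = f h & forall j, nth Blank (cf_right c) j = f (h + j.+1%:Z)%R].
Proof.
move=> X; have [||c R H] := @texec_run _ _ _ _ X (tcomp p 0) [::] [::] _ (init _ w).
- by rewrite cats0.
- have -> : pc (tcomp p 0) 0 = tm_start (tm_of (tcomp p 0)) by apply: val_inj; rewrite /= inordK.
  exact: init_conf.
rewrite [(f, h).1]/= [(f, h).2]/= in H; exists c; split=> //; last 2 first.
- by rewrite (conf_cur H).
- by move=> j; case: H => _ ->; rewrite /= addrAC subrr add0r.
case: H => E _; rewrite /halted E /= add0n /pc inordK ?size_tcomp //.
by rewrite drop_oversize ?size_tcomp.
Qed.


(** * Stack programs *)

Inductive sprog :=
| Skip
| Push of nat & bool
| Pop of nat
| Emit of bool
| Seq of sprog & sprog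
| Case of nat & sprog & sprog & sprog
| While of nat & sprog.

Definition state := ((nat -> seq bool) * seq bool)%type.

Inductive exec : sprog -> state -> nat -> state -> Prop :=
| ESkip s : exec Skip s 1 s
| EPush i b st out : exec (Push i b) (st, out) 1 (upd st i (b :: st i), out)
| EPop i st out : exec (Pop i) (st, out) 1 (upd st i (behead (st i)), out)
| EEmit b st out : exec (Emit b) (st, out) 1 (st, rcons out b)
| ESeq p q s s1 s2 n m : exec p s n s1 -> exec q s1 m s2 -> exec (Seq p q) s (n + m) s2
| ECase i p1 p0 pe s s' n :
    exec (match s.1 i with [::] => pe | true :: _ => p1 | false :: _ => p0 end) s n s' ->
    exec (Case i p1 p0 pe) s n.+1 s'
| EWhileT i p s s1 s2 n m : s.1 i <> [::] -> exec p s n s1 -> exec (While i p) s1 m s2 ->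
    exec (While i p) s (n + m).+1 s2
| EWhileF i p s : s.1 i = [::] -> exec (While i p) s 1 s.

Definition bnd (S : nat) (s : state) := size s.2 <= S /\ forall i, size (s.1 i) <= S.

(** An instruction lengthens a stack or the output by at most one bit, so time bounds space. *)
Lemma exec_bnd p s n s' S : exec p s n s' -> bnd S s -> bnd (S + n) s'.
Proof.
move=> X; elim: X S => {p s n s'}.
- by move=> s S [H1 H2]; split=> [|i]; [move: H1|move: (H2 i)]; lia.
- move=> i b st out S [/= H1 H2]; split=> [|j] /=; first by lia.
  by rewrite /upd; case: eqP => _ /=; [move: (H2 i)|move: (H2 j)]; lia.
- move=> i st out S [/= H1 H2]; split=> [|j] /=; first by lia.
  by rewrite /upd; case: eqP => _ /=; rewrite ?size_behead; [move: (H2 i)|move: (H2 j)]; lia.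
- move=> b st out S [/= H1 H2]; split=> [|j] /=; first by rewrite size_rcons; lia.
  by move: (H2 j); lia.
- by move=> p q s s1 s2 n m _ IH1 _ IH2 S /IH1 /IH2; rewrite addnA.
- move=> i p1 p0 pe s s' n _ IH S /IH [H1 H2]; split=> [|j]; first by lia.
  by move: (H2 j); lia.
- move=> i p s s1 s2 n m _ _ IH1 _ IH2 S /IH1 /IH2 [H1 H2]; split=> [|j]; first by lia.
  by move: (H2 j); lia.
- by move=> i p s _ S [H1 H2]; split=> [|j]; [lia|move: (H2 j); lia].
Qed.

Fixpoint sregs (p : sprog) : nat :=
  match p with
  | Skip | Emit _ => 0
  | Push i _ | Pop i => i.+1
  | Seq p q => maxn (sregs p) (sregs q)
  | Case i p q r => maxn i.+1 (maxn (sregs p) (maxn (sregs q) (sregs r)))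
  | While i p => maxn i.+1 (sregs p)
  end.

Definition texecB p t N t' := exists2 n, n <= N & texec p t n t'.

Lemma texecB_seq p q t t1 t2 n m N : texecB p t n t1 -> texecB q t1 m t2 -> n + m <= N ->
  texecB (TSeq p q) t N t2.
Proof.
move=> [a Ha Xa] [b Hb Xb] H; exists (a + b); last exact: XSeq Xb.
by apply: leq_trans H; apply: leq_add.
Qed.

Lemma texecB_ifT (P : pred Sym) p q t t' n N :
  P (t.1 t.2) -> texecB p t n t' -> n.+2 <= N -> texecB (TIf P p q) t N t'.
Proof. by move=> HP [a Ha X] H; exists a.+2; [lia|apply: XIfT]. Qed.

Lemma texecB_ifF (P : pred Sym) p q t t' n N :
  ~~ P (t.1 t.2) -> texecB q t n t' -> n.+1 <= N -> texecB (TIf P p q) t N t'.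
Proof. by move=> HP [a Ha X] H; exists a.+1; [lia|apply: XIfF]. Qed.

Lemma texecB_le p t n N t' : texecB p t n t' -> n <= N -> texecB p t N t'.
Proof. by move=> [a Ha X] H; exists a => //; apply: leq_trans H. Qed.

Lemma texec_seq_inv p q t x t2 : texec (TSeq p q) t x t2 ->
  exists n m t1, [/\ x = n + m, texec p t n t1 & texec q t1 m t2].
Proof.
move=> X; set r := TSeq p q in X; have E : r = TSeq p q by [].
case: X E => // p' q' u u1 u2 n m X1 X2 [<- <-].
by exists n, m, u1.
Qed.

Fixpoint tmv (mv : Move) (n : nat) : tprog :=
  if n is n'.+1 then TSeq (TAct (fun s => (s, mv))) (tmv mv n') else TAct (fun s => (s, MStay)).

Lemma tmv_exec mv n f h : texec (tmv mv n) (f, h) n.+1 (f, h + disp mv * n%:Z)%R.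
Proof.
elim: n h => [|n IH] h.
  have := XAct (fun s => (s, MStay)) (f, h).
  by rewrite /act /= upd_id mulr0 addr0.
have X := XAct (fun s => (s, mv)) (f, h); rewrite /act /= upd_id in X.
have := XSeq X (IH _); rewrite add1n.
by have -> : (h + disp mv + disp mv * n = h + disp mv * n.+1)%R by lia.
Qed.

Lemma tmvB mv n f h h' N : h' = (h + disp mv * n%:Z)%R -> n < N -> texecB (tmv mv n) (f, h) N (f, h').
Proof. by move=> -> H; exists n.+1 => //; apply: tmv_exec. Qed.

Definition nonblank : pred Sym := fun s => s != Blank.

Definition scan mv s := TWhile nonblank (tmv mv s).

Lemma scan_exec mv s n f h :
  (forall j, j < n -> f (h + disp mv * (s * j)%N%:Z)%R <> Blank) ->
  f (h + disp mv * (s * n)%N%:Z)%R = Blank ->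
  texec (scan mv s) (f, h) (n * s.+3).+1 (f, h + disp mv * (s * n)%N%:Z)%R.
Proof.
elim: n h => [|n IH] h Hn Hb.
  rewrite muln0 mulr0 addr0 in Hb *.
  by apply: XWhileF; rewrite /= Hb.
have E : forall j, (h + disp mv * s + disp mv * (s * j)%N = h + disp mv * (s * j.+1)%N)%R.
  by move=> j; rewrite mulnS; lia.
have -> : (n.+1 * s.+3).+1 = (s.+1 + (n * s.+3).+1).+2 by lia.
apply: (XWhileT _ (tmv_exec _ _ _ _)).
  by apply/eqP; have := Hn 0; rewrite muln0 mulr0 addr0; apply.
rewrite -E; apply: IH; last by rewrite E.
by move=> j Hj; rewrite E; apply: Hn.
Qed.

Lemma scanB mv s n f h h' N :
  (forall j, j < n -> f (h + disp mv * (s * j)%N%:Z)%R <> Blank) ->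
  h' = (h + disp mv * (s * n)%N%:Z)%R -> f h' = Blank -> n * s.+3 < N ->
  texecB (scan mv s) (f, h) N (f, h').
Proof. by move=> Hn -> Hb H; exists (n * s.+3).+1 => //; apply: scan_exec. Qed.

Definition twr (a : Sym) := TAct (fun _ => (a, MStay)).
Lemma twrB a f h N : 0 < N -> texecB (twr a) (f, h) N (upd f h a, h).
Proof. by move=> H; exists 1 => //; have := XAct (fun _ => (a, MStay)) (f, h); rewrite /act /= addr0. Qed.

(** * Simulation of several stacks on one tape *)

Section Compile.
Variable k : nat.
Hypothesis k0 : 0 < k.

(* Cell [j] (from the bottom) of stack [i] is at [col i j.+1]; the cells [col i 0], i.e. the
   positions -1, ..., -k, stay blank and delimit the stacks on one side and the word at the
   nonnegative positions on the other. *)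
Definition col (i j : nat) : int := Negz (j * k + i).

(** The bottom of each stack is nearest to the word, so that a push or pop changes one cell at the
    far end; hence [rev], the head of the list being the top. *)
Definition stape (s : state) (z : int) : Sym :=
  match z with
  | Posz j => nth Blank (map sym_of_bit s.2) j
  | Negz p => if p < k then Blank
              else nth Blank (map sym_of_bit (rev (s.1 (p %% k)))) (p %/ k).-1
  end.

Lemma stape0 s i : i < k -> stape s (col i 0) = Blank.
Proof. by move=> H; rewrite /col /= mul0n add0n H. Qed.

Lemma stapeS s i j : i < k -> stape s (col i j.+1) = nth Blank (map sym_of_bit (rev (s.1 i))) j.
Proof.
move=> H; rewrite /col /= ltnNge mulSn -addnA leq_addr /= addnA -mulSn.
by rewrite modnMDl modn_small // divnMDl // divn_small // addn0.
Qed.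

Lemma sym_of_bit_nonblank b : sym_of_bit b <> Blank. Proof. by case: b. Qed.

Lemma stape_nonblank s i j : i < k -> 0 < j <= size (s.1 i) -> stape s (col i j) <> Blank.
Proof.
case: j => // j H Hj; rewrite stapeS // (nth_map false) ?size_rev //.
exact: sym_of_bit_nonblank.
Qed.

Lemma stape_end s i : i < k -> stape s (col i (size (s.1 i)).+1) = Blank.
Proof. by move=> H; rewrite stapeS // nth_default // size_map size_rev. Qed.

Lemma stape_top s i b l : i < k -> s.1 i = b :: l -> stape s (col i (size (s.1 i))) = sym_of_bit b.
Proof.
move=> H E; rewrite E [size _]/= stapeS // E rev_cons map_rcons nth_rcons size_map size_rev.
by rewrite ltnn eqxx.
Qed.

Lemma col_eq i j p : i < k -> (Negz p == col i j) = (p %% k == i) && (p %/ k == j).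
Proof.
move=> H; apply/eqP/andP => [[->]|[/eqP <- /eqP <-]].
  by rewrite modnMDl modn_small // divnMDl // divn_small // addn0 !eqxx.
by rewrite /col -divn_eq.
Qed.

Lemma stape_push st out i b : i < k ->
  upd (stape (st, out)) (col i (size (st i)).+1) (sym_of_bit b) =
  stape (upd st i (b :: st i), out).
Proof.
move=> H; apply: functional_extensionality => -[j|p]; first by rewrite /upd.
rewrite {1}/upd col_eq //= /upd.
case: ltnP => Hp.
  by rewrite (divn_small Hp) andbF.
have D : 0 < p %/ k by rewrite divn_gt0.
case: eqP => //= E; case: eqP => E2; rewrite ?E rev_cons map_rcons nth_rcons size_map size_rev.
  by rewrite E2 /= ltnn eqxx.
case: ltnP => // Hs; rewrite nth_default ?size_map ?size_rev //.
by case: eqP => // E3; case: E2; lia.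
Qed.

Lemma stape_pop st out i : i < k -> 0 < size (st i) ->
  upd (stape (st, out)) (col i (size (st i))) Blank =
  stape (upd st i (behead (st i)), out).
Proof.
case E : (st i) => [|b l] // H _; apply: functional_extensionality => -[j|p]; first by rewrite /upd.
rewrite {1}/upd col_eq //= /upd.
case: ltnP => Hp.
  by rewrite (divn_small Hp) andbF.
have D : 0 < p %/ k by rewrite divn_gt0.
case: eqP => //= E1; case: eqP => E2.
  by rewrite E2 /= nth_default // size_map size_rev.
rewrite E1 E rev_cons map_rcons nth_rcons size_map size_rev; case: ltnP => // Hs.
rewrite [RHS]nth_default ?size_map ?size_rev //.
by case: eqP => // E3; case: E2; lia.
Qed.

Definition nav i := TSeq (tmv MLeft (k + i).+1) (scan MLeft k).
Definition back i := TSeq (scan MRight k) (tmv MRight i.+1).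
Definition top i := TSeq (nav i) (tmv MRight k).

(** Bounds a scan along a stack of height at most [M], a round of which takes [k + 3] steps. *)
Definition unit_cost M := (k + 3) * (M + 3).

Lemma k_lt_unit_cost M : k < unit_cost M.
Proof. by apply: (@leq_trans (k + 3)); [lia|rewrite leq_pmulr // addn3]. Qed.

Lemma navB s i M : i < k -> size (s.1 i) <= M ->
  texecB (nav i) (stape s, 0%R) (2 * unit_cost M) (stape s, col i (size (s.1 i)).+1).
Proof.
move=> H HM; apply: texecB_seq.
- by apply: tmvB (erefl _) (leqnn _).
- have -> : (0 + disp MLeft * ((k + i).+1)%:Z = col i 1)%R by rewrite /col /=; lia.
  apply: (@scanB _ _ (size (s.1 i))); last exact: leqnn.
  + move=> j Hj; have -> : (col i 1 + disp MLeft * (k * j)%N = col i j.+1)%R by rewrite /col /=; lia.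
    exact: stape_nonblank.
  + by rewrite /col /=; lia.
  + exact: stape_end.
- rewrite /unit_cost; nia.
Qed.

Lemma backB s i n M : i < k -> n <= size (s.1 i) -> size (s.1 i) <= M ->
  texecB (back i) (stape s, col i n) (2 * unit_cost M) (stape s, 0%R).
Proof.
move=> H Hn HM; apply: texecB_seq.
- apply: (@scanB _ _ n _ _ (col i 0)); last exact: leqnn.
  + move=> j Hj; have -> : (col i n + disp MRight * (k * j)%N = col i (n - j))%R by rewrite /col /=; nia.
    by apply: stape_nonblank => //; lia.
  + by rewrite /col /=; lia.
  + exact: stape0.
- by apply: (@tmvB _ i.+1); [rewrite /col /=; lia|exact: leqnn].
- rewrite /unit_cost; nia.
Qed.

Lemma topB s i M : i < k -> size (s.1 i) <= M ->
  texecB (top i) (stape s, 0%R) (3 * unit_cost M) (stape s, col i (size (s.1 i))).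
Proof.
move=> H HM; apply: texecB_seq (navB H HM) _ _.
  by apply: (@tmvB _ k); [rewrite /col /=; lia|exact: leqnn].
rewrite /unit_cost; nia.
Qed.

Definition emit b :=
  TSeq (scan MRight 1) (TSeq (twr (sym_of_bit b)) (TSeq (scan MLeft 1) (tmv MRight 1))).

Fixpoint scomp (p : sprog) : tprog :=
  match p with
  | Skip => tmv MStay 0
  | Push i b => TSeq (nav i) (TSeq (twr (sym_of_bit b)) (back i))
  | Pop i => TSeq (top i) (TIf nonblank (TSeq (twr Blank) (TSeq (tmv MRight k) (back i))) (back i))
  | Emit b => emit b
  | Seq p q => TSeq (scomp p) (scomp q)
  | Case i p1 p0 pe =>
      TSeq (top i) (TIf (pred1 S1) (TSeq (back i) (scomp p1))
                   (TIf (pred1 S0) (TSeq (back i) (scomp p0)) (TSeq (back i) (scomp pe))))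
  | While i p =>
      TSeq (top i) (TSeq (TWhile nonblank (TSeq (back i) (TSeq (scomp p) (top i)))) (back i))
  end.

Lemma stape_emit st out b :
  upd (stape (st, out)) (Posz (size out)) (sym_of_bit b) = stape (st, rcons out b).
Proof.
apply: functional_extensionality => -[j|p]; last by rewrite /upd.
rewrite /upd /= map_rcons nth_rcons size_map.
case: eqP => [[->]|N]; first by rewrite ltnn eqxx.
case: ltnP => // H; case: eqP => [E|_]; first by case: N; rewrite E.
by rewrite nth_default // size_map.
Qed.

Lemma stape_out_nonblank s j : j < size s.2 -> stape s (Posz j) <> Blank.
Proof. by move=> H; rewrite /= (nth_map false) //; apply: sym_of_bit_nonblank. Qed.

Lemma scanRoutB s M : size s.2 <= M ->
  texecB (scan MRight 1) (stape s, 0%R) (2 * unit_cost M) (stape s, Posz (size s.2)).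
Proof.
move=> HM; apply: (@scanB _ _ (size s.2)).
+ by move=> j Hj; rewrite add0r mul1r mul1n; apply: stape_out_nonblank.
+ by rewrite /=; lia.
+ by rewrite /= nth_default // size_map.
+ rewrite /unit_cost; nia.
Qed.

Lemma scanLoutB s n M : size s.2 <= M -> n < size s.2 ->
  texecB (TSeq (scan MLeft 1) (tmv MRight 1)) (stape s, Posz n) (3 * unit_cost M) (stape s, 0%R).
Proof.
move=> HM Hn; apply: texecB_seq.
+ apply: (@scanB _ _ n.+1 _ _ (- 1)%R); last exact: leqnn.
  - move=> j Hj; have -> : (n%:Z + disp MLeft * (1 * j)%N = (n - j)%N%:Z)%R by rewrite /=; lia.
    by apply: stape_out_nonblank; lia.
  - by rewrite /=; lia.
  - by rewrite /= k0.
+ by apply: (@tmvB _ 1) (leqnn _); rewrite /=; lia.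
+ rewrite /unit_cost; nia.
Qed.

Lemma emitB st out b M : size out < M ->
  texecB (emit b) (stape (st, out), 0%R) (6 * unit_cost M) (stape (st, rcons out b), 0%R).
Proof.
move=> HM; apply: texecB_seq; first by apply: (@scanRoutB _ M); rewrite /=; lia.
- apply: texecB_seq; first by apply: (@twrB _ _ _ 1).
  + rewrite stape_emit; apply: (@scanLoutB _ _ M); rewrite /= size_rcons; lia.
  + exact: leqnn.
- rewrite /unit_cost; nia.
Qed.

Local Arguments stape : simpl never.
(** The second conjunct is for the loop: on the tape, later rounds start at the top of stack [i] and
    not at position 0, so the induction hypothesis must be available from there. [M] dominates every
    size met during the run. *)
Lemma scomp_exec p s n s' : exec p s n s' -> sregs p <= k -> forall S M, bnd S s -> S + n <= M ->
  texecB (scomp p) (stape s, 0%R) (n * (12 * unit_cost M)) (stape s', 0%R) /\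
  forall i q, p = While i q ->
    texecB (TSeq (TWhile nonblank (TSeq (back i) (TSeq (scomp q) (top i)))) (back i))
      (stape s, col i (size (s.1 i))) (n * (12 * unit_cost M)) (stape s', 0%R).
Proof.
have U0 M : 9 <= unit_cost M by rewrite /unit_cost; nia.
elim=> {p s n s'}.
- move=> s _ S M _ _; split=> //.
  by apply: tmvB; [rewrite /=; lia|move: (U0 M); lia].
- move=> i b st out /= Hi S M [/= Hb1 Hb2] HM; split=> //.
  have H2 := Hb2 i; have H3 : size (st i) < M by lia.
  apply: texecB_seq; first by apply: (@navB (st, out) i M) => //=; lia.
  + apply: texecB_seq; first by apply: (@twrB _ _ _ 1).
    * rewrite stape_push //; apply: (@backB _ _ _ M) => //=; rewrite /upd eqxx //=.
    * exact: leqnn.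
  + move: (U0 M); lia.
- move=> i st out /= Hi S M [/= Hb1 Hb2] HM; split=> //.
  have H2 := Hb2 i; have H3 : size (st i) < M by lia.
  apply: texecB_seq; first by apply: (@topB (st, out) i M) => //=; lia.
  + case: (posnP (size (st i))) => E.
    * apply: (@texecB_ifF _ _ _ _ _ (2 * unit_cost M) (5 * unit_cost M)); last by move: (U0 M); lia.
        by rewrite /= E negbK stape0.
      have -> : upd st i (behead (st i)) = st by rewrite (size0nil E) -[RHS](upd_id _ i) (size0nil E).
      apply: (@backB (st, out) i _ M) => //=; lia.
    * apply: (@texecB_ifT _ _ _ _ _ (1 + (unit_cost M + 2 * unit_cost M)) (5 * unit_cost M));
        last by move: (U0 M); lia.
        by apply/eqP/stape_nonblank => //=; lia.
      apply: texecB_seq; first by apply: (@twrB _ _ _ 1).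
      - rewrite stape_pop //; apply: texecB_seq.
        + apply: (@tmvB _ k _ _ (col i (size (st i)).-1)); last exact: k_lt_unit_cost.
          by rewrite /col /=; nia.
        + by apply: (@backB _ i _ M) => //=; rewrite /upd eqxx size_behead; lia.
        + exact: leqnn.
      - exact: leqnn.
  + move: (U0 M); lia.
- move=> b st out _ S M [/= Hb1 Hb2] HM; split=> //.
  apply: texecB_le; first by apply: (@emitB _ _ _ M); lia.
  lia.
- move=> p q s s1 s2 n m X1 IH1 X2 IH2; rewrite /= geq_max => /andP[R1 R2] S M Hb HM; split=> //.
  have [|H1 _] := IH1 R1 S M Hb; first by lia.
  have [|H2 _] := IH2 R2 (S + n) M (exec_bnd X1 Hb); first by lia.
  by apply: texecB_seq H1 H2 _; lia.
- move=> i p1 p0 pe s s' n X IH; rewrite /= !geq_max => /and4P[Ri R1 R0 Re] S M Hb HM; split=> //.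
  have Hi := Hb.2 i.
  apply: texecB_seq; first by apply: (@topB s i M) => //; lia.
  + have HB : forall p, texecB (scomp p) (stape s, 0%R) (n * (12 * unit_cost M)) (stape s', 0%R) ->
        texecB (TSeq (back i) (scomp p)) (stape s, col i (size (s.1 i)))
          (2 * unit_cost M + n * (12 * unit_cost M)) (stape s', 0%R).
      move=> p Hp; apply: (texecB_seq _ Hp (leqnn _)); apply: backB => //; lia.
    case E : (s.1 i) IH => [|[] l] IH.
    * apply: (@texecB_ifF _ _ _ _ _ (4 * unit_cost M + n * (12 * unit_cost M))); last exact: leqnn.
        by rewrite /= stape0.
      apply: texecB_ifF; first by rewrite /= stape0.
        by rewrite -E; apply: HB; have [|? _] := IH Re S M Hb; [lia|].
      by move: (U0 M); lia.
    * apply: (@texecB_ifT _ _ _ _ _ (4 * unit_cost M + n * (12 * unit_cost M)).-1); last by move: (U0 M); lia.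
        by rewrite -E /= (stape_top _ E).
      apply: texecB_le; first by rewrite -E; apply: HB; have [|? _] := IH R1 S M Hb; [lia|].
      by move: (U0 M); lia.
    * apply: (@texecB_ifF _ _ _ _ _ (4 * unit_cost M + n * (12 * unit_cost M))); last exact: leqnn.
        by rewrite -E /= (stape_top _ E).
      apply: texecB_ifT; first by rewrite -E /= (stape_top _ E).
        by rewrite -E; apply: HB; have [|? _] := IH R0 S M Hb; [lia|].
      by move: (U0 M); lia.
  + move: (U0 M); lia.
- move=> i p s s1 s2 n m Hne X1 IH1 X2 IH2 R S M Hb HM.
  have Ri : i < k by move: R; rewrite /= geq_max => /andP[].
  have Rp : sregs p <= k by move: R; rewrite /= geq_max => /andP[].
  have Hi := Hb.2 i.
  have Hb1 := exec_bnd X1 Hb; have Hi1 := Hb1.2 i.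
  have [|H1 _] := IH1 Rp S M Hb; first by lia.
  have [|_ H2] := IH2 R (S + n) M Hb1; first by lia.
  have {H2} [x Hx X] := H2 _ _ (erefl _).
  have L : texecB (TSeq (TWhile nonblank (TSeq (back i) (TSeq (scomp p) (top i)))) (back i))
      (stape s, col i (size (s.1 i))) ((n + m) * (12 * unit_cost M) + 6 * unit_cost M) (stape s2, 0%R).
    (* The remaining rounds are separated from the final [back], so that one more round can be put
       in front of the loop. *)
    have [a [b [u [Ex Y1 Y2]]]] := texec_seq_inv X.
    have [y Hy Y] : texecB (TSeq (back i) (TSeq (scomp p) (top i)))
        (stape s, col i (size (s.1 i))) (n * (12 * unit_cost M) + 5 * unit_cost M)
        (stape s1, col i (size (s1.1 i))).
      apply: texecB_seq; first by apply: (@backB s i _ M) => //; lia.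
        apply: texecB_seq H1 _ (leqnn _); apply: (@topB s1 i M) => //; lia.
      lia.
    exists ((y + a).+2 + b); last first.
      apply: XSeq Y2; apply: XWhileT Y Y1.
      by apply/eqP/stape_nonblank => //; rewrite leqnn andbT; case: (s.1 i) Hne.
    rewrite mulnDl; move: (U0 M) Hx Hy; rewrite Ex; lia.
  split.
  + apply: texecB_seq L _; first by apply: (@topB s i M) => //; lia.
    lia.
  + by move=> i' q [<- <-]; apply: texecB_le L _; lia.
- move=> i p s Hs R S M Hb HM; have HsM : size (s.1 i) <= M by rewrite Hs.
  have Ri : i < k by move: R; rewrite /= geq_max => /andP[].
  have L : texecB (TSeq (TWhile nonblank (TSeq (back i) (TSeq (scomp p) (top i)))) (back i))
      (stape s, col i (size (s.1 i))) (3 * unit_cost M) (stape s, 0%R).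
    have [b Hb' Y] := @backB s i (size (s.1 i)) M Ri (leqnn _) HsM.
    exists (1 + b); last first.
      by apply: XSeq Y; apply: XWhileF; rewrite /= Hs stape0.
    move: (U0 M); lia.
  split.
  + apply: texecB_seq L _; first exact: (@topB s i M).
    lia.
  + by move=> i' q [<- <-]; apply: texecB_le L _; lia.
Qed.

Definition load_bit b :=
  TSeq (twr Blank) (TSeq (tmv MLeft 1) (TSeq (TSeq (scan MLeft 1) (tmv MRight 1)) (scomp (Push 0 b)))).
(** The input is consumed from its end, so that its first bit finishes on top of stack 0 and the
    word area is left empty for the output. *)
Definition load : tprog :=
  TWhile nonblank (TSeq (scan MRight 1) (TSeq (tmv MLeft 1) (TIf (pred1 S1) (load_bit true) (load_bit false)))).

Lemma load_bitB st out b b' S M : bnd S (st, out) -> S < M ->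
  texecB (load_bit b) (stape (st, rcons out b'), Posz (size out)) (20 * unit_cost M)
    (stape (upd st 0 (b :: st 0), out), 0%R).
Proof.
move=> Hb HS; have U0 : 9 <= unit_cost M by rewrite /unit_cost; nia.
have HM : size out <= S by case: Hb.
apply: texecB_seq; first by apply: (@twrB _ _ _ 1).
- have -> : upd (stape (st, rcons out b')) (Posz (size out)) Blank = stape (st, out).
    rewrite -stape_emit; apply: functional_extensionality => z; rewrite /upd; case: eqP => // ->.
    by rewrite /stape /= nth_default // size_map.
  apply: texecB_seq; first by apply: (@tmvB _ 1) (leqnn _).
  + apply: (@texecB_seq _ _ _ (stape (st, out), 0%R)).
    * apply: texecB_seq.
      - apply: (@scanB _ _ (size out) _ _ (- 1)%R); last exact: leqnn.
        + move=> j Hj.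
          have -> : ((size out)%:Z + disp MLeft * 1%N%:Z + disp MLeft * (1 * j)%N =
                     ((size out).-1 - j)%N%:Z)%R by rewrite /=; lia.
          by apply: stape_out_nonblank => /=; lia.
        + by rewrite /=; lia.
        + by rewrite /stape /= k0.
      - by apply: (@tmvB _ 1) (leqnn _); rewrite /=; lia.
      - exact: leqnn.
    * by have [||H _] := scomp_exec (EPush 0 b st out) _ Hb (M := M); [|lia|exact: H].
    * exact: leqnn.
  + exact: leqnn.
- rewrite /unit_cost; nia.
Qed.

Lemma loadB st out S M : bnd S (st, out) -> S + size out <= M ->
  texecB load (stape (st, out), 0%R) ((size out).+1 * (30 * unit_cost M))
    (stape (upd st 0 (out ++ st 0), [::]), 0%R).
Proof.
have U0 : 9 <= unit_cost M by rewrite /unit_cost; nia.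
elim/last_ind: out st S => [|out b IH] st S Hb HS.
  exists 1; first by lia.
  by rewrite /= upd_id; apply: XWhileF; rewrite /= /stape.
have HM : size out < S by case: Hb; rewrite /= size_rcons.
have Hb' : bnd S (st, out) by split; [exact: ltnW|exact: Hb.2].
rewrite size_rcons in HS.
have Hu : upd st 0 (rcons out b ++ st 0) = upd (upd st 0 (b :: st 0)) 0 (out ++ (upd st 0 (b :: st 0)) 0).
  by apply: functional_extensionality => i; rewrite /upd cat_rcons; case: eqP.
have [y Hy Y] : texecB load (stape (upd st 0 (b :: st 0), out), 0%R) ((size out).+1 * (30 * unit_cost M))
    (stape (upd st 0 (rcons out b ++ st 0), [::]), 0%R).
  rewrite Hu; apply: (IH _ S.+1); last by lia.
  split=> [|i] /=; first by lia.
  by rewrite /upd; case: eqP => _ /=; [move: (Hb.2 0)|move: (Hb.2 i)] => /=; lia.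
have [x Hx X] : texecB (TSeq (scan MRight 1) (TSeq (tmv MLeft 1) (TIf (pred1 S1) (load_bit true) (load_bit false))))
  (stape (st, rcons out b), 0%R) (28 * unit_cost M) (stape (upd st 0 (b :: st 0), out), 0%R).
  apply: texecB_seq; first by apply: (@scanRoutB (st, rcons out b) M); rewrite /= size_rcons; lia.
  - apply: texecB_seq.
    + by apply: (@tmvB _ 1 _ _ (Posz (size out)) 2) => //; rewrite /= size_rcons; lia.
    + have Eb : stape (st, rcons out b) (Posz (size out)) = sym_of_bit b.
        by rewrite -stape_emit /upd eqxx.
      have L b' : texecB (load_bit b') (stape (st, rcons out b), Posz (size out)) (20 * unit_cost M)
        (stape (upd st 0 (b' :: st 0), out), 0%R) by apply: load_bitB Hb' _; lia.
      case: b Eb L {Hb Hy Y Hu} => Eb L.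
      * by apply: texecB_ifT (L true) (leqnn _); rewrite /= Eb.
      * apply: (@texecB_ifF _ _ _ _ _ (20 * unit_cost M) (20 * unit_cost M).+2 _ (L false)); last by [].
        by rewrite /= Eb.
    + exact: leqnn.
  - lia.
exists (x + y).+2; first by rewrite size_rcons; lia.
apply: XWhileT X Y; apply/eqP; rewrite [_.1 _]/=.
by apply: (@stape_out_nonblank (st, rcons out b)); rewrite size_rcons.
Qed.

End Compile.

(** * Polynomial bounds *)

(** The base is at least 2, so constants, sums and factors are absorbed by the exponent, with no
    exception at 0. *)
Definition is_poly (f : nat -> nat) := exists k, forall n, f n <= n.+2 ^ k.

Lemma is_poly_le f g : (forall n, f n <= g n) -> is_poly g -> is_poly f.
Proof. by move=> H [k Hk]; exists k => n; apply: leq_trans (H n) (Hk n). Qed.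

Lemma leq_expl a b e : a <= b -> a ^ e <= b ^ e.
Proof. by case: e => // e H; rewrite leq_exp2r. Qed.

Lemma is_poly_const c : is_poly (fun _ => c).
Proof.
by exists c => n; apply: leq_trans (ltnW (ltn_expl c (ltnSn 1))) _; apply: leq_expl.
Qed.

Lemma is_poly_id : is_poly (fun n => n).
Proof. by exists 1 => n; rewrite expn1; lia. Qed.

Lemma is_poly_add f g : is_poly f -> is_poly g -> is_poly (fun n => f n + g n).
Proof.
move=> [k Hk] [l Hl]; exists (k + l).+1 => n.
have H1 : n.+2 ^ k <= n.+2 ^ (k + l) by apply: leq_pexp2l => //; lia.
have H2 : n.+2 ^ l <= n.+2 ^ (k + l) by apply: leq_pexp2l => //; lia.
apply: leq_trans (leq_add (leq_trans (Hk n) H1) (leq_trans (Hl n) H2)) _.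
by rewrite addnn -mul2n expnS leq_mul2r orbT.
Qed.

Lemma is_poly_mul f g : is_poly f -> is_poly g -> is_poly (fun n => f n * g n).
Proof. by move=> [k Hk] [l Hl]; exists (k + l) => n; rewrite expnD leq_mul. Qed.

Lemma is_poly_comp f g : is_poly f -> is_poly g -> is_poly (fun n => f (g n)).
Proof.
(* [g n + 2] is at most 4 times [n.+2 ^ l], and two more factors [n.+2] absorb the 4. *)
move=> [k Hk] [l Hl]; exists (l.+2 * k) => n; apply: leq_trans (Hk _) _.
rewrite expnM; apply: leq_expl; rewrite !expnS; move: (Hl n).
have : 0 < n.+2 ^ l by rewrite expn_gt0.
set y := _ ^ _ => Hy Hg; have : 2 * (2 * y) <= n.+2 * (n.+2 * y) by rewrite !leq_mul.
lia.
Qed.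

Lemma is_poly_bound f : is_poly f -> exists d, forall n, f n <= Defs.poly d n.
Proof.
(* For positive arguments [n + 2] is at most [3 * n], which asks for the coefficient [3 ^ k] and the
   exponent [k]; one number has to serve as both. *)
move=> [k Hk]; exists (3 ^ k + k) => n; apply: leq_trans (Hk n) _; rewrite /Defs.poly.
case: n => [|n].
  have : 2 ^ k <= 3 ^ k by apply: leq_expl.
  lia.
have H1 : n.+3 ^ k <= 3 ^ k * n.+1 ^ k by rewrite -expnMn; apply: leq_expl; lia.
have H2 : n.+1 ^ k <= n.+1 ^ (3 ^ k + k) by apply: leq_pexp2l => //; lia.
nia.
Qed.

(** Index [size w] is included: the blank found there stops the reading. *)
Lemma read_bits_map w v : (forall i, i <= size w -> nth Blank v i = nth Blank (map sym_of_bit w) i) ->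
  read_bits v = w.
Proof.
elim: w v => [|b w IH] v H.
  by have := H 0 (leqnn _) => /=; case: v {H} => //= a v ->.
case: v H => [|a v] H; first by have := H 0 isT; case: b {H}.
have IHv : read_bits v = w by apply: IH => i Hi; apply: (H i.+1).
by have /= -> := H 0 isT; case: b {H} => /=; rewrite IHv.
Qed.

Theorem stack_polytime p f c : is_poly c ->
  (forall x, exists n st, n <= c (size x) /\ exec p (upd (fun=> [::]) 0 x, [::]) n (st, f x)) ->
  polytime_computable f.
Proof.
move=> Pc Hp; set k := (sregs p).+1.
pose time := fun N => N.+1 * (30 * unit_cost k (2 * N)) + c N * (12 * unit_cost k (N + c N)).
have [d Hd] : exists d, forall n, time n <= Defs.poly d n.
  apply: is_poly_bound; rewrite /time /unit_cost.
  have PS : is_poly S by apply: (is_poly_le (g := fun n => n + 1)); [move=> n; lia|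
     apply: is_poly_add is_poly_id (is_poly_const _)].
  by repeat (apply: is_poly_add || apply: is_poly_mul || apply: is_poly_const || apply: Pc || apply: PS || apply: is_poly_id).
exists (tm_of (tcomp (TSeq (load k) (scomp k p)) 0)), d => x.
have [n [st [Hn X]]] := Hp x.
have Hb : bnd (size x) (fun=> [::], x) by split.
have k0 : 0 < k by [].
have [a Ha Xa] := @loadB k k0 _ _ _ (2 * size x) Hb ltac:(lia).
rewrite /= cats0 in Xa.
have Hb2 : bnd (size x) (upd (fun=> [::]) 0 x, [::]) by split=> // i /=; rewrite /upd; case: eqP.
have [|[b Hb' Xb] _] := scomp_exec k0 X _ Hb2 (leqnn _); first exact: leqnSn.
have T0 : word_tape (enc x) = stape k (fun=> [::], x).
  apply: functional_extensionality => -[j|j] //=; by rewrite /stape /=; case: ifP => //; rewrite nth_nil.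
have XX := XSeq Xa Xb; rewrite -T0 in XX.
have [cf [R Hh Hc Hr]] := texec_halt XX.
exists (a + b), cf; split; last split=> //; last split=> //.
  apply: leq_trans (Hd _); rewrite /time; apply: leq_add => //.
  by apply: leq_trans Hb' _; rewrite /unit_cost !(leq_mul, leq_add).
rewrite /output; apply: read_bits_map => -[|i] Hi /=; first by rewrite Hc.
by rewrite Hr.
Qed.


(** * A language of bounded nested loops *)

Inductive expr :=
| EC of nat
| EV of nat
| EAdd of expr & expr
| EMul of expr & expr
| ESub of expr & expr
| EBit of expr
| ESize.

Fixpoint eval (x : seq bool) (rho : nat -> nat) (e : expr) : nat :=
  match e with
  | EC c => c
  | EV v => rho v
  | EAdd a b => eval x rho a + eval x rho b
  | EMul a b => eval x rho a * eval x rho b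
  | ESub a b => eval x rho a - eval x rho b
  | EBit a => nth false x (eval x rho a)
  | ESize => size x
  end.

(** Variables are bound by loops only and the bound of a loop is evaluated once, so for a fixed
    program all values and the running time are polynomial in the input size. *)
Inductive gen :=
| GNil
| GOut of expr
| GSeq of gen & gen
| GFor of nat & expr & gen.

Fixpoint gden (x : seq bool) (rho : nat -> nat) (g : gen) : seq bool :=
  match g with
  | GNil => [::]
  | GOut e => [:: eval x rho e != 0]
  | GSeq g1 g2 => gden x rho g1 ++ gden x rho g2
  | GFor v e g => flatten [seq gden x (upd rho v i) g | i <- iota 0 (eval x rho e)]
  end.

Fixpoint evars (e : expr) : nat :=
  match e with
  | EC _ | ESize => 0
  | EV v => v.+1
  | EAdd a b | EMul a b | ESub a b => maxn (evars a) (evars b)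
  | EBit a => evars a
  end.

Fixpoint gvars (g : gen) : nat :=
  match g with
  | GNil => 0
  | GOut e => evars e
  | GSeq g1 g2 => maxn (gvars g1) (gvars g2)
  | GFor v e g => maxn v.+1 (maxn (evars e) (gvars g))
  end.

Definition execB p s N s' := exists2 n, n <= N & exec p s n s'.

Lemma execB_le p s n N s' : execB p s n s' -> n <= N -> execB p s N s'.
Proof. by move=> [a Ha X] H; exists a => //; apply: leq_trans H. Qed.

Lemma execB_eq p s N s' s1 : execB p s N s1 -> s1 = s' -> execB p s N s'.
Proof. by move=> H <-. Qed.

Lemma execB_eq' p s s1 N s' : s1 = s -> execB p s N s' -> execB p s1 N s'.
Proof. by move=> ->. Qed.

Lemma execB_seq p q s s1 s2 n m : execB p s n s1 -> execB q s1 m s2 ->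
  execB (Seq p q) s (n + m) s2.
Proof. by move=> [a Ha Xa] [b Hb Xb]; exists (a + b); [apply: leq_add|apply: ESeq Xb]. Qed.

Lemma execB_push i b st out : execB (Push i b) (st, out) 1 (upd st i (b :: st i), out).
Proof. by exists 1 => //; constructor. Qed.

Lemma execB_pop i st out : execB (Pop i) (st, out) 1 (upd st i (behead (st i)), out).
Proof. by exists 1 => //; constructor. Qed.

Lemma execB_emit b st out : execB (Emit b) (st, out) 1 (st, rcons out b).
Proof. by exists 1 => //; constructor. Qed.

Lemma execB_skip s : execB Skip s 1 s.
Proof. by exists 1 => //; constructor. Qed.

Lemma execB_case i p1 p0 pe s s' N :
  execB (match s.1 i with [::] => pe | true :: _ => p1 | false :: _ => p0 end) s N s' ->
  execB (Case i p1 p0 pe) s N.+1 s'.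
Proof. by move=> [a Ha Xa]; exists a.+1 => //; constructor. Qed.

(** [F j] is the state after [j] rounds; the register loops below are verified by exhibiting such an
    [F]. *)
Lemma execB_loop i p (F : nat -> state) n N :
  (forall j, j < n -> (F j).1 i <> [::]) -> (F n).1 i = [::] ->
  (forall j, j < n -> execB p (F j) N (F j.+1)) ->
  execB (While i p) (F 0) (n * N.+1 + 1) (F n).
Proof.
elim: n F => [|n IH] F Hne He Hp; first by exists 1 => //; constructor.
have [a Ha Xa] := Hp 0 isT.
have [|||b Hb Xb] := IH (fun j => F j.+1); [by move=> j; apply: (Hne j.+1)|by []|by move=> j; apply: (Hp j.+1)|].
exists (a + b).+1; first by rewrite mulSn; lia.
by apply: EWhileT Xb => //; apply: Hne.
Qed.

Lemma execB_loop' i p (F : nat -> state) n N s s' :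
  (forall j, j < n -> (F j).1 i <> [::]) -> (F n).1 i = [::] ->
  (forall j, j < n -> execB p (F j) N (F j.+1)) -> s = F 0 -> F n = s' ->
  execB (While i p) s (n * N.+1 + 1) s'.
Proof. by move=> H1 H2 H3 -> <-; apply: execB_loop. Qed.

Definition un (n : nat) : seq bool := nseq n true.

Lemma behead_un n : behead (un n) = un n.-1. Proof. by case: n. Qed.
Lemma un_neq0 n : 0 < n -> un n <> [::]. Proof. by case: n. Qed.

Ltac eqs := repeat (case: eqP => [?|?]; try subst); try done; try congruence; try lia.

Definition clear a := While a (Pop a).

Lemma clearB a st out : execB (clear a) (st, out) (size (st a) * 2 + 1) (upd st a [::], out).
Proof.
apply: (@execB_loop' _ _ (fun j => (upd st a (drop j (st a)), out))).
- by move=> j Hj /=; rewrite /upd eqxx => /(congr1 size); rewrite size_drop /=; lia.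
- by rewrite /= /upd eqxx drop_size.
- move=> j Hj; apply: execB_eq (execB_pop _ _ _) _; congr pair.
  apply: functional_extensionality => r; rewrite /upd eqxx; case: eqP => // _.
  by rewrite -drop1 drop_drop.
- by rewrite drop0 upd_id.
- by rewrite drop_size.
Qed.

Definition pmove a b := While a (Seq (Pop a) (Push b true)).

Lemma pmoveB a b n st out : a <> b -> st a = un n ->
  execB (pmove a b) (st, out) (n * 3 + 1) (upd (upd st b (un n ++ st b)) a [::], out).
Proof.
move=> ab Ha; apply: (@execB_loop' _ _ (fun j => (upd (upd st b (un j ++ st b)) a (un (n - j)), out))).
- by move=> j Hj /=; rewrite /upd eqxx; apply: un_neq0; lia.
- by rewrite /= /upd eqxx subnn.
- move=> j Hj; apply: execB_eq (execB_seq (execB_pop _ _ _) (execB_push _ _ _ _)) _.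
  congr pair; apply: functional_extensionality => r; rewrite /upd !eqxx behead_un.
  have -> : (n - j).-1 = n - j.+1 by lia.
  by repeat case: eqP => //; congruence.
- congr pair; apply: functional_extensionality => r; rewrite /upd subn0 -Ha.
  by repeat case: eqP => [->|] //.
- by rewrite subnn.
Qed.

Definition padd a b t := Seq (While a (Seq (Pop a) (Seq (Push b true) (Push t true)))) (pmove t a).

Lemma paddB a b t n d st out : a <> b -> a <> t -> b <> t -> st a = un n -> st b = un d -> st t = [::] ->
  execB (padd a b t) (st, out) (n * 7 + 2) (upd st b (un (n + d)), out).
Proof.
move=> ab aT bt Ha Hb Ht.
have -> : n * 7 + 2 = (n * 4 + 1) + (n * 3 + 1) by lia.
apply: (@execB_seq _ _ _ (upd (upd (upd st b (un (n + d))) t (un n)) a [::], out)).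
- apply: (@execB_loop' _ _ (fun j => (upd (upd (upd st b (un (j + d))) t (un j)) a (un (n - j)), out))).
  + by move=> j Hj /=; rewrite /upd eqxx; apply: un_neq0; lia.
  + by rewrite /= /upd eqxx subnn.
  + move=> j Hj; apply: execB_eq (execB_seq (execB_pop _ _ _) (execB_seq (execB_push _ _ _ _) (execB_push _ _ _ _))) _.
    congr pair; apply: functional_extensionality => r; rewrite /upd !eqxx behead_un.
    have -> : (n - j).-1 = n - j.+1 by lia.
    by repeat case: eqP => //; congruence.
  + congr pair; apply: functional_extensionality => r; rewrite /upd subn0 add0n -[un 0]/(@nil bool) -Ha -Hb -Ht.
    by repeat case: eqP => [->|] //.
  + by rewrite subnn.
- apply: execB_eq (pmoveB (n := n) _ _ _) _; first by congruence.
    by rewrite /upd; repeat case: eqP => //; congruence.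
  congr pair; apply: functional_extensionality => r; rewrite /upd eqxx cats0.
  by repeat case: eqP; congruence.
Qed.

Definition shift a b :=
  Case a (Seq (Pop a) (Push b true)) (Seq (Pop a) (Push b false)) Skip.

Lemma shiftB a b st out : a <> b ->
  execB (shift a b) (st, out) 3 (upd (upd st b (take 1 (st a) ++ st b)) a (behead (st a)), out).
Proof.
move=> ab; apply: execB_case => /=; case E : (st a) => [|[] l].
- apply: execB_le (execB_eq (execB_skip _) _) _ => //.
  by rewrite /= upd_id -E upd_id.
- apply: execB_eq (execB_seq (execB_pop _ _ _) (execB_push _ _ _ _)) _.
  congr pair; apply: functional_extensionality => r; rewrite /upd E /= take0.
  by repeat case: eqP => //; congruence.
- apply: execB_eq (execB_seq (execB_pop _ _ _) (execB_push _ _ _ _)) _.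
  congr pair; apply: functional_extensionality => r; rewrite /upd E /= take0.
  by repeat case: eqP => //; congruence.
Qed.

Lemma take1_drop_rev T (s : seq T) j : take 1 (drop j s) ++ rev (take j s) = rev (take j.+1 s).
Proof. by rewrite -[in RHS]addn1 takeD rev_cat; case: (drop j s) => [|x [|y l]]. Qed.

Definition shiftall a b := While a (shift a b).

Lemma shiftallB a b st out : a <> b ->
  execB (shiftall a b) (st, out) (size (st a) * 4 + 1) (upd (upd st b (rev (st a) ++ st b)) a [::], out).
Proof.
move=> ab; apply: (@execB_loop' _ _
  (fun j => (upd (upd st b (rev (take j (st a)) ++ st b)) a (drop j (st a)), out))).
- by move=> j Hj /=; rewrite /upd eqxx => /(congr1 size); rewrite size_drop /=; lia.
- by rewrite /= /upd eqxx drop_size.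
- move=> j Hj; apply: execB_eq (shiftB _ _ ab) _; congr pair.
  apply: functional_extensionality => r; rewrite /upd !eqxx.
  case: eqP => [|_]; last by rewrite -take1_drop_rev -catA; repeat case: eqP => //; congruence.
  by rewrite -drop1 drop_drop.
- by rewrite take0 drop0 /= upd_id upd_id.
- by rewrite drop_size take_size.
Qed.

(* Register 0 holds the input and register 1 is empty; register [2 + v] holds variable [v] in
   unary; the registers from [t] on are free. *)
Definition inv x (rho : nat -> nat) V t (st : nat -> seq bool) :=
  [/\ st 0 = x, st 1 = [::], forall v, v < V -> st (2 + v) = un (rho v) & forall r, t <= r -> st r = [::]].

Lemma inv_upd x rho V t t' st l : V + 2 <= t -> t < t' -> inv x rho V t st -> inv x rho V t' (upd st t l).
Proof.
move=> HV Ht [H0 H1 Hv Hr]; split.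
- by rewrite /upd; case: eqP => //; lia.
- by rewrite /upd; case: eqP => //; lia.
- by move=> v Hvv; rewrite /upd; case: eqP => [|_]; [lia|apply: Hv].
- by move=> r Hrr; rewrite /upd; case: eqP => [|_]; [lia|apply: Hr; lia].
Qed.

Fixpoint push_un t c := if c is c'.+1 then Seq (push_un t c') (Push t true) else Skip.

(** Popping an empty stack does nothing, which makes subtraction truncated. An input bit is read by
    shifting the bits before it to register 1, testing the top of register 0 and shifting back; past
    the end register 0 is empty and the value is 0. *)
Fixpoint ce (t : nat) (e : expr) : sprog :=
  match e with
  | EC c => push_un t c
  | EV v => padd (2 + v) t t.+1
  | EAdd a b => Seq (ce t a) (Seq (ce t.+1 b) (pmove t.+1 t))
  | EMul a b => Seq (ce t.+1 a) (Seq (ce t.+2 b)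
       (Seq (While t.+1 (Seq (Pop t.+1) (padd t.+2 t t.+3))) (clear t.+2)))
  | ESub a b => Seq (ce t a) (Seq (ce t.+1 b) (While t.+1 (Seq (Pop t.+1) (Pop t))))
  | EBit a => Seq (ce t.+1 a) (Seq (While t.+1 (Seq (Pop t.+1) (shift 0 1)))
       (Seq (Case 0 (Push t true) Skip Skip) (shiftall 1 0)))
  | ESize => Seq (While 0 (Seq (Push t true) (shift 0 1))) (shiftall 1 0)
  end.

Definition below (V M : nat) (rho : nat -> nat) := forall v, v < V -> rho v <= M.

Lemma eval_bound e : exists2 c, is_poly c &
  forall x rho V M, evars e <= V -> below V M rho -> size x <= M -> eval x rho e <= c M.
Proof.
elim: e => [c|v|a [ca Pa IHa] b [cb Pb IHb]|a [ca Pa IHa] b [cb Pb IHb]|a [ca Pa IHa] b [cb Pb IHb]|a _|] /=.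
- by exists (fun _ => c) => //; apply: is_poly_const.
- by exists (fun M => M) => [|x rho V M Hv Hr _]; [apply: is_poly_id|apply: Hr].
- exists (fun M => ca M + cb M); first exact: is_poly_add.
  move=> x rho V M; rewrite geq_max => /andP[Ha Hb] Hr Hx.
  by apply: leq_add; [apply: IHa Hr Hx|apply: IHb Hr Hx].
- exists (fun M => ca M * cb M); first exact: is_poly_mul.
  move=> x rho V M; rewrite geq_max => /andP[Ha Hb] Hr Hx.
  by apply: leq_mul; [apply: IHa Hr Hx|apply: IHb Hr Hx].
- exists ca => // x rho V M; rewrite geq_max => /andP[Ha Hb] Hr Hx.
  by apply: leq_trans (leq_subr _ _) _; apply: IHa Hr Hx.
- by exists (fun _ => 1) => [|x rho V M _ _ _]; [apply: is_poly_const|case: nth].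
- by exists (fun M => M) => [|x rho V M _ _ Hx]; [apply: is_poly_id|].
Qed.

Ltac poly_tac := repeat (apply: is_poly_add || apply: is_poly_mul || apply: is_poly_const
  || apply: is_poly_id || assumption).

Lemma ce_spec e : exists2 c, is_poly c &
  forall x rho V M t st out, evars e <= V -> V + 2 <= t -> inv x rho V t st ->
    below V M rho -> size x <= M ->
    execB (ce t e) (st, out) (c M) (upd st t (un (eval x rho e)), out).
Proof.
elim: e => [c|v|a [ca Pa IHa] b [cb Pb IHb]|a [ca Pa IHa] b [cb Pb IHb]|a [ca Pa IHa] b [cb Pb IHb]|a [ca Pa IHa]|] /=.
- exists (fun _ => c + 1) => [|x rho V M t st out _ HV [H0 H1 Hv Hr] _ _]; first by poly_tac.
  elim: c => [|c IH] /=.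
    by apply: execB_eq (execB_skip _) _; rewrite /= -(Hr t) // upd_id.
  apply: execB_le (execB_eq (execB_seq IH (execB_push _ _ _ _)) _) _; last by lia.
  by congr pair; apply: functional_extensionality => r; rewrite /upd eqxx; case: eqP.
- exists (fun M => M * 7 + 2) => [|x rho V M t st out Hv HV [H0 H1 Hs Hr] Hb _]; first by poly_tac.
  apply: execB_le (execB_eq (paddB (n := rho v) (d := 0) _ _ _ _ _ _ _) _) _; try lia.
  + exact: Hs.
  + exact: Hr.
  + by apply: Hr; lia.
  + by rewrite addn0.
  + by have := Hb v Hv; lia.
- have [va Pva Va] := eval_bound a; have [vb Pvb Vb] := eval_bound b.
  exists (fun M => ca M + (cb M + (vb M * 3 + 1))) => [|x rho V M t st out]; first by poly_tac.
  rewrite geq_max => /andP[Ha Hb] HV Hi Hr Hx.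
  have S1 := IHa _ _ _ _ _ _ out Ha HV Hi Hr Hx.
  have S2 := IHb _ _ _ _ _ _ out Hb (leqW HV) (inv_upd (un (eval x rho a)) HV (ltnSn t) Hi) Hr Hx.
    apply: execB_le (execB_eq (execB_seq S1 (execB_seq S2 (pmoveB (n := eval x rho b) _ _ _))) _) _.
  + lia.
  + by rewrite /upd eqxx.
  + have [_ _ _ Hrr] := Hi; congr pair; apply: functional_extensionality => r; rewrite /upd !eqxx.
    have -> : (t == t.+1) = false by lia.
    case: eqP => [->|_]; first by rewrite Hrr //; case: eqP => //; lia.
    by case: eqP => // _; rewrite /un -nseqD addnC.
  + by rewrite !leq_add // leq_mul2r /= (Vb _ _ V).
- have [va Pva Va] := eval_bound a; have [vb Pvb Vb] := eval_bound b.
  exists (fun M => ca M + (cb M + ((va M * (1 + (vb M * 7 + 2)).+1 + 1) + (vb M * 2 + 1)))) => [|x rho V M t st out].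
    apply: is_poly_add => //; apply: is_poly_add => //; apply: is_poly_add; last by poly_tac.
    apply: (is_poly_le (g := fun M => va M * (4 + vb M * 7) + 1)); last by poly_tac.
    by move=> n; lia.
  rewrite geq_max => /andP[Ha Hb] HV Hi Hr Hx.
  set A := eval x rho a; set B := eval x rho b.
  have [H0 H1 Hv Hrr] := Hi.
  have HA : A <= va M by apply: Va Hr Hx.
  have HB : B <= vb M by apply: Vb Hr Hx.
  have Hi1 : inv x rho V t.+1 st by split=> // r ?; apply: Hrr; lia.
  have Hi2 : inv x rho V t.+2 (upd st t.+1 (un A)) by apply: inv_upd Hi1; lia.
  pose F j := (upd (upd (upd st t (un (j * B))) t.+1 (un (A - j))) t.+2 (un B), out).
  have L : execB (While t.+1 (Seq (Pop t.+1) (padd t.+2 t t.+3))) (F 0) (A * (1 + (B * 7 + 2)).+1 + 1) (F A).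
    apply: execB_loop.
    + move=> j Hj /=; rewrite /upd eqxx; case: eqP => [|_]; [lia|apply: un_neq0; lia].
    + by rewrite /= /upd eqxx subnn; case: eqP => //; lia.
    + move=> j Hj; apply: execB_eq (execB_seq (execB_pop _ _ _)
        (paddB (n := B) (d := j * B) _ _ _ _ _ _ _)) _; try lia.
      * by rewrite /upd; eqs.
      * by rewrite /upd; eqs.
      * by rewrite /upd; repeat case: eqP => //; try lia; move=> *; apply: Hrr; lia.
      * congr pair; apply: functional_extensionality => r; rewrite /upd !eqxx.
        have -> : (t.+1 == t.+2) = false by lia.
        rewrite behead_un; have -> : (A - j).-1 = A - j.+1 by lia.
        by rewrite mulSn; eqs.
  have S1 := IHa _ _ _ _ _ _ out Ha (leqW HV) Hi1 Hr Hx.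
  have S2 := IHb _ _ _ _ _ _ out Hb (leqW (leqW HV)) Hi2 Hr Hx.
  have S4 := clearB t.+2 (F A).1 out.
  apply: execB_le (execB_eq (execB_seq S1 (execB_seq S2 (execB_seq (execB_eq' _ L) S4))) _) _.
  + congr pair; apply: functional_extensionality => r; rewrite /upd mul0n subn0 -[un 0]/(@nil bool) -(Hrr t) //.
    by eqs.
  + congr pair; apply: functional_extensionality => r; rewrite /upd /= subnn /upd.
    rewrite -[un 0]/(@nil bool); case: eqP => [->|_]; first by rewrite Hrr; [case: eqP => //; lia|lia].
    by case: eqP => [->|_]; [rewrite Hrr; [case: eqP => //; lia|lia]|].
  + rewrite /F /= /upd eqxx size_nseq !leq_add ?leq_mul //; lia.
- have [va Pva Va] := eval_bound a; have [vb Pvb Vb] := eval_bound b.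
  exists (fun M => ca M + (cb M + (vb M * 3 + 1))) => [|x rho V M t st out]; first by poly_tac.
  rewrite geq_max => /andP[Ha Hb] HV Hi Hr Hx.
  set A := eval x rho a; set B := eval x rho b.
  have [H0 H1 Hv Hrr] := Hi.
  have S1 := IHa _ _ _ _ _ _ out Ha HV Hi Hr Hx.
  have S2 := IHb _ _ _ _ _ _ out Hb (leqW HV) (inv_upd (un (eval x rho a)) HV (ltnSn t) Hi) Hr Hx.
  pose F j := (upd (upd st t (un (A - j))) t.+1 (un (B - j)), out).
  have L : execB (While t.+1 (Seq (Pop t.+1) (Pop t))) (F 0) (B * 3 + 1) (F B).
    apply: execB_loop.
    + by move=> j Hj /=; rewrite /upd eqxx; apply: un_neq0; lia.
    + by rewrite /= /upd eqxx subnn.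
    + move=> j Hj; apply: execB_eq (execB_seq (execB_pop _ _ _) (execB_pop _ _ _)) _.
      congr pair; apply: functional_extensionality => r; rewrite /upd !eqxx.
      have -> : (t == t.+1) = false by lia.
      rewrite !behead_un; have -> : (A - j).-1 = A - j.+1 by lia.
      have -> : (B - j).-1 = B - j.+1 by lia.
      by eqs.
  apply: execB_le (execB_eq (execB_seq S1 (execB_seq S2 (execB_eq' _ L))) _) _.
  + by rewrite /F !subn0.
  + congr pair; apply: functional_extensionality => r; rewrite /upd /= subnn.
    by case: eqP => [->|_] //; rewrite Hrr //; case: eqP => //; lia.
  + by rewrite !leq_add // leq_mul2r /= (Vb _ _ V).
- have [va Pva Va] := eval_bound a.
  exists (fun M => ca M + ((va M * 5 + 1) + (2 + (va M * 4 + 1)))) => [|x rho V M t st out]; first by poly_tac.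
  move=> Ha HV Hi Hr Hx.
  set A := eval x rho a.
  have [H0 H1 Hv Hrr] := Hi.
  have HA : A <= va M by apply: Va Hr Hx.
  have Hi1 : inv x rho V t.+1 st by split=> // r ?; apply: Hrr; lia.
  have S1 := IHa _ _ _ _ _ _ out Ha (leqW HV) Hi1 Hr Hx.
  pose F j := (upd (upd (upd st 0 (drop j x)) 1 (rev (take j x))) t.+1 (un (A - j)), out).
  have L : execB (While t.+1 (Seq (Pop t.+1) (shift 0 1))) (F 0) (A * 5 + 1) (F A).
    apply: execB_loop.
    + by move=> j Hj /=; rewrite /upd eqxx; apply: un_neq0; lia.
    + by rewrite /= /upd eqxx subnn.
    + move=> j Hj; apply: execB_eq (execB_seq (execB_pop _ _ _) (shiftB _ _ _)) _ => //.
      congr pair; apply: functional_extensionality => r; rewrite /upd /= !eqxx.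
      rewrite behead_un; have -> : (A - j).-1 = A - j.+1 by lia.
      case: eqP => [->|_]; first by rewrite -drop1 drop_drop.
      have -> : (1 == t.+1) = false by lia.
      by rewrite take1_drop_rev; eqs.
  pose st1 := upd (F A).1 t (un (nth false x A)).
  have S3 : execB (Case 0 (Push t true) Skip Skip) (F A) 2 (st1, out).
    have E0 : (F A).1 0 = drop A x by rewrite /F /upd /=; eqs.
    apply: execB_case; rewrite E0.
    have Ht : upd (F A).1 t [::] = (F A).1.
      rewrite -[RHS](upd_id _ t); congr upd; rewrite /F /= /upd.
      by do 3![case: eqP => [|_]; first lia]; rewrite Hrr.
    rewrite /st1; have -> : nth false x A = nth false (drop A x) 0 by rewrite nth_drop addn0.
    case: (drop A x) => [|[] l] /=.
    + by rewrite Ht; apply: execB_skip.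
    + apply: execB_eq (execB_push _ _ _ _) _; congr (upd _ _ _, _).
      rewrite /upd; do 3![case: eqP => [|_]; first lia].
      by rewrite Hrr.
    + by rewrite Ht; apply: execB_skip.
  have S4 := @shiftallB 1 0 st1 out ltac:(by []).
  apply: execB_le (execB_eq (execB_seq S1 (execB_seq (execB_eq' _ L) (execB_seq S3 S4))) _) _.
  + congr pair; apply: functional_extensionality => r; rewrite /upd subn0 drop0 take0.
    rewrite -[rev [::]]/(@nil bool) -H1 -H0 -/A.
    by eqs.
  + have E0 : st1 0 = drop A x by rewrite /st1 /F /upd /=; eqs.
    have E1 : st1 1 = rev (take A x) by rewrite /st1 /F /upd /=; eqs.
    congr pair; apply: functional_extensionality => r; rewrite /upd.
    rewrite E0 E1 revK cat_take_drop /st1 /F /upd /= subnn.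
    eqs; by rewrite Hrr.
  + have -> : st1 1 = rev (take A x) by rewrite /st1 /F /upd /=; eqs.
    rewrite size_rev size_take; case: ltnP => Hlt; lia.
- exists (fun M => (M * 5 + 1) + (M * 4 + 1)) => [|x rho V M t st out]; first by poly_tac.
  move=> _ HV [H0 H1 Hv Hrr] Hr Hx.
  pose F j := (upd (upd (upd st 0 (drop j x)) 1 (rev (take j x))) t (un j), out).
  have L : execB (While 0 (Seq (Push t true) (shift 0 1))) (F 0) (size x * 5 + 1) (F (size x)).
    apply: execB_loop.
    + move=> j Hj /=; rewrite /upd /=; case: eqP => [|_]; first lia.
      by move/(congr1 size); rewrite size_drop /=; lia.
    + by rewrite /= /upd /= drop_size; case: eqP => //; lia.
    + move=> j Hj; apply: execB_eq (execB_seq (execB_push _ _ _ _) (shiftB _ _ _)) _ => //.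
      congr pair; apply: functional_extensionality => r; rewrite /upd /= !eqxx.
      have -> : (0 == t) = false by lia.
      have -> : (1 == t) = false by lia.
      case: eqP => [->|_]; first by rewrite -drop1 drop_drop; case: eqP => //; lia.
      by rewrite take1_drop_rev; eqs.
  have S4 := @shiftallB 1 0 (F (size x)).1 out ltac:(by []).
  apply: execB_le (execB_eq (execB_seq (execB_eq' _ L) S4) _) _.
  + congr pair; apply: functional_extensionality => r; rewrite /upd drop0 take0.
    rewrite -[rev [::]]/(@nil bool) -[un 0]/(@nil bool).
    by eqs; apply: Hrr.
  + have E0 : (F (size x)).1 0 = [::] by rewrite /F /upd /= drop_size; eqs.
    have E1 : (F (size x)).1 1 = rev x by rewrite /F /upd /= take_size; eqs.
    congr pair; apply: functional_extensionality => r; rewrite {1 2}/upd.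
    rewrite E0 E1 revK cats0 /F /upd /=.
    by eqs.
  + have -> : (F (size x)).1 1 = rev x by rewrite /F /upd /= take_size; eqs.
    rewrite size_rev; lia.
Qed.

(** A loop keeps the old value of its variable in [t.+1] and restores it at the end, since a bound
    variable may shadow an outer one. *)
Fixpoint cg (t : nat) (g : gen) : sprog :=
  match g with
  | GNil => Skip
  | GOut e => Seq (ce t e) (Seq (Case t (Emit true) Skip (Emit false)) (clear t))
  | GSeq g1 g2 => Seq (cg t g1) (cg t g2)
  | GFor v e g => Seq (ce t e) (Seq (pmove (2 + v) t.+1)
      (Seq (While t (Seq (Pop t) (Seq (cg t.+2 g) (Push (2 + v) true))))
      (Seq (clear (2 + v)) (pmove t.+1 (2 + v)))))
  end.

(** In the body of a loop the variables are bounded by [M + va M], the second term accounting for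
    the loop variable; the bounds therefore compose, once per level of nesting. *)
Lemma cg_spec g : exists2 c, is_poly c &
  forall x rho V M t st out, gvars g <= V -> V + 2 <= t -> inv x rho V t st ->
    below V M rho -> size x <= M ->
    execB (cg t g) (st, out) (c M) (st, out ++ gden x rho g).
Proof.
elim: g => [|e|a [ca Pa IHa] b [cb Pb IHb]|v e g [cc Pg IH]] /=.
- exists (fun _ => 1) => [|x rho V M t st out _ _ _ _ _]; first by poly_tac.
  by rewrite cats0; apply: execB_skip.
- have [c Pc Hc] := ce_spec e; have [va Pva Va] := eval_bound e.
  exists (fun M => c M + (2 + (va M * 2 + 1))) => [|x rho V M t st out Hv HV Hi Hr Hx]; first by poly_tac.
  have S1 := Hc _ _ _ _ _ _ out Hv HV Hi Hr Hx.
  set A := eval x rho e in S1 *.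
  have S2 : execB (Case t (Emit true) Skip (Emit false)) (upd st t (un A), out) 2
     (upd st t (un A), out ++ [:: A != 0]).
    apply: execB_case; rewrite /= {1}/upd eqxx cats1.
    by case: A {S1} => [|A] /=; apply: execB_emit.
  have S3 := clearB t (upd st t (un A)) (out ++ [:: A != 0]).
  apply: execB_le (execB_eq (execB_seq S1 (execB_seq S2 S3)) _) _.
  + have [_ _ _ Hrr] := Hi; congr pair; apply: functional_extensionality => r; rewrite /upd.
    by eqs; rewrite Hrr.
  + by rewrite /upd eqxx size_nseq !leq_add // leq_mul2r /= (Va _ _ V).
- exists (fun M => ca M + cb M) => [|x rho V M t st out]; first by poly_tac.
  rewrite geq_max => /andP[Ha Hb] HV Hi Hr Hx; rewrite catA.
  by apply: execB_seq; [apply: IHa Hi Hr Hx|apply: IHb Hi Hr Hx].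
- have [c Pc Hc] := ce_spec e; have [va Pva Va] := eval_bound e.
  exists (fun M => c M + ((M * 3 + 1) + ((va M * (1 + (cc (M + va M) + 1)).+1 + 1) +
    ((va M * 2 + 1) + (M * 3 + 1))))) => [|x rho V M t st out].
    have Pcc : is_poly (fun M => cc (M + va M)) by apply: is_poly_comp Pg (is_poly_add is_poly_id Pva).
    apply: (is_poly_le (g := fun M => c M + ((M * 3 + 1) + ((va M * (cc (M + va M) + 3) + 1) +
    ((va M * 2 + 1) + (M * 3 + 1)))))); first by move=> n; lia.
    by poly_tac.
  rewrite !geq_max => /and3P[Hv He Hg] HV Hi Hr Hx.
  have S1 := Hc _ _ _ _ _ _ out He HV Hi Hr Hx.
  set A := eval x rho e in S1 *.
  have HA : A <= va M by apply: Va Hr Hx.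
  have [H0 H1 Hs Hrr] := Hi.
  have N1 : 2 + v <> t.+1 by lia.
  have N2 : upd st t (un A) (2 + v) = un (rho v) by rewrite /upd; eqs; rewrite -Hs.
  have S2 := pmoveB out N1 N2.
  pose F j := (upd (upd (upd st t.+1 (un (rho v))) t (un (A - j))) (2 + v) (un j),
    out ++ flatten [seq gden x (upd rho v i) g | i <- iota 0 j]).
  have L : execB (While t (Seq (Pop t) (Seq (cg t.+2 g) (Push (2 + v) true)))) (F 0)
      (A * (1 + (cc (M + va M) + 1)).+1 + 1) (F A).
    apply: execB_loop.
    + by move=> j Hj /=; rewrite /upd eqxx; eqs; apply: un_neq0; lia.
    + by rewrite /= /upd eqxx subnn; eqs.
    + move=> j Hj; apply: execB_eq (execB_seq (execB_pop _ _ _) (execB_seq (IH x (upd rho v j) V _ _ _ _ _ _ _ _ _) (execB_push _ _ _ _))) _ => //.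
      * lia.
      * split=> [| |w Hw|r Hw].
        - by rewrite /upd; eqs.
        - by rewrite /upd; eqs.
        - by rewrite /upd; eqs; apply: Hs.
        - by rewrite /upd; eqs; apply: Hrr; lia.
      * by move=> w Hw; rewrite /upd; eqs; have := Hr w Hw; lia.
      * lia.
      * rewrite /F -[in iota 0 j.+1]addn1 iotaD map_cat flatten_cat /= cats0 add0n catA; congr pair.
        apply: functional_extensionality => r; rewrite /upd !eqxx.
        have -> : (t == 2 + v) = false by lia.
        rewrite behead_un; have -> : (A - j).-1 = A - j.+1 by lia.
        by eqs.
  have S4 := clearB (2 + v) (F A).1 (F A).2.
  have N3 : t.+1 <> 2 + v by lia.
  have N4 : upd (F A).1 (2 + v) [::] t.+1 = un (rho v) by rewrite /F /upd /=; eqs.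
  have S5 := pmoveB (F A).2 N3 N4.
  apply: execB_le (execB_eq (execB_seq S1 (execB_seq S2 (execB_seq (execB_eq' _ L) (execB_seq S4 S5)))) _) _.
  + rewrite /F /= cats0; congr pair; apply: functional_extensionality => r; rewrite /upd subn0.
    by eqs; rewrite Hrr ?cats0.
  + rewrite /F /=; congr pair; apply: functional_extensionality => r; rewrite /upd !eqxx subnn cats0.
    by eqs; rewrite ?(Hrr _ (leqnn _)) ?(Hrr _ (leqnSn _)) -?Hs.
  + rewrite /F /= /upd eqxx size_nseq.
    have := Hr v Hv => Hrv.
    by rewrite !leq_add // ?leq_mul2r ?orbT //; lia.
Qed.

Theorem gen_polytime g : polytime_computable (fun x => gden x (fun=> 0) g).
Proof.
have [c Pc Hc] := cg_spec g.
apply: (@stack_polytime (cg (gvars g + 2) g) _ c Pc) => x.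
have [||n Hn X] := Hc x (fun=> 0) (gvars g) (size x) (gvars g + 2) (upd (fun=> [::]) 0 x) [::] (leqnn _) (leqnn _) _ _ (leqnn _).
- by split=> [| |v Hv|r Hr] //; rewrite /upd; eqs.
- by [].
- by exists n, (upd (fun=> [::]) 0 x).
Qed.


(** * Election gadgets *)

(* The linear order listing [l] first and then all other numbers increasingly. *)
Fixpoint lead (l : seq nat) (a b : nat) : bool :=
  if l is s :: l' then if a == s then b != s else if b == s then false else lead l' a b else a < b.

Lemma lead_irr l a : lead l a a = false.
Proof. by elim: l => [|s l IH] /=; [rewrite ltnn|case: eqP]. Qed.

Lemma lead_trans l : transitive (lead l).
Proof.
elim: l => [|s l IH] b a c /=; first exact: ltn_trans.
case: (a == s) => //; last by do 2![case: ifP => // _]; apply: IH.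
by move=> /negbTE ->; case: (c == s).
Qed.

Lemma lead_total l a b : a != b -> lead l a b || lead l b a.
Proof.
elim: l => [|s l IH] /= ab; first by rewrite -neq_ltn.
by case: eqP => [E|_]; case: eqP => [E'|_] //; [rewrite E E' eqxx in ab|apply: IH].
Qed.

Lemma lead_asym l a b : lead l a b -> lead l b a = false.
Proof. by move=> H; apply/negP => H'; have := lead_trans H H'; rewrite lead_irr. Qed.

Lemma lead_rcons_l S c b : c \notin S -> b != c -> lead (rcons S c) c b = (b \notin S).
Proof.
elim: S => [|s S IH] /=; first by rewrite eqxx.
rewrite !inE !negb_or => /andP[cs cS] bc; rewrite (negbTE cs).
by case: eqP => //= _; apply: IH.
Qed.

Lemma lead_rcons_r S c b : c \notin S -> b != c -> lead (rcons S c) b c = (b \in S).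
Proof.
elim: S => [|s S IH] /=; first by move=> _ /negbTE ->; rewrite eqxx.
rewrite !inE !negb_or => /andP[cs cS] bc; rewrite (negbTE cs).
by case: eqP => //= _; apply: IH.
Qed.

Lemma lead_rcons S c a b : a != c -> b != c -> lead (rcons S c) a b = lead S a b.
Proof. by move=> ac bc; elim: S => [|s S IH] /=; rewrite ?(negbTE ac) ?(negbTE bc) ?IH. Qed.

Definition sd (r : nat -> nat -> bool) (a b : nat) : int := ((r a b)%:Z - (r b a)%:Z)%R.
Definition flip (r : nat -> nat -> bool) : nat -> nat -> bool := fun a b => r b a.

Definition gain (c : nat) (S : seq nat) (a b : nat) : int :=
  (2 * ((a == c) && (b \in S))%:Z - 2 * ((b == c) && (a \in S))%:Z)%R.

(* McGarvey's pair of votes. *)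
Lemma mcgarvey c S a b : c \notin S -> a != b ->
  (sd (lead (c :: S)) a b + sd (flip (lead (rcons S c))) a b = gain c S a b)%R.
Proof.
move=> cS ab; rewrite /sd /flip /gain.
case: (eqVneq a c) => [Ea|ac]; case: (eqVneq b c) => [Eb|bc].
- by rewrite Ea Eb eqxx in ab.
- rewrite Ea lead_rcons_l ?lead_rcons_r //= !eqxx (negbTE bc) /=; case: (b \in S) => /=; lia.
- rewrite Eb lead_rcons_l ?lead_rcons_r //= !eqxx (negbTE ac) /=; case: (a \in S) => /=; lia.
- rewrite !lead_rcons //= (negbTE ac) (negbTE bc) /=; lia.
Qed.

(* A Boolean variable together with the clause in which it occurs positively (its head) and the at
   most two clauses in which it occurs negatively (its bodies, 0 meaning none). *)
Definition gadget := (nat * nat * nat)%type.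
Definition head_of (g : gadget) := g.1.1.
Definition body1 (g : gadget) := g.1.2.
Definition body2 (g : gadget) := g.2.

(* Alternative [d] wins when all clauses are satisfied and the manipulator votes truthfully; [w]
   is the better alternative that wins instead once [d] and [e] are swapped; [z] and [e] never win.
   The other alternatives are the clauses, and an unsatisfied clause beats [w] and [d]. The clause
   [top] is the one which the fallback assignment of [sat_of_dominating] may violate. *)
Section Election.
Variables (m : nat) (gs : seq gadget).
Let z := m - 2.
Let top := m - 1.
Let e := 0.
Let d := 1.
Let w := 2.
Let G := size gs.

(* The head floats between [up] (the variable is false and its bodies lose to the head) and [down]
   (the variable is true and the head loses to [z]). The reversed [mid] votes cancel [mid]. *)
Definition up (g : gadget) := lead [:: head_of g; body1 g; body2 g; z].
Definition mid (g : gadget) := lead [:: body1 g; body2 g; head_of g; z].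
Definition down (g : gadget) := lead [:: body1 g; body2 g; z; head_of g].
Definition gvote (g : gadget) a b := up g a b && down g a b.

(** McGarvey pairs, the first two used twice: weight 4 of [e] over [w], [d], [z] and of [top] over
    [e], weight 2 of [z] over [top]. The first puts the margins of [w] and [d] to [e] at -3 or -5
    according to the manipulator's vote, the second makes [e] lose to [top], and the third
    compensates for [top] being first in [VM]: its margin to [z] is -1 and not 1 when it is
    unsatisfied. *)
Definition specials : seq (nat -> nat -> bool) :=
  [:: lead [:: e; w; d; z]; flip (lead [:: w; d; z; e]);
      lead [:: e; w; d; z]; flip (lead [:: w; d; z; e]);
      lead [:: top; e]; flip (lead [:: e; top]);
      lead [:: top; e]; flip (lead [:: e; top]);
      lead [:: z; top]; flip (lead [:: top; z])].

Definition votes := map gvote gs ++ map (fun g => flip (mid g)) gs ++ specials.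
Definition po (i : 'I_(G + (G + 10))) : rel 'I_m :=
  fun a b => nth (fun _ _ => false) votes i a b.
Definition VM : rel 'I_m := fun a b => b < a.

(** The clauses. All but [top] have an index below [z], so [VM] gives them a margin of at most -1 to
    [z]. *)
Definition isX c := (3 <= c < m) && (c != z).
(** A missing body is the alternative [e], whose margins may drop freely since it has to lose
    anyway. A genuine body lies below its head in index and is neither [z] nor [top]. *)
Definition body_ok (h b : nat) := (b == 0) || (3 <= b < z) && (b < h).
Definition gadget_ok (g : gadget) :=
  [&& isX (head_of g), body_ok (head_of g) (body1 g) & body_ok (head_of g) (body2 g)].

Definition gd i := nth (0, 0, 0) gs i.
Definition sat_clause (sg : nat -> bool) c :=
  exists2 i, i < G & sg i && (head_of (gd i) == c) || ~~ sg i && ((body1 (gd i) == c) || (body2 (gd i) == c)).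
Definition flips (sg : nat -> bool) a b i :=
  if sg i then (a == head_of (gd i)) && (b == z)
  else (b == head_of (gd i)) && ((a == body1 (gd i)) || (a == body2 (gd i))).

Hypothesis m5 : 5 <= m.
Hypothesis gs_ok : all gadget_ok gs.

Lemma gd_ok i : i < G -> gadget_ok (gd i).
Proof. by move=> Hi; apply: (allP gs_ok); apply: mem_nth. Qed.

(* The pairs [mid] ranks as [a] above [b] but some extension of [gvote] as [b] above [a]. *)
Definition canflip a b := exists2 i, i < G &
  (a == head_of (gd i)) && (b == z) || (b == head_of (gd i)) && ((a == body1 (gd i)) || (a == body2 (gd i))).

(** Genuine bodies have smaller indices than their heads, and [z] is neither head nor body; so two
    variables never act on one margin in opposite directions. *)
Lemma canflip_anti a b : canflip a b -> ~ canflip b a.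
Proof.
move=> [i Hi H1] [j Hj H2]; have := gd_ok Hi; have := gd_ok Hj.
rewrite /gadget_ok /isX /body_ok; move: H1 H2; rewrite /e /z.
case: (gd i) => [[h b1] b2]; case: (gd j) => [[h' b1'] b2']; rewrite /head_of /body1 /body2 /=.
lia.
Qed.

Ltac lead_cases := repeat (case: eqP => /= [?|?]); lia.

Lemma mid_down g a b : gadget_ok g -> mid g a b && down g b a = (a == head_of g) && (b == z).
Proof.
case: g => [[h b1] b2]; rewrite /gadget_ok /mid /down /isX /body_ok /head_of /body1 /body2 /= => H.
by lead_cases.
Qed.

Lemma mid_up g a b : gadget_ok g ->
  mid g a b && up g b a = (b == head_of g) && ((a == body1 g) || (a == body2 g)).
Proof.
case: g => [[h b1] b2]; rewrite /gadget_ok /mid /up /isX /body_ok /head_of /body1 /body2 /= => H.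
by lead_cases.
Qed.

Lemma gvote_body_z g a : gadget_ok g -> (a == body1 g) || (a == body2 g) -> gvote g a z.
Proof.
case: g => [[h b1] b2]; rewrite /gadget_ok /gvote /down /up /isX /body_ok /head_of /body1 /body2 /= => H H'.
by lead_cases.
Qed.

Arguments lead : simpl never.

(** * Margins in a completion of the partial orders *)

Section Profile.
Variable P : 'I_(G + (G + 10)) -> rel 'I_m.
Hypothesis PE : in_info_set po P.

Definition gi (i : 'I_G) : 'I_(G + (G + 10)) := lshift (G + 10) i.

Lemma po_gi i : po (gi i) = fun a b => gvote (gd i) a b.
Proof.
apply: functional_extensionality => a; apply: functional_extensionality => b.
by rewrite /po /votes nth_cat size_map /= ltn_ord (nth_map (0, 0, 0)).
Qed.

Lemma po_mid i : po (rshift G (lshift 10 i)) = fun a b => mid (gd i) b a.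
Proof.
apply: functional_extensionality => a; apply: functional_extensionality => b.
rewrite /po /votes nth_cat size_map /= ltnNge leq_addr /= addKn nth_cat size_map ltn_ord.
by rewrite (nth_map (0, 0, 0)).
Qed.

Lemma po_special i : po (rshift G (rshift G i)) = fun a b => nth (fun _ _ => false) specials i a b.
Proof.
apply: functional_extensionality => a; apply: functional_extensionality => b.
rewrite /po /votes nth_cat size_map /= ltnNge leq_addr /= addKn nth_cat size_map /=.
by rewrite ltnNge leq_addr /= addKn.
Qed.

Lemma linear_lead l : is_linear_order (fun a b : 'I_m => lead l a b).
Proof.
apply/andP; split; [apply/andP; split|].
- by apply/forallP => a; rewrite lead_irr.
- do 3![apply/forallP => ?]; apply/implyP => H; apply/implyP; exact: lead_trans.
- by do 2![apply/forallP => ?]; apply/implyP; apply: lead_total.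
Qed.

Lemma linear_flip_lead l : is_linear_order (fun a b : 'I_m => lead l b a).
Proof.
apply/andP; split; [apply/andP; split|].
- by apply/forallP => a; rewrite lead_irr.
- do 3![apply/forallP => ?]; apply/implyP => H; apply/implyP => H'; exact: lead_trans H' H.
- by do 2![apply/forallP => ?]; apply/implyP; rewrite eq_sym; apply: lead_total.
Qed.

Lemma linear_special i : is_linear_order (fun a b : 'I_m => nth (fun _ _ => false) specials (i : 'I_10) a b).
Proof.
case: i => [[|[|[|[|[|[|[|[|[|[|//]]]]]]]]]] ?] /=.
- exact: (linear_lead [:: e; w; d; z]).
- exact: (linear_flip_lead [:: w; d; z; e]).
- exact: (linear_lead [:: e; w; d; z]).
- exact: (linear_flip_lead [:: w; d; z; e]).
- exact: (linear_lead [:: top; e]).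
- exact: (linear_flip_lead [:: e; top]).
- exact: (linear_lead [:: top; e]).
- exact: (linear_flip_lead [:: e; top]).
- exact: (linear_lead [:: z; top]).
- exact: (linear_flip_lead [:: top; z]).
Qed.

Lemma linear_asym r (a b : 'I_m) : is_linear_order r -> r a b -> r b a = false.
Proof.
case/andP => /andP[/forallP H1 /forallP H2] _ H; apply/negP => H'.
have /forallP/(_ b)/forallP/(_ a)/implyP/(_ H)/implyP/(_ H') := H2 a.
by rewrite (negbTE (H1 a)).
Qed.

Lemma linear_total r (a b : 'I_m) : is_linear_order r -> a != b -> r b a = ~~ r a b.
Proof.
move=> Hr ab; have /andP[_ /forallP/(_ a)/forallP/(_ b)/implyP/(_ ab) H] := Hr.
by case E : (r a b) H => /= H; [rewrite (linear_asym Hr E)|rewrite H].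
Qed.

Lemma linear_trans r (a b c : 'I_m) : is_linear_order r -> r a b -> r b c -> r a c.
Proof.
case/andP => /andP[_ /forallP H2] _ H H'.
by have /forallP/(_ b)/forallP/(_ c)/implyP/(_ H)/implyP/(_ H') := H2 a.
Qed.

Lemma extends_linear (r s : rel 'I_m) a b : is_linear_order r -> is_linear_order s ->
  extends s r -> s a b = r a b.
Proof.
move=> Hr Hs /forallP/(_ _)/forallP/(_ _)/implyP H.
case: (eqVneq a b) => [->|ab].
  have /andP[/andP[/forallP/(_ b) /negbTE -> _] _] := Hr.
  by have /andP[/andP[/forallP/(_ b) /negbTE -> _] _] := Hs.
case E : (r a b); first exact: H.
have E' : r b a by rewrite (linear_total Hr ab) E.
by apply: (linear_asym Hs); apply: H.
Qed.

Definition fl (a b : 'I_m) (i : 'I_G) : bool := mid (gd i) a b && P (gi i) b a.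
Definition F (a b : 'I_m) : nat := \sum_(i < G) fl a b i.
Definition Wf (a b : nat) : int :=
  (2 * gain e [:: w; d; z] a b + 2 * gain top [:: e] a b + gain z [:: top] a b)%R.

Lemma specials_sum (a b : 'I_m) : a != b ->
  (\sum_(i < 10) sd (nth (fun _ _ => false) specials i) a b = Wf a b)%R.
Proof.
move=> ab; have ab' : val a != val b by [].
have H1 : e \notin [:: w; d; z] by rewrite !inE /e /w /d /z; lia.
have H2 : top \notin [:: e] by rewrite !inE /e /top; lia.
have H3 : z \notin [:: top] by rewrite !inE /z /top; lia.
rewrite !big_ord_recl big_ord0 /= /Wf -(mcgarvey H1 ab') -(mcgarvey H2 ab') -(mcgarvey H3 ab').
rewrite [rcons _ _]/= [rcons [:: e] _]/= [rcons [:: top] _]/=.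
set x1 := sd _ _ _; set x2 := sd _ _ _; set x3 := sd _ _ _; set x4 := sd _ _ _; set x5 := sd _ _ _; set x6 := sd _ _ _.
clearbody x1 x2 x3 x4 x5 x6; lia.
Qed.

(** A variable's vote and its reversed [mid] cancel wherever the vote agrees with [mid]; each
    disagreement gives 2 to the alternative that [mid] ranks lower. [F a b] counts the disagreements
    at the expense of [a]. *)
Lemma D_form (V : rel 'I_m) (a b : 'I_m) : a != b ->
  (D P V a b = 2 * (F b a)%:Z - 2 * (F a b)%:Z + Wf a b + ((V a b)%:Z - (V b a)%:Z))%R.
Proof.
move=> ab; rewrite /D; congr (_ + _)%R; rewrite -(specials_sum ab).
rewrite big_split_ord big_split_ord /= addrA; congr (_ + _)%R; last first.
  apply: eq_bigr => i _; rewrite /sd.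
  have [Hl He] := PE (rshift G (rshift G i)).
  by rewrite !(extends_linear _ _ (linear_special i) Hl) // -(po_special i).
rewrite -big_split /= /F.
rewrite !(big_morph Posz PoszD (erefl _)) !mulr_sumr -sumrB.
apply: eq_bigr => i _.
have [Hl _] := PE (gi i); have [Hl' He'] := PE (rshift G (lshift 10 i)).
rewrite -!/(gi i) (linear_total Hl ab).
have Lm := linear_flip_lead [:: body1 (gd i); body2 (gd i); head_of (gd i); z].
rewrite po_mid in He'.
rewrite !(extends_linear _ _ Lm Hl' He') /fl -!/(mid (gd i) _ _) /= (linear_total Hl ab).
have Mt : mid (gd i) a b || mid (gd i) b a by apply: lead_total.
have Ms : mid (gd i) a b -> mid (gd i) b a = false by apply: lead_asym.
case: (boolP (mid (gd i) a b)) Mt Ms => /= [_ _ /(_ isT) ->|_ -> _]; by case: (P _ _ _).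
Qed.
End Profile.

Lemma mid_not_gvote g a b : gadget_ok g -> mid g a b -> ~~ gvote g a b ->
  (a == head_of g) && (b == z) || (b == head_of g) && ((a == body1 g) || (a == body2 g)).
Proof.
move=> ok Hm; have ab : a != b by apply/eqP => E; move: Hm; rewrite E /mid lead_irr.
have Tu : up g a b || up g b a by apply: lead_total.
have Td : down g a b || down g b a by apply: lead_total.
rewrite -(mid_down a b ok) -(mid_up a b ok) Hm /gvote /=.
by case: (up g a b) Tu => /= [_|-> _]; [case: (down g a b) Td => //= ->|rewrite orbT].
Qed.

Lemma fl_cases P a b i : in_info_set po P -> fl P a b i ->
  (val a == head_of (gd i)) && (val b == z) ||
  (val b == head_of (gd i)) && ((val a == body1 (gd i)) || (val a == body2 (gd i))).
Proof.
move=> PE /andP[Hm Hp]; apply: mid_not_gvote => //; first exact: gd_ok.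
apply/negP => H; have [Hl /forallP/(_ a)/forallP/(_ b)/implyP] := PE (gi i).
by rewrite po_gi => /(_ H) H'; rewrite (linear_asym Hl H') in Hp.
Qed.

Lemma F_gt0P P a b : reflect (exists i, fl P a b i) (0 < F P a b).
Proof.
rewrite lt0n sum_nat_eq0 negb_forall; apply: (iffP existsP) => -[i Hi]; exists i.
  by move: Hi; rewrite negb_imply /= eqb0 negbK.
by rewrite Hi.
Qed.

Lemma F_canflip P a b : in_info_set po P -> 0 < F P a b -> canflip a b.
Proof. by move=> PE /F_gt0P[i Hi]; exists i => //; exact: (fl_cases PE Hi). Qed.

Lemma F_anti P P' a b : in_info_set po P -> in_info_set po P' -> 0 < F P a b -> F P' b a = 0.
Proof.
move=> H H' /(F_canflip H) Hc; case: (posnP (F P' b a)) => // /(F_canflip H') Hc'.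
by case: (canflip_anti Hc Hc').
Qed.

Definition profile_of (sg : nat -> bool) (i : 'I_(G + (G + 10))) : rel 'I_m :=
  if i < G then fun a b : 'I_m => if sg i then down (gd i) a b else up (gd i) a b else po i.

Lemma profile_of_gi sg i : profile_of sg (gi i) = fun a b : 'I_m => if sg i then down (gd i) a b else up (gd i) a b.
Proof. by rewrite /profile_of /= ltn_ord. Qed.

Lemma profile_of_info sg : in_info_set po (profile_of sg).
Proof.
move=> i; case: (split_ordP i) => j ->.
  rewrite -/(gi j) profile_of_gi po_gi; split.
    by case: (sg j); apply: linear_lead.
  apply/forallP => a; apply/forallP => b; apply/implyP => /andP[H1 H2].
  by case: (sg j).
have -> : profile_of sg (rshift G j) = po (rshift G j).
  by rewrite /profile_of /= ltnNge leq_addr.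
split; last by do 2![apply/forallP => ?]; apply/implyP.
case: (split_ordP j) => k ->; first by rewrite po_mid; apply: linear_flip_lead.
by rewrite po_special; apply: linear_special.
Qed.

Lemma fl_profile_of sg a b i : fl (profile_of sg) a b i = flips sg a b i.
Proof.
rewrite /fl profile_of_gi /flips; have ok := gd_ok (ltn_ord i).
by case: (sg i); rewrite ?mid_down ?mid_up.
Qed.

Definition unsat P (c : 'I_m) := isX c /\ forall y, F P c y = 0.

Definition sigma_of P (zz : 'I_m) (i : nat) : bool :=
  if insub i is Some j then [exists h : 'I_m, (val h == head_of (gd i)) && P (gi j) zz h] else false.

(** A completed vote need not be [up] or [down], so a variable is read as true when its vote ranks
    [z] above the head. As bodies are above [z] in every completion, a head above one of its bodies
    is also above [z]: a variable that lowers a margin of a body is read as false. *)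
Lemma sat_of_profile P : in_info_set po P -> (forall c, ~ unsat P c) ->
  exists sg, forall c, isX c -> sat_clause sg c.
Proof.
move=> PE Hu; have Hz : z < m by rewrite /z; lia.
exists (sigma_of P (Ordinal Hz)) => c Hc.
have Hcm : c < m by move: Hc; rewrite /isX => /andP[/andP[]].
have [y /F_gt0P[i Hf]] : exists y, 0 < F P (Ordinal Hcm) y.
  case: (pickP (fun y => 0 < F P (Ordinal Hcm) y)) => [y Hy|H0]; first by exists y.
  by case: (Hu (Ordinal Hcm)); split=> // y; move: (H0 y); rewrite lt0n => /negbFE/eqP.
exists i => //.
have ok := gd_ok (ltn_ord i).
have [Hl He] := PE (gi i).
have Hs : sigma_of P (Ordinal Hz) i = [exists h : 'I_m, (val h == head_of (gd i)) && P (gi i) (Ordinal Hz) h].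
  rewrite /sigma_of insubT //= => Hi; rewrite (_ : Sub _ _ = i) //; exact: val_inj.
have /andP[_ Hp] := Hf.
have := fl_cases PE Hf.
rewrite Hs; case/orP => /andP[/eqP H1 H2].
  apply/orP; left; rewrite -H1 eqxx andbT; apply/existsP; exists (Ordinal Hcm); rewrite eqxx /=.
  by rewrite (_ : Ordinal Hz = y) //; apply: val_inj; rewrite /= (eqP H2).
apply/orP; right; rewrite ![_ == c]eq_sym H2 andbT; apply/existsP => -[h /andP[/eqP Hh Hzh]].
have Eh : h = y by apply: val_inj; rewrite Hh H1.
rewrite Eh in Hzh; have Hzc := linear_trans Hl Hzh Hp.
move/forallP/(_ (Ordinal Hcm))/forallP/(_ (Ordinal Hz))/implyP: He; rewrite po_gi => /(_ (gvote_body_z ok H2)).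
by move=> Hcz; rewrite (linear_asym Hl Hcz) in Hzc.
Qed.

Lemma score_le n (P : 'I_n -> rel 'I_m) V (c y : 'I_m) : y != c -> (maximin_score P V c <= D P V c y)%R.
Proof. by move=> H; apply: bigmin_le_cond. Qed.

Lemma score_ge n (P : 'I_n -> rel 'I_m) V (c : 'I_m) (k : int) : (k <= 0)%R ->
  (forall y, y != c -> (k <= D P V c y)%R) -> (k <= maximin_score P V c)%R.
Proof. by move=> Hk H; apply/bigmin_geP; split=> //; apply: le_trans Hk _. Qed.

Lemma gain0 c S a b : a != c -> a \notin S -> gain c S a b = 0%R.
Proof. by rewrite /gain => /negbTE -> /negbTE ->; rewrite andbF /=; lia. Qed.

Lemma Wf_X a b : 3 <= a < z -> Wf a b = 0%R.
Proof.
move=> H; have H' : 3 <= a < m - 2 by [].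
by rewrite /Wf !gain0 ?mulr0 // ?inE ?/e ?/w ?/d ?/top ?/z; lia.
Qed.

Lemma Wf_top b : Wf top b = (4 * (b == e)%:Z - 2 * (b == z)%:Z)%R.
Proof.
have H0 : top == e = false by rewrite /top /e; lia.
have H1 : top == z = false by rewrite /top /z; lia.
have H2 : top == w = false by rewrite /top /w; lia.
have H3 : top == d = false by rewrite /top /d; lia.
rewrite /Wf /gain !inE H0 H1 H2 H3 eqxx !andbF !andbT /=; lia.
Qed.

Lemma Wf_e_top : Wf e top = (-4)%R.
Proof.
have H0 : e == top = false by rewrite /top /e; lia.
have H1 : top == z = false by rewrite /top /z; lia.
have H2 : top == w = false by rewrite /top /w; lia.
have H3 : top == d = false by rewrite /top /d; lia.
have H4 : e == z = false by rewrite /e /z; lia.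
have H5 : top == e = false by rewrite eq_sym.
by rewrite /Wf /gain !inE H0 H1 H2 H3 H4 H5 !eqxx.
Qed.

Lemma Wf_e a : a \in [:: w; d; z] -> Wf a e = (-4)%R.
Proof.
move=> Ha; have H0 : a == e = false by move: Ha; rewrite !inE /e /w /d /z; lia.
have H1 : a == top = false by move: Ha; rewrite !inE /top /w /d /z; lia.
have H2 : e == top = false by rewrite /top /e; lia.
have H3 : e == z = false by rewrite /e /z; lia.
by rewrite /Wf /gain !mem_seq1 Ha H0 H1 H2 H3 eqxx !(andbF, andFb).
Qed.

Lemma Wf_wd a b : (a == w) || (a == d) -> b != e -> Wf a b = 0%R.
Proof.
move=> Ha Hb; have H0 : a == e = false by move: Ha; rewrite /e /w /d; lia.
have H1 : a == top = false by move: Ha; rewrite /top /w /d; lia.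
have H3 : a == z = false by move: Ha; rewrite /w /d /z; lia.
by rewrite /Wf /gain !mem_seq1 H0 H1 H3 (negbTE Hb) /= !andbF.
Qed.

Lemma isXP c : reflect (3 <= c < z \/ c = top) (isX c).
Proof. by rewrite /isX /z /top; apply: (iffP idP); lia. Qed.

Lemma canflip_l a b : canflip a b -> a = e \/ isX a.
Proof.
move=> [i /gd_ok]; rewrite /gadget_ok /isX /body_ok /e /z; case: (gd i) => [[h b1] b2].
rewrite /head_of /body1 /body2 /=; lia.
Qed.

Lemma canflip_r a b : canflip a b -> b = z \/ isX b /\ a < b.
Proof.
move=> [i /gd_ok]; rewrite /gadget_ok /isX /body_ok /e /z; case: (gd i) => [[h b1] b2].
rewrite /head_of /body1 /body2 /=; lia.
Qed.

Lemma canflip_top b : canflip top b -> b = z.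
Proof.
move=> [i /gd_ok]; rewrite /gadget_ok /isX /body_ok /top /e /z; case: (gd i) => [[h b1] b2].
rewrite /head_of /body1 /body2 /=; lia.
Qed.

Lemma z_ltm : z < m. Proof. by rewrite /z ltn_subrL; apply: ltn_trans m5. Qed.
Lemma top_ltm : top < m. Proof. by rewrite /top ltn_subrL; apply: ltn_trans m5. Qed.
Let eo : 'I_m := Ordinal (leq_trans (isT : 0 < 5) m5).
Let d' : 'I_m := Ordinal (leq_trans (isT : 1 < 5) m5).
Let wo : 'I_m := Ordinal (leq_trans (isT : 2 < 5) m5).
Let zo : 'I_m := Ordinal z_ltm.
Let topo : 'I_m := Ordinal top_ltm.

(** * Maximin scores under an arbitrary linear vote of the manipulator *)

Section Scores.
Variables (P : 'I_(G + (G + 10)) -> rel 'I_m) (V : rel 'I_m).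
Hypotheses (PE : in_info_set po P) (Vl : is_linear_order V).

Definition sV (a b : 'I_m) : int := ((V a b)%:Z - (V b a)%:Z)%R.

Lemma sV_bound a b : (-1 <= sV a b <= 1)%R.
Proof. by rewrite /sV; case: (V a b); case: (V b a). Qed.

Lemma sV_odd a b : a != b -> sV a b = (if V a b then 1 else -1)%R.
Proof. by move=> ab; rewrite /sV (linear_total Vl ab); case: (V a b). Qed.

Lemma gain_even c S a b : exists k : int, gain c S a b = (2 * k)%R.
Proof. by eexists; rewrite /gain -mulrBr. Qed.

Lemma D_odd a b : a != b -> exists k : int, D P V a b = (2 * k + 1)%R.
Proof.
move=> ab; rewrite D_form // -/(sV a b) sV_odd // /Wf.
have [k ->] := gain_even z [:: top] a b.
move: (gain e _ _ _) (gain top _ _ _) (F P a b) (F P b a) => x y f g.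
case: (V a b).
- exists (g%:Z - f%:Z + (x + y + k))%R; lia.
- exists (g%:Z - f%:Z + (x + y + k) - 1)%R; lia.
Qed.

Lemma F_w (a b : 'I_m) : (a == w :> nat) || (a == d :> nat) || (a == z :> nat) -> F P a b = 0.
Proof.
move=> Ha; case: (posnP (F P a b)) => // /(F_canflip PE)/canflip_l.
rewrite /isX; move: Ha; rewrite /w /d /z /e; lia.
Qed.

Lemma F_to (a b : 'I_m) : (b != z :> nat) -> ~~ isX b -> F P a b = 0.
Proof.
move=> Hb Hx; case: (posnP (F P a b)) => // /(F_canflip PE)/canflip_r[E|[E _]].
  by rewrite E eqxx in Hb.
by rewrite E in Hx.
Qed.

Lemma F_z (a b : 'I_m) : (a == z :> nat) -> F P a b = 0.
Proof. by move=> H; apply: F_w; rewrite H !orbT. Qed.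

Lemma score_wdz (c : 'I_m) : (val c \in [:: w; d; z]) -> (maximin_score P V c <= -4 + sV c eo)%R.
Proof.
move=> Hc; have ce : c != eo by apply/eqP => E; move: Hc; rewrite E !inE /w /d /z /=; lia.
apply: le_trans (score_le _ _ (_ : eo != c)) _; first by rewrite eq_sym.
rewrite D_form // -/(sV c eo) [Wf _ _](Wf_e Hc).
have -> : F P eo c = 0.
  case: (posnP (F P eo c)) => // /(F_canflip PE) [i /gd_ok]; move: Hc.
  rewrite /gadget_ok /isX /body_ok !inE /w /d /z /e /=; case: (gd i) => [[h b1] b2].
  rewrite /head_of /body1 /body2 /=; lia.
rewrite F_w; first by lia.
by move: Hc; rewrite !inE orbA.
Qed.

Lemma score_e : (maximin_score P V eo <= -4 + sV eo topo)%R.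
Proof.
have ne : eo != topo by rewrite -val_eqE /= /top; lia.
apply: le_trans (score_le _ _ (_ : topo != eo)) _; first by rewrite eq_sym.
rewrite D_form // -/(sV eo topo) [Wf _ _]Wf_e_top.
have -> : F P topo eo = 0 by apply: F_to => //=; rewrite /z; lia.
lia.
Qed.

Lemma score_X_le (c : 'I_m) : 3 <= c < z -> (maximin_score P V c <= sV c zo)%R.
Proof.
move=> Hc; have cz : c != zo by rewrite -val_eqE /=; lia.
apply: le_trans (score_le _ _ (_ : zo != c)) _; first by rewrite eq_sym.
rewrite D_form // -/(sV c zo) Wf_X // (F_z (a := zo)) //; lia.
Qed.

Lemma score_X_sat (c y : 'I_m) : 3 <= c < z -> 0 < F P c y -> (maximin_score P V c <= -2 + sV c y)%R.
Proof.
move=> Hc Hf; have cy : c != y.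
  by apply/eqP => E; have E0 := F_anti PE PE Hf; rewrite -E in E0 Hf; rewrite E0 in Hf.
apply: le_trans (score_le _ _ (_ : y != c)) _; first by rewrite eq_sym.
rewrite D_form // -/(sV c y) Wf_X // (F_anti PE PE Hf); lia.
Qed.

(** When no margin is lowered, only the manipulator's own vote can contribute negatively, and it
    contributes at least -1. *)
Lemma score_X_unsat (c : 'I_m) : 3 <= c < z -> unsat P c -> (-1 <= maximin_score P V c)%R.
Proof.
move=> Hc [_ Hu]; apply: score_ge => // y yc.
rewrite D_form 1?eq_sym // -/(sV c y) Wf_X // Hu; have := sV_bound c y; lia.
Qed.

(** The margin to [z] starts at -2 and the most favourable vote adds 1, so no vote lifts [top] above
    -1. *)
Lemma score_top_le : (maximin_score P V topo <= -2 * (F P topo zo)%:Z - 1)%R.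
Proof.
have ne : topo != zo by rewrite -val_eqE /= /top /z; lia.
apply: le_trans (score_le _ _ (_ : zo != topo)) _; first by rewrite eq_sym.
rewrite D_form // -/(sV topo zo) [Wf _ _]Wf_top (F_z (a := zo)) //= eqxx.
have := sV_bound topo zo; have -> : (z == e) = false by rewrite /z /e; lia.
lia.
Qed.

Lemma score_top_unsat : unsat P topo -> (forall y, y != topo -> V topo y) -> (-1 <= maximin_score P V topo)%R.
Proof.
move=> [_ Hu] HV; apply: score_ge => // y yc.
have yc' : topo != y by rewrite eq_sym.
rewrite D_form // -/(sV topo y) [Wf _ _]Wf_top Hu sV_odd // HV //.
case: (val y == e) => /=; case: (val y == z) => /=; lia.
Qed.

Lemma score_wd_ge (c : 'I_m) : (c == w :> nat) || (c == d :> nat) -> V c eo -> (-3 <= maximin_score P V c)%R.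
Proof.
move=> Hc HV; apply: score_ge => // y yc.
have yc' : c != y by rewrite eq_sym.
rewrite D_form // -/(sV c y) (F_w (a := c)); last by rewrite Hc.
case: (eqVneq y eo) => [->|ye].
  rewrite [Wf _ _]Wf_e; last by rewrite !inE orbA Hc.
  rewrite sV_odd; first by rewrite HV; lia.
  by apply/eqP => E; move: Hc; rewrite E.
rewrite Wf_wd //; have := sV_bound c y; lia.
Qed.
End Scores.

Lemma winner_unique n (P : 'I_n -> rel 'I_m) V w1 w2 :
  maximin_winner P V w1 -> maximin_winner P V w2 -> w1 = w2.
Proof.
move=> H1 H2; apply/eqP/negPn/negP => ne.
have ne' : w2 != w1 by rewrite eq_sym.
by case: (H1 _ ne') (H2 _ ne) => [A|[A B]] [A'|[A' B']]; lia.
Qed.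

Lemma winner_exists n (P : 'I_n -> rel 'I_m) V : exists w', maximin_winner P V w'.
Proof.
case: (@arg_maxP _ _ _ eo predT (maximin_score P V) isT) => i _ Hi.
have {}Hi c : (maximin_score P V c <= maximin_score P V i)%R by apply: Hi.
have Hj : maximin_score P V i == maximin_score P V i by [].
case: (@arg_minnP _ i (fun j => maximin_score P V j == maximin_score P V i) val Hj) => j /eqP Ej Hjm.
exists j => c cj; have := Hi c; rewrite -Ej le_eqVlt => /orP[/eqP E|]; last by left.
right; split=> //; have := Hjm c; rewrite E Ej eqxx => /(_ isT).
by rewrite leq_eqVlt => /orP[/eqP/val_inj E'|//]; rewrite E' eqxx in cj.
Qed.

Lemma alt_cases (c : 'I_m) : [\/ c = eo, val c \in [:: w; d; z] | isX c].
Proof.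
have [E|E] := eqVneq (val c) e; first by apply: Or31; apply: val_inj.
case: (boolP (val c \in [:: w; d; z])) => H; first exact: Or32.
by apply: Or33; move: (ltn_ord c) H E; rewrite /isX !inE /e /w /d /z /= => H1 H2 H3; lia.
Qed.

Definition Vsw : rel 'I_m := fun a b => lead [:: d; e] b a.

Lemma VM_linear : is_linear_order VM. Proof. exact: (linear_flip_lead [::]). Qed.
Lemma Vsw_linear : is_linear_order Vsw. Proof. exact: linear_flip_lead. Qed.

Lemma Vsw_VM (a b : 'I_m) : 1 < maxn a b -> a != b -> Vsw a b = VM a b.
Proof.
rewrite /Vsw /VM /= /lead /= => H ab; have : val a != val b by [].
by lead_cases.
Qed.

(** Leaves only the pair of [d] and [e] open, so that [VM] and [Vsw] can be treated together. *)
Definition agree (V : rel 'I_m) := is_linear_order V /\ forall a b : 'I_m, 1 < maxn a b -> a != b -> V a b = VM a b.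

Lemma agree_VM : agree VM. Proof. by split=> //; apply: VM_linear. Qed.
Lemma agree_Vsw : agree Vsw. Proof. by split; [apply: Vsw_linear|apply: Vsw_VM]. Qed.

(** * Winners under the truthful vote and under the swapped vote *)

Section Winners.
Variables (P : 'I_(G + (G + 10)) -> rel 'I_m) (V : rel 'I_m).
Hypotheses (PE : in_info_set po P) (AV : agree V).
Let Vl : is_linear_order V := AV.1.

Lemma sV_lt (a b : 'I_m) : a < b -> 1 < b -> sV V a b = (-1)%R.
Proof.
move=> ab b1; have nab : a != b by rewrite -val_eqE /= neq_ltn ab.
rewrite sV_odd // AV.2 //; last by rewrite leq_max b1 orbT.
by rewrite /VM ltnNge (ltnW ab).
Qed.

Lemma score_unsat (c : 'I_m) : unsat P c -> maximin_score P V c = (-1)%R.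
Proof.
move=> Hu; apply/eqP; rewrite eq_le; case/isXP: (Hu.1) => Hc.
  rewrite score_X_unsat // andbT; apply: le_trans (score_X_le PE Vl Hc) _.
  by rewrite sV_lt //=; move: Hc; rewrite /=; lia.
have Ec : c = topo by apply: val_inj.
rewrite Ec in Hu *; rewrite score_top_unsat //; last first.
  move=> y yt; rewrite AV.2 /VM /=; [|rewrite /top; lia|by rewrite eq_sym].
  by move: yt (ltn_ord y); rewrite -val_eqE /= /top; lia.
rewrite andbT; apply: le_trans (score_top_le PE Vl) _; lia.
Qed.

Lemma score_sat (c : 'I_m) : isX c -> ~ unsat P c -> (maximin_score P V c <= -3)%R.
Proof.
move=> Hx Hu.
have [y Hy] : exists y, 0 < F P c y.
  case: (pickP (fun y => 0 < F P c y)) => [y Hy|H0]; first by exists y.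
  by case: Hu; split=> // y; move: (H0 y); rewrite lt0n => /negbFE/eqP.
have Hcy := F_canflip PE Hy; case/isXP: Hx => Hc.
  apply: le_trans (score_X_sat PE Vl Hc Hy) _.
  have cy : c < y by case: (canflip_r Hcy) => [->|[]//]; case/andP: Hc.
  by rewrite sV_lt //; lia.
have Ec : c = topo by apply: val_inj.
have Ey : y = zo by apply: val_inj; apply: canflip_top; rewrite -Hc.
rewrite Ec; apply: le_trans (score_top_le PE Vl) _.
by rewrite Ec Ey in Hy; lia.
Qed.

Lemma score_e_low : (maximin_score P V eo <= -5)%R.
Proof.
apply: le_trans (score_e PE Vl) _; by rewrite sV_lt //= /top; lia.
Qed.

Lemma score_wdz_low (c : 'I_m) : val c \in [:: w; d; z] -> (maximin_score P V c <= -3)%R.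
Proof. by move=> Hc; apply: le_trans (score_wdz PE Vl Hc) _; have := sV_bound V c eo; lia. Qed.

Lemma winner_unsat u : unsat P u -> (forall c, unsat P c -> u <= c) -> maximin_winner P V u.
Proof.
move=> Hu Hmin c cu; rewrite (score_unsat Hu).
case: (alt_cases c) => [->|Hc|Hc].
- by left; apply: le_lt_trans score_e_low _.
- by left; apply: le_lt_trans (score_wdz_low Hc) _.
- case: (pselect (unsat P c)) => Hc'; last by left; apply: le_lt_trans (score_sat Hc Hc') _.
  right; split; first exact: score_unsat.
  by rewrite ltn_neqAle Hmin // andbT -val_eqE eq_sym in cu *.
Qed.

(** Everybody scores at most -3, so an alternative that reaches -3 wins if it has the least index
    among those doing so. [e] is always at -5 or lower; [d] comes next, and [w] follows when [d] has
    dropped too. *)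
Lemma winner_sat (v : 'I_m) : (forall c, ~ unsat P c) -> (-3 <= maximin_score P V v)%R ->
  (v == w :> nat) && (maximin_score P V d' <= -5)%R || (v == d :> nat) ->
  maximin_winner P V v.
Proof.
move=> Hs Hv Hvw c cv.
case: (alt_cases c) => [->|Hc|Hc].
- by left; apply: le_lt_trans score_e_low _; apply: lt_le_trans Hv.
- have := score_wdz_low Hc; move: Hc; rewrite !inE => Hc Hlow.
  case/orP: Hvw => [/andP[/eqP Ew Hd]|/eqP Ed].
    case: (eqVneq (val c) d) => [Ec|nd].
      have -> : c = d' by apply: val_inj.
      by left; apply: le_lt_trans Hd _; apply: lt_le_trans Hv.
    have vc : v < c by move: Hc nd cv; rewrite -val_eqE /= Ew /w /d /z; lia.
    by case: (ltrP (maximin_score P V c) (maximin_score P V v)) => H; [left|right; split=> //; lia].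
  have vc : v < c by move: Hc cv; rewrite -val_eqE /= Ed /w /d /z; lia.
  by case: (ltrP (maximin_score P V c) (maximin_score P V v)) => H; [left|right; split=> //; lia].
- have := score_sat Hc (Hs c) => Hlow.
  have vc : v < c by case/orP: Hvw => [/andP[/eqP -> _]|/eqP ->]; case/andP: Hc => /andP[]; rewrite /w /d; lia.
  by case: (ltrP (maximin_score P V c) (maximin_score P V v)) => H; [left|right; split=> //; lia].
Qed.
End Winners.

Lemma exists_min_unsat P u : unsat P u ->
  exists u, unsat P u /\ forall c, unsat P c -> u <= c.
Proof.
move=> Hu; pose Q (c : 'I_m) := isX c && [forall y, F P c y == 0].
have QP c : reflect (unsat P c) (Q c).
  apply: (iffP andP) => -[H1 H2]; split=> //; first by move=> y; apply/eqP; apply: (forallP H2).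
  by apply/forallP => y; rewrite H2.
have /QP Qu := Hu.
by case: (arg_minnP val Qu) => v /QP Hv Hm; exists v; split=> // c /QP; apply: Hm.
Qed.

Lemma VM_winner_sat P : in_info_set po P -> (forall c, ~ unsat P c) -> maximin_winner P VM d'.
Proof.
move=> PE Hs; apply: (winner_sat PE agree_VM Hs); last by [].
exact: (score_wd_ge PE VM_linear).
Qed.

Lemma Vsw_winner_sat P : in_info_set po P -> (forall c, ~ unsat P c) -> maximin_winner P Vsw wo.
Proof.
move=> PE Hs; apply: (winner_sat PE agree_Vsw Hs).
  exact: (score_wd_ge PE Vsw_linear).
rewrite orbF; apply: le_trans (score_wdz PE Vsw_linear _) _; first by [].
rewrite (sV_odd Vsw_linear) //; have -> : Vsw d' eo = false by []; lia.
Qed.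

Lemma unsat_profile_of sg c : unsat (profile_of sg) c -> ~ sat_clause sg c.
Proof.
move=> [Hx Hu] [i Hi Hs].
have ok := gd_ok Hi.
have Hh : head_of (gd i) < m by move: ok; rewrite /gadget_ok /isX => /and3P[/andP[/andP[]]].
pose y := if sg i then zo else Ordinal Hh.
have := Hu y; apply/eqP; rewrite -lt0n; apply/F_gt0P; exists (Ordinal Hi).
rewrite fl_profile_of /flips /y /=; move: Hs.
by case: (sg i) => /=; [rewrite orbF => /eqP ->|case/orP => /eqP ->]; rewrite !eqxx ?orbT.
Qed.

(** * Satisfying assignments and dominating votes *)

Theorem dominating_of_sat :
  (exists sg, forall c, isX c -> sat_clause sg c) -> dominating_manipulation po VM.
Proof.
move=> [sg Hsg]; exists Vsw; split; first exact: Vsw_linear; split.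
- move=> P PE w' w0 Hw' Hw0.
  case: (pselect (exists c, unsat P c)) => [[c /exists_min_unsat[u [Hu Hm]]]|Hn].
    left; rewrite (winner_unique Hw' (winner_unsat PE agree_Vsw Hu Hm)).
    by rewrite (winner_unique Hw0 (winner_unsat PE agree_VM Hu Hm)).
  have Hn' c : ~ unsat P c by move=> H; apply: Hn; exists c.
  rewrite (winner_unique Hw' (Vsw_winner_sat PE Hn')) (winner_unique Hw0 (VM_winner_sat PE Hn')).
  by right.
- exists (profile_of sg); split; first exact: profile_of_info.
  have Hn c : ~ unsat (profile_of sg) c by move=> H; have := unsat_profile_of H; apply; apply: Hsg; case: H.
  exists wo, d'; split; first by apply: Vsw_winner_sat => //; apply: profile_of_info.
  by split; first by apply: VM_winner_sat => //; apply: profile_of_info.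
Qed.

Lemma F_le1 sg (a b : 'I_m) :
  (forall i j, i < G -> j < G -> flips sg a b i -> flips sg a b j -> i = j) -> F (profile_of sg) a b <= 1.
Proof.
move=> H; case: (posnP (F (profile_of sg) a b)) => [->//|/F_gt0P[i Hi]].
rewrite /F (bigD1 i) //= Hi big1 // => j ji.
case E : (fl _ _ _ j) => //; move: E Hi; rewrite !fl_profile_of => Hj Hi.
by rewrite (val_inj (H _ _ (ltn_ord j) (ltn_ord i) Hj Hi)) eqxx in ji.
Qed.

Theorem sat_of_dominating (sr : nat -> bool) :
  (forall c, isX c -> c != top -> sat_clause sr c) ->
  (forall a b i j, isX a -> a != top -> i < G -> j < G -> flips sr a b i -> flips sr a b j -> i = j) ->
  dominating_manipulation po VM -> exists sg, forall c, isX c -> sat_clause sg c.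
Proof.
move=> Hr H1 [V' [V'l [Hdom [P [PE [w' [w0 [Hw' [Hw0 Hbetter]]]]]]]]].
pose Pr := profile_of sr.
have PrE : in_info_set po Pr by apply: profile_of_info.
case: (pselect (exists c, unsat Pr c)) => [[t Ht]|Hn]; last first.
  by apply: (sat_of_profile PrE) => c H; apply: Hn; exists c.
case: (pselect (exists c, unsat P c)) => [[c0 Hc0]|Hn]; last first.
  by apply: (sat_of_profile PE) => c H; apply: Hn; exists c.
exfalso.
have onlytop c : unsat Pr c -> c = topo.
  move=> H; apply: val_inj => /=; apply/eqP/negPn/negP => ne.
  by case: (unsat_profile_of H); apply: Hr ne; case: H.
have Ht' : unsat Pr topo by rewrite -(onlytop t).
have Wr : maximin_winner Pr VM topo.
  by apply: (winner_unsat PrE agree_VM Ht') => c /onlytop ->.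
(* [top] is first in [VM], so a dominating vote cannot replace it. *)
have Wr' : maximin_winner Pr V' topo.
  have [x Hx] := winner_exists Pr V'.
  case: (Hdom _ PrE _ _ Hx Wr) => [<-//|]; rewrite /VM /= => H.
  by have := ltn_ord x; move: H; rewrite /top; lia.
(* With the largest index [top] loses every tie, hence it beats all others strictly. *)
have Hlt c : c != topo -> (maximin_score Pr V' c < -1)%R.
  move=> ct; case: (Wr' _ ct) => [H|[_ H]].
    by apply: lt_le_trans H _; apply: le_trans (score_top_le PrE V'l) _; lia.
  by have := ltn_ord c; move: H; rewrite /= /top; lia.
have [u [Hu Hm]] := exists_min_unsat Hc0.
have Eu : w0 = u := winner_unique Hw0 (winner_unsat PE agree_VM Hu Hm).
move: Hbetter; rewrite /VM Eu => uw'.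
have wm := ltn_ord w'.
have Hux : 3 <= u < z by case/isXP: (Hu.1) => // E; move: uw' wm; rewrite E /top; lia.
have Hsu := score_X_unsat PE V'l Hux Hu.
(* A tie would be decided for [u], which has the smaller index. *)
have {}Hw' : (-1 < maximin_score P V' w')%R.
  have uw : u != w' by rewrite -val_eqE /= neq_ltn uw'.
  by case: (Hw' _ uw) => [|[_ H]]; [apply: le_lt_trans|move: uw' H; lia].
have Hwx : 3 <= w' < z.
  case: (alt_cases w') => [E|E|/isXP[//|E]].
  - by move: uw'; rewrite E.
  - by have := score_wdz PE V'l E; have := sV_bound V' w' eo; move: Hw'; lia.
  - have Et : w' = topo by apply: val_inj.
    by have := score_top_le PE V'l; move: Hw'; rewrite Et; lia.
have wt : w' != topo by rewrite -val_eqE /=; move: Hwx; rewrite /z /top; lia.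
suff : (-1 <= maximin_score Pr V' w')%R by move: (Hlt _ wt); lia.
apply: score_ge => // y yw; have wy : w' != y by rewrite eq_sym.
(* Margins are odd, so above -1 means at least 1. *)
have HD : (1 <= D P V' w' y)%R.
  have := score_le P V' yw; have [k Ek] := D_odd PE V'l wy; move: Hw'; rewrite Ek; lia.
move: HD; rewrite !D_form // Wf_X // -/(sV V' w' y).
have HF : F Pr w' y <= 1.
  by apply: F_le1 => i j; apply: H1; [apply/isXP; left|move: Hwx; rewrite /z /top; lia].
have := sV_bound V' w' y.
(* If the fallback leaves this margin alone or raises it, only the vote [V'] can be negative. If the
   fallback lowers it, no completion raises it, so the value 1 in [P] comes from [V'] ranking [w']
   above [y]; the fallback then has at least -2 + 1. *)
case: (posnP (F Pr w' y)) => [->|H0]; first by lia.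
rewrite (F_anti PrE PE H0) (F_anti PrE PrE H0); lia.
Qed.

Lemma po_cases i : is_linear_order (po i) \/ exists j : 'I_G, po i = fun a b => gvote (gd j) a b.
Proof.
case: (split_ordP i) => j ->; first by right; exists j; apply: po_gi.
case: (split_ordP j) => k ->; left; first by rewrite po_mid; apply: linear_flip_lead.
by rewrite po_special; apply: linear_special.
Qed.

Lemma po_partial i : is_partial_order (po i).
Proof.
case: (po_cases i) => [/andP[]//|[j ->]].
apply/andP; split; first by apply/forallP => a; rewrite /gvote /up lead_irr.
do 3![apply/forallP => ?]; apply/implyP => /andP[H1 H2]; apply/implyP => /andP[H3 H4].
by apply/andP; split; [apply: lead_trans H1 H3|apply: lead_trans H2 H4].
Qed.

Lemma po_unknown i : unknown_pairs (po i) <= 4.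
Proof.
case: (po_cases i) => [Hl|[j Ej]].
  rewrite /unknown_pairs eq_card0 // => -[a b]; rewrite !inE /=.
  case: ltnP => //= ab; have ne : a != b by rewrite -val_eqE /= neq_ltn ab.
  by rewrite (linear_total Hl ne) negbK andNb.
have ok := gd_ok (ltn_ord j); rewrite /unknown_pairs {}Ej.
pose o (u v : nat) := if u < v then (u, v) else (v, u).
pose s := [:: o (head_of (gd j)) z; o (head_of (gd j)) (body1 (gd j)); o (head_of (gd j)) (body2 (gd j))].
set A := [set _ | _].
have fI : injective (fun ab : 'I_m * 'I_m => (val ab.1, val ab.2)).
  by move=> [a b] [a' b'] [] /val_inj -> /val_inj ->.
rewrite cardE -(size_map (fun ab : 'I_m * 'I_m => (val ab.1, val ab.2))).
apply: (@leq_trans (size s)) => //; apply: uniq_leq_size; first by rewrite (map_inj_uniq fI) enum_uniq.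
move=> _ /mapP[[a b] + ->]; rewrite mem_enum inE /= => /andP[/andP[ab Hab] Hba].
have ne : val a != val b by rewrite neq_ltn ab.
have : mid (gd j) a b || mid (gd j) b a by apply: lead_total.
rewrite !inE /o; case/orP => /mid_not_gvote - /(_ ok).
- move/(_ Hab) => /orP[/andP[/eqP <- /eqP <-]|/andP[/eqP <- /orP[]/eqP <-]];
    by rewrite ?ab ?(ltnNge b) ?(ltnW ab) /= eqxx ?orbT.
- move/(_ Hba) => /orP[/andP[/eqP <- /eqP <-]|/andP[/eqP <- /orP[]/eqP <-]];
    by rewrite ?ab ?(ltnNge b) ?(ltnW ab) /= eqxx ?orbT.
Qed.
End Election.


(** * Forbidden configurations *)

(* Every cell [p <= R] receives at least one of [K] tiles; the set [mem _ _ j] of (cell, tile)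
   pairs, [j < B], must not be entirely chosen. Each (cell, tile) pair is copied [B.+1] times,
   copy [j.+1] implying copy [j], so that every copy occurs at most twice negatively. *)
Section Forbidden.
Variables (R K B : nat) (mem : nat -> nat -> nat -> bool).
Hypotheses (K0 : 0 < K) (B0 : 0 < B).

(** Clause numbers: from 3 the clauses of the [B] conflicts, then those for the implications between
    copies, then from [base] the clauses of the cells. In this order every body precedes its
    head. *)
Definition base := 3 + B + R.+1 * K * B.
Definition chain p k j := 3 + B + ((p * K + k) * B + j).
(** The last cell skips [malt - 2], which is [z], and gets [malt - 1], which is [top]. *)
Definition cellc p := base + p + (p == R).
Definition malt := base + R + 2.

Definition coord := (nat * nat * nat)%type.
(** Clause [chain p k j] reads: copy [j] holds or copy [j.+1] fails. Copy [j] is thus its head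
    variable and occurs negatively in the previous such clause and, if the pair belongs to conflict
    [j], in the clause of that conflict. Copy [B] is the choice itself, with the clause of the cell
    as head. A product with a false Boolean is the missing body 0. *)
Definition gad (c : coord) : gadget :=
  let: (p, k, j) := c in
  if j < B then (chain p k j, (0 < j) * chain p k j.-1, mem p k j * (3 + j))
  else (cellc p, chain p k B.-1, 0).
Definition in_coords (c : coord) := let: (p, k, j) := c in [&& p <= R, k < K & j <= B].
Definition coords : seq coord :=
  [seq (pk, j) | pk <- [seq (p, k) | p <- iota 0 R.+1, k <- iota 0 K], j <- iota 0 B.+1].
Definition gads := map gad coords.

Lemma mem_coords c : (c \in coords) = in_coords c.
Proof.
case: c => [[p k] j]; apply/idP/idP => [|/and3P[H1 H2 H3]].
  case/allpairsP => -[pk' j'] [].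
  case/allpairsP => -[p1 k1] [H1 H2 E] H3 E'; move: E' H1 H2 H3; rewrite {}E => -[-> -> ->].
  by rewrite !mem_iota /=; lia.
apply/allpairsP; exists ((p, k), j); split=> //; last by rewrite mem_iota; move: H3; rewrite /=; lia.
by apply/allpairsP; exists (p, k); split=> //; rewrite mem_iota; move: H1 H2; rewrite /=; lia.
Qed.

Lemma uniq_coords : uniq coords.
Proof.
apply: allpairs_uniq; [apply: allpairs_uniq|exact: iota_uniq|]; try exact: iota_uniq.
all: by move=> [? ?] [? ?] _ _ [-> ->].
Qed.

Lemma radix_inj b a c a' c' : c < b -> c' < b -> a * b + c = a' * b + c' -> a = a' /\ c = c'.
Proof.
move=> H H' E; have b0 : 0 < b by apply: leq_ltn_trans H.
have := congr1 (divn^~ b) E; have := congr1 (modn^~ b) E.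
by rewrite !modnMDl !modn_small // !divnMDl // !divn_small // !addn0.
Qed.

Lemma chain_inj p k j p' k' j' : k < K -> k' < K -> j < B -> j' < B ->
  chain p k j = chain p' k' j' -> (p, k, j) = (p', k', j').
Proof.
move=> Hk Hk' Hj Hj' /addnI /(radix_inj Hj Hj')[/(radix_inj Hk Hk')[-> ->] ->] //.
Qed.

Lemma chain_bounds p k j : p <= R -> k < K -> j < B -> 3 + B <= chain p k j < base.
Proof.
move=> Hp Hk Hj; rewrite /chain leq_addr /base ltn_add2l /=.
have : p * K + k < R.+1 * K by nia.
nia.
Qed.

Lemma cellc_bounds p : p <= R -> base <= cellc p < malt.
Proof. by rewrite /cellc /malt; case: eqP; lia. Qed.

Lemma cellc_inj p p' : p <= R -> p' <= R -> cellc p = cellc p' -> p = p'.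
Proof. by rewrite /cellc; do 2![case: eqP]; lia. Qed.

Lemma cellc_neq_z p : p <= R -> cellc p != malt - 2.
Proof. by rewrite /cellc /malt; case: eqP; lia. Qed.

Lemma gads_ok : all (gadget_ok malt) gads.
Proof.
apply/allP => _ /mapP[[[p k] j] + ->]; rewrite mem_coords => /and3P[Hp Hk Hj].
have Eb : 3 + B <= base by rewrite /base leq_addr.
rewrite /gad; case: ltnP => HjB; rewrite /gadget_ok /isX /body_ok /head_of /body1 /body2 /=.
  have := chain_bounds Hp Hk HjB; have : chain p k j.-1 < chain p k j \/ j = 0 by rewrite /chain; lia.
  rewrite /malt; case: (mem p k j); case: j {Hj} HjB => [|j] HjB /=; rewrite ?mul1n ?mul0n => H1 H2.
  - lia.
  - have := @chain_bounds p k j Hp Hk (ltnW HjB); lia.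
  - lia.
  - have := @chain_bounds p k j Hp Hk (ltnW HjB); lia.
have := cellc_bounds Hp; have := cellc_neq_z Hp; have HB : B.-1 < B by lia.
have := chain_bounds Hp Hk HB; rewrite /malt; lia.
Qed.

Definition cd i : coord := nth (0, 0, 0) coords i.

Lemma size_gads : size gads = size coords. Proof. exact: size_map. Qed.

Lemma gd_gads i : i < size gads -> gd gads i = gad (cd i) /\ in_coords (cd i).
Proof.
rewrite size_gads => Hi; rewrite -mem_coords mem_nth //.
by rewrite /gd (nth_map (0, 0, 0)).
Qed.

Lemma cd_index c : in_coords c -> index c coords < size gads /\ cd (index c coords) = c.
Proof. by rewrite -mem_coords size_gads index_mem => H; rewrite /cd nth_index. Qed.

Definition forbidden_sat (n : nat) (ch : nat -> nat -> bool) :=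
  (forall p, p < n -> exists2 k, k < K & ch p k) /\
  (forall j, j < B -> exists p k, [/\ p <= R, k < K, mem p k j & ~~ ch p k]).

Lemma isX_cellc p : p <= R -> isX malt (cellc p).
Proof.
move=> Hp; have := cellc_bounds Hp; have := cellc_neq_z Hp; rewrite /isX /base; lia.
Qed.

Lemma isX_chain p k j : p <= R -> k < K -> j < B -> isX malt (chain p k j).
Proof. by move=> Hp Hk Hj; have := chain_bounds Hp Hk Hj; rewrite /isX /malt; lia. Qed.

Lemma isX_use j : j < B -> isX malt (3 + j).
Proof. by move=> Hj; rewrite /isX /malt /base; lia. Qed.

Lemma isX_cases c : isX malt c ->
  [\/ exists2 j, j < B & c = 3 + j,
      exists p k j, [/\ p <= R, k < K, j < B & c = chain p k j] |
      exists2 p, p <= R & c = cellc p].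
Proof.
rewrite /isX /malt => /andP[/andP[H3 Hm] Hz].
have [H1|H1] := ltnP c (3 + B); first by apply: Or31; exists (c - 3); lia.
have [H2|H2] := ltnP c base.
  apply: Or32; set x := c - (3 + B); have Hx : x < R.+1 * K * B by rewrite /x; move: H2; rewrite /base; lia.
  exists (x %/ B %/ K), (x %/ B %% K), (x %% B).
  rewrite !ltn_mod /chain -!divn_eq -ltnS !ltn_divLR // K0 B0; split=> //; rewrite /x; lia.
apply: Or33; have [H4|H4] := ltnP c (base + R).
  by exists (c - base); [lia|rewrite /cellc; case: eqP; lia].
by exists R; [|rewrite /cellc eqxx; lia].
Qed.

Lemma gad_clause_cell p c : p <= R -> in_coords c ->
  [/\ (head_of (gad c) == cellc p) -> c.1.1 = p /\ c.2 = B,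
      body1 (gad c) != cellc p & body2 (gad c) != cellc p].
Proof.
case: c => [[p' k'] j'] Hp /and3P[Hp' Hk' Hj']; have Hc := cellc_bounds Hp.
have Eb : 3 + B <= base by rewrite /base leq_addr.
have E3 : base = 3 + B + R.+1 * K * B by [].
rewrite /gad; case: ltnP => HjB; rewrite /head_of /body1 /body2 /=.
  have H1 := chain_bounds Hp' Hk' HjB; have H2 : chain p' k' j'.-1 <= chain p' k' j' by rewrite /chain; lia.
  split.
  - lia.
  - by case: (0 < j'); lia.
  - by case: (mem p' k' j'); lia.
have HB : B.-1 < B by lia.
have /andP[_ H1] := chain_bounds Hp' Hk' HB.
split.
- by move=> /eqP/(cellc_inj Hp' Hp) ->; split=> //; lia.
- lia.
- lia.
Qed.

Lemma gad_clause_chain p k j c : p <= R -> k < K -> j < B -> in_coords c ->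
  [/\ (head_of (gad c) == chain p k j) = (c == (p, k, j)),
      (body1 (gad c) == chain p k j) = (c == (p, k, j.+1)) & body2 (gad c) != chain p k j].
Proof.
case: c => [[p' k'] j'] Hp Hk Hj /and3P[Hp' Hk' Hj']; have Hc := chain_bounds Hp Hk Hj.
rewrite /gad; case: ltnP => HjB; rewrite /head_of /body1 /body2 /=.
  split.
  - by apply/eqP/eqP => [/(chain_inj Hk' Hk HjB Hj)|[-> -> ->]].
  - case: j' HjB {Hj'} => [|j'] HjB /=; first by apply/eqP/eqP => [|[]]; lia.
    by rewrite mul1n; apply/eqP/eqP => [/(chain_inj Hk' Hk (ltnW HjB) Hj)[-> -> ->]|[-> -> ->]].
  - by case: (mem p' k' j'); lia.
have Ej : j' = B by lia.
have HB : B.-1 < B by lia.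
split.
- apply/eqP/eqP => [H|[_ _ H]]; last lia.
  by have := cellc_bounds Hp'; lia.
- rewrite Ej; apply/eqP/eqP => [/(chain_inj Hk' Hk HB Hj)[-> -> E]|[-> -> E]]; [congr (_, _)|congr chain]; lia.
- lia.
Qed.

Lemma gad_clause_use j c : j < B -> in_coords c ->
  [/\ head_of (gad c) != 3 + j, body1 (gad c) != 3 + j &
      (body2 (gad c) == 3 + j) -> c.2 = j /\ mem c.1.1 c.1.2 j].
Proof.
case: c => [[p' k'] j'] Hj /and3P[Hp' Hk' Hj'].
have Eb : 3 + B <= base by rewrite /base leq_addr.
rewrite /gad; case: ltnP => HjB; rewrite /head_of /body1 /body2 /=.
  have H1 := chain_bounds Hp' Hk' HjB; split; first by lia.
    by case: j' {Hj' H1} HjB => [|j'] HjB /=; rewrite ?mul1n /chain; lia.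
  case E : (mem p' k' j') => /=; last by lia.
  by rewrite mul1n => /eqP/addnI Ej; rewrite -Ej.
split; [by have := cellc_bounds Hp'; lia|by rewrite /chain; lia|lia].
Qed.

(** The choice is read off copy [B]. It implies all lower copies, so a false copy [j] that satisfies
    the clause of conflict [j] certifies a tile that is not chosen. *)
Theorem forbidden_of_sat sg : (forall c, isX malt c -> sat_clause gads sg c) ->
  exists ch, forbidden_sat R.+1 ch.
Proof.
move=> H; pose on c := sg (index c coords).
have onE i : i < size gads -> on (cd i) = sg i.
  by move=> Hi; rewrite /on /cd index_uniq // ?uniq_coords -?size_gads.
have Hchain p k j : p <= R -> k < K -> j < B -> on (p, k, j.+1) -> on (p, k, j).
  move=> Hp Hk Hj; have [i Hi] := H _ (isX_chain Hp Hk Hj).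
  have [-> Hc] := gd_gads Hi; have [-> -> /negbTE ->] := gad_clause_chain Hp Hk Hj Hc.
  by rewrite -(onE i Hi) orbF => /orP[] /andP[Ho /eqP <-] => // /(negP Ho).
have Hall p k : p <= R -> k < K -> on (p, k, B) -> forall j, j <= B -> on (p, k, B - j).
  move=> Hp Hk Ho; elim=> [|j IH] Hj; first by rewrite subn0.
  apply: Hchain => //; first by lia.
  have -> : (B - j.+1).+1 = B - j by lia.
  by apply: IH; lia.
exists (fun p k => on (p, k, B)); split=> [p Hp|j Hj].
  have [i Hi] := H _ (isX_cellc Hp).
  have [-> Hc] := gd_gads Hi; have [H1 /negbTE -> /negbTE ->] := gad_clause_cell Hp Hc.
  rewrite andbF orbF -(onE i Hi) => /andP[Ho /H1].
  by case: (cd i) Hc Ho => [[p' k'] j'] /and3P[_ Hk _] Ho /= [E1 E2]; exists k'; rewrite // -E1 -E2.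
have [i Hi] := H _ (isX_use Hj).
have [-> Hc] := gd_gads Hi; have [/negbTE -> /negbTE -> H1] := gad_clause_use Hj Hc.
rewrite andbF -(onE i Hi) => /andP[Ho /H1].
case: (cd i) Hc Ho => [[p' k'] j'] /and3P[Hp Hk _] Ho /= [E1 E2]; exists p', k'; split=> //.
apply/negP => /(Hall _ _ Hp Hk) => /(_ (B - j') (leq_subr _ _)).
by rewrite subKn ?E1 ?(ltnW Hj) // -E1 (negbTE Ho).
Qed.

Definition sg_of (ch : nat -> nat -> bool) (i : nat) := ch (cd i).1.1 (cd i).1.2.

(** All copies of a pair receive the same value. Cells from [n] on may be empty, at the price of
    their own clauses only; the fallback has [n = R]. *)
Theorem sat_of_forbidden n ch c : n <= R.+1 -> forbidden_sat n ch -> isX malt c ->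
  (forall p, p <= R -> c = cellc p -> p < n) -> sat_clause gads (sg_of ch) c.
Proof.
move=> Hn [H1 H2] /isX_cases[[j Hj ->] _|[p [k [j [Hp Hk Hj ->]]]] _|[p Hp ->] /(_ p Hp (erefl _)) Hpn].
- have [p [k [Hp Hk Hm Hc]]] := H2 j Hj.
  have [|Hi Ei] := @cd_index (p, k, j); first by rewrite /= Hp Hk ltnW.
  exists (index (p, k, j) coords) => //; have [-> _] := gd_gads Hi.
  by rewrite /sg_of Ei /= Hj (negbTE Hc) Hm /body2 /= mul1n eqxx orbT.
- case Hc : (ch p k).
    have Hin : in_coords (p, k, j) by rewrite /= Hp Hk ltnW.
    have [Hi Ei] := cd_index Hin.
    exists (index (p, k, j) coords) => //; have [-> _] := gd_gads Hi.
    by rewrite /sg_of Ei Hc; have [-> _ _] := gad_clause_chain Hp Hk Hj Hin; rewrite eqxx.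
  have Hin : in_coords (p, k, j.+1) by rewrite /= Hp Hk.
  have [Hi Ei] := cd_index Hin.
  exists (index (p, k, j.+1) coords) => //; have [-> _] := gd_gads Hi.
  by rewrite /sg_of Ei Hc /=; have [_ -> _] := gad_clause_chain Hp Hk Hj Hin; rewrite eqxx.
- have [k Hk Hc] := H1 p Hpn.
  have Hin : in_coords (p, k, B) by rewrite /= Hp Hk leqnn.
  have [Hi Ei] := cd_index Hin.
  exists (index (p, k, B) coords) => //; have [-> _] := gd_gads Hi.
  by rewrite /sg_of Ei Hc /= ltnn /head_of /= eqxx.
Qed.

(** Only variables for the tiles of one cell share a head. True ones coincide because at most one
    tile is chosen; false ones lower margins of different [chain] clauses. *)
Theorem flips_unique (ch : nat -> nat -> bool) : (forall p k k', ch p k -> ch p k' -> k = k') ->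
  forall a b i j, isX malt a -> i < size gads -> j < size gads ->
  flips malt gads (sg_of ch) a b i -> flips malt gads (sg_of ch) a b j -> i = j.
Proof.
move=> Hch a b i j Ha Hi Hj; have [Ei Ci] := gd_gads Hi; have [Ej Cj] := gd_gads Hj.
suff E : flips malt gads (sg_of ch) a b i -> flips malt gads (sg_of ch) a b j -> cd i = cd j.
  move=> Fi Fj; apply/eqP; rewrite -(nth_uniq (0, 0, 0) _ _ uniq_coords) -?size_gads //.
  by apply/eqP; apply: E.
rewrite /flips Ei Ej /sg_of.
have NZ c : in_coords c -> head_of (gad c) != malt - 2.
  move=> Hc; have /allP/(_ (gad c)) := gads_ok; rewrite map_f ?mem_coords // => /(_ isT).
  by rewrite /gadget_ok /isX => /and3P[/andP[]].
have Hk : forall c c', in_coords c -> in_coords c' -> head_of (gad c) = head_of (gad c') ->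
    c = c' \/ exists p k k', c = (p, k, B) /\ c' = (p, k', B).
  move=> [[p k] l] [[p' k'] l'] Hc Hc'; move: (Hc) (Hc') => /and3P[Hp Hkk Hl] /and3P[Hp' Hkk' Hl'].
  have [HlB|HlB] := ltnP l B.
    have [E _ _] := gad_clause_chain Hp Hkk HlB Hc'.
    have -> : head_of (gad (p, k, l)) = chain p k l by rewrite /gad HlB.
    by move=> E'; left; apply/esym/eqP; rewrite -E -E'.
  have El : l = B by lia.
  have [E _ _] := gad_clause_cell Hp Hc'.
  have -> : head_of (gad (p, k, l)) = cellc p by rewrite /gad ltnNge HlB.
  move=> E'; have [|/= -> ->] := E; first by rewrite -E'.
  by right; exists p, k, k'; rewrite El.
case Si : (ch _ _); case Sj : (ch _ _).
- move=> /andP[/eqP Ha1 _] /andP[/eqP Ha2 _].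
  have [//|[p [k [k' [E E']]]]] := Hk _ _ Ci Cj (etrans (esym Ha1) Ha2).
  by rewrite E E' in Si Sj *; have /= -> := Hch _ _ _ Si Sj.
- by move=> /andP[_ /eqP Hb] /andP[/eqP Hb' _]; have := NZ _ Cj; rewrite -Hb' Hb eqxx.
- by move=> /andP[/eqP Hb' _] /andP[_ /eqP Hb]; have := NZ _ Ci; rewrite -Hb' Hb eqxx.
- move=> /andP[/eqP Hb1 Ba] /andP[/eqP Hb2 Ba'].
  have [//|[p [k [k' [E E']]]]] := Hk _ _ Ci Cj (etrans (esym Hb1) Hb2).
  move: Ba Ba'; rewrite E E' /gad ltnn /body1 /body2 /=.
  have a0 : a != 0 by move: Ha; rewrite /isX; lia.
  rewrite (negbTE a0) !orbF => /eqP -> /eqP; move: Ci Cj; rewrite E E' => /and3P[_ Hk1 _] /and3P[_ Hk2 _].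
  have HB : B.-1 < B by lia.
  by move=> /(chain_inj Hk1 Hk2 HB HB)[->].
Qed.
End Forbidden.


(** * Computations as forbidden configurations *)

Section Tableau.
Variable M : TM.

Definition tile : finType := (Sym * option (tm_state M))%type.
Definition blk : tile := (Blank, None).

Definition snapshot := (tm_state M * (int -> Sym) * int)%type.

(** A halted machine repeats its snapshot, so acceptance can be tested at one fixed time, the
    horizon. *)
Definition advance (s : snapshot) : snapshot :=
  let: (q, f, h) := s in
  if tm_delta q (f h) is Some (q', a, mv) then (q', upd f h a, (h + disp mv)%R) else s.

Definition tile_at (s : snapshot) (z : int) : tile :=
  (s.1.2 z, if z == s.2 then Some s.1.1 else None).

Definition arrives (dir : Move) (t : tile) : option (tm_state M) :=
  if t.2 is Some q then
    match tm_delta q t.1, dir with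
    | Some (q', _, MLeft), MLeft | Some (q', _, MRight), MRight => Some q'
    | _, _ => None
    end
  else None.

Definition next_tile (a b c : tile) : tile :=
  if b.2 is Some q then
    if tm_delta q b.1 is Some (q', s, mv) then (s, if mv is MStay then Some q' else None) else b
  else if arrives MRight a is Some q then (b.1, Some q)
  else if arrives MLeft c is Some q then (b.1, Some q) else b.

Lemma advance_tile s z :
  tile_at (advance s) z = next_tile (tile_at s (z - 1)) (tile_at s z) (tile_at s (z + 1)).
Proof.
case: s => [[q f] h]; rewrite /advance /next_tile /arrives /tile_at /=.
case: (eqVneq z h) => [->|zh] /=.
  case Ed: (tm_delta q (f h)) => [[[q' a] mv]|] /=; last by rewrite eqxx.
  rewrite /upd eqxx; congr (_, _).
  by case: mv {Ed} => /=; case: eqP => //; lia.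
case: (eqVneq (z - 1)%R h) => [E1|n1]; case: (eqVneq (z + 1)%R h) => [E2|n2]; try lia.
- rewrite -E1.
  case Ed: (tm_delta q _) => [[[q' a] mv]|] /=; rewrite ?(negbTE zh) //; last first.
    by case: eqP => //; lia.
  rewrite /upd; have -> : (z == z - 1)%R = false by lia.
  by case: mv {Ed} => /=; case: eqP => //; lia.
- rewrite -E2.
  case Ed: (tm_delta q _) => [[[q' a] mv]|] /=; last first.
    by case: eqP => //; lia.
  rewrite /upd; have -> : (z == z + 1)%R = false by lia.
  by case: mv {Ed} => /=; case: eqP => //; lia.
- case Ed: (tm_delta q (f h)) => [[[q' a] mv]|] /=; rewrite ?(negbTE zh) //.
  rewrite /upd (negbTE zh); congr (_, _).
  by case: mv {Ed} => /=; case: eqP => //; lia.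
Qed.

Definition snap (w : seq Sym) (t : nat) : snapshot :=
  iter t advance (tm_start M, word_tape w, 0%R).

Lemma snap_bounds w t : [/\ (- t%:Z <= (snap w t).2)%R, ((snap w t).2 <= t%:Z)%R &
  forall z, ((z < - t%:Z) || ((size w + t)%:Z <= z))%R -> (snap w t).1.2 z = Blank].
Proof.
elim: t => [|t]; first by split=> // -[z|z] //= H; rewrite nth_default //; lia.
rewrite /snap /= -/(snap w t); case: (snap w t) => [[q f] h] /= [H1 H2 H3].
case Ed: (tm_delta q (f h)) => [[[q' a] mv]|] /=.
  split; [by case: mv {Ed} => /=; lia|by case: mv {Ed} => /=; lia|].
  by move=> z Hz; rewrite /upd; case: eqP => [E|_]; [lia|apply: H3; lia].
by split=> [||z Hz]; [lia|lia|apply: H3; lia].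
Qed.

Lemma snap_blank w t z : ((z < - t%:Z) || ((size w + t)%:Z < z))%R -> tile_at (snap w t) z = blk.
Proof.
move=> Hz; have [H1 H2 H3] := snap_bounds w t; rewrite /tile_at H3; last by lia.
by case: eqP => //; lia.
Qed.

Lemma run_snap w k c : run M k (init M w) = Some c ->
  let: (q, f, h) := snap w k in conf c q f h.
Proof.
have run_step n (c0 : config M) : run M n.+1 c0 = obind (@step M) (run M n c0).
  elim: n c0 => [|n IH] c0; first by rewrite /=; case: step.
  by rewrite -[LHS]/(if step c0 is Some c' then run M n.+1 c' else None) [in RHS]/=; case: (step c0).
elim: k c => [|k IH] c; first by case=> <-; apply: init_conf.
rewrite run_step; case E : (run M k _) => [c1|] //= Hs.
move: (IH _ E); rewrite /snap /= -/(snap w k); case: (snap w k) => [[q f] h] /= Hc.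
case Ed: (tm_delta q (f h)) => [[[q' a] mv]|] /=.
  by have [c2] := step_conf Hc Ed; rewrite Hs => -[->].
by move: Hs; rewrite /step (conf_cur Hc); case: Hc => -> _; rewrite Ed.
Qed.

Lemma halted_snap w k c t : run M k (init M w) = Some c -> halted c -> k <= t -> snap w t = snap w k.
Proof.
move=> /run_snap; case E : (snap w k) => [[q f] h] Hc Hh kt.
rewrite -(subnK kt); elim: (t - k) => [|n IH]; first by rewrite add0n.
rewrite addSn /snap /= -/(snap w _) IH /=.
by move: Hh; rewrite /halted (conf_cur Hc); case: Hc => -> _ ->.
Qed.

Definition is_bit (s : Sym) := (s == S0) || (s == S1).
(** The output being exactly the bit true is a condition on two adjacent cells. *)
Definition accepting (s : snapshot) := (s.1.2 s.2 == S1) && ~~ is_bit (s.1.2 (s.2 + 1)%R).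

Lemma read_bits_nil s : (read_bits s == [::]) = ~~ is_bit (nth Blank s 0).
Proof. by case: s => [|[]]. Qed.

Lemma accepts_snap w T : halts_within M w T -> accepts M w <-> accepting (snap w T).
Proof.
have out c k : run M k (init M w) = Some c -> halted c -> (output c == [:: true]) = accepting (snap w k).
  move=> /run_snap; case: (snap w k) => [[q f] h] Hc _.
  rewrite /accepting /= -(conf_cur Hc) -(conf_right Hc) /output /= -read_bits_nil.
  by case: (cf_cur c).
move=> [k [c [kT [Hr Hh]]]]; split.
  move=> [k' [c' [Hr' [Hh' Ho]]]].
  rewrite (halted_snap Hr Hh kT) -(halted_snap Hr Hh (leq_maxl k k')) (halted_snap Hr' Hh' (leq_maxr k k')).
  by rewrite -(out c') // Ho.
by rewrite (halted_snap Hr Hh kT) -(out c) // => /eqP Ho; exists k, c.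
Qed.

(* The rows of the tableau, of width [W], are laid end to end: [cells p] is the tile of time
   [p %/ W] at tape position [p %% W - off]. Cell [p + W + 1] is then determined by the cells
   [p], [p + 1], [p + 2], including at the ends of the rows, which are blank. *)
Section Rows.
Variables (w : seq Sym) (T W off : nat).
Hypotheses (Hoff : off = T + 2) (HW : off + size w + T + 3 <= W).
Let R := T.+1 * W + 1.

Definition cells (p : nat) : tile := tile_at (snap w (p %/ W)) ((p %% W)%N%:Z - off%:Z)%R.

Lemma cells_row t i : i < W -> cells (t * W + i) = tile_at (snap w t) (i%:Z - off%:Z)%R.
Proof.
move=> Hi; have W0 : 0 < W by lia.
by rewrite /cells divnMDl // divn_small // addn0 modnMDl modn_small.
Qed.

Lemma cells_init p : p <= W -> cells p = tile_at (snap w 0) (p%:Z - off%:Z)%R.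
Proof.
rewrite leq_eqVlt => /orP[/eqP ->|Hp]; last by rewrite -{1}[p]add0n -[in LHS](mul0n W) cells_row.
rewrite -{1}[W]mul1n -[1 * W]addn0 cells_row; last by lia.
by rewrite !snap_blank //; lia.
Qed.

Lemma cells_next p : p + W + 1 < R -> cells (p + W + 1) = next_tile (cells p) (cells p.+1) (cells p.+2).
Proof.
have W0 : 0 < W by lia.
rewrite (divn_eq p W); move: (p %/ W) (p %% W) (ltn_pmod p W0) => t i Hi HR.
have [H|H] := ltnP i.+1 W.
  have -> : t * W + i + W + 1 = t.+1 * W + i.+1 by lia.
  have -> : (t * W + i).+1 = t * W + i.+1 by lia.
  have -> : (t * W + i.+1).+1 = t * W + i.+2 by lia.
  rewrite (cells_row t.+1 H) (cells_row t Hi) (cells_row t H) {1}/snap /= -/(snap w t) advance_tile.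
  have -> : (i.+1%:Z - off%:Z - 1 = i%:Z - off%:Z)%R by lia.
  have [H'|H'] := ltnP i.+2 W.
    rewrite cells_row //; congr next_tile; congr tile_at; lia.
  have -> : t * W + i.+2 = t.+1 * W + 0 by lia.
  have Ht : t < T by rewrite -(ltn_pmul2r W0); move: HR; rewrite /R; lia.
  rewrite cells_row // !(snap_blank (w := w) (t := t.+1)); last by lia.
  by rewrite [tile_at _ (_ + 1)%R]snap_blank //; lia.
(* The three cells straddle the end of a row; they and the resulting cell lie in margins that
   neither the head nor the word has reached. *)
have -> : t * W + i + W + 1 = t.+2 * W + 0 by lia.
have -> : (t * W + i).+1 = t.+1 * W + 0 by lia.
have -> : (t.+1 * W + 0).+1 = t.+1 * W + 1 by lia.
have Ht : t < T by rewrite -(leq_pmul2r W0); move: HR; rewrite /R; lia.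
by rewrite !cells_row //; [rewrite !snap_blank //; lia|lia].
Qed.
End Rows.

Section Encoding.
Variables (d : nat) (x : seq bool).
Let N := size x.
Definition guess_len n := Defs.poly d n.
Definition horizon n := Defs.poly d (n + guess_len n).
Definition origin n := horizon n + 2.
Definition width n := origin n + (n + 1 + guess_len n) + horizon n + 3.
(** Smaller cell numbers form the tableau; the cell with this number is the additional one whose
    clause is [top]. The final 1 gives [W < R] even for horizon 0. *)
Definition ncells n := (horizon n).+1 * width n + 1.
Let Y := guess_len N.
Let T := horizon N.
Let off := origin N.
Let W := width N.
Let R := ncells N.

(* The first component selects: window, initial row, shape of the guess, acceptance. *)
Definition kind : finType := ((bool * bool) * (tile * tile * tile * tile))%type.
Definition kinds := enum kind.
Definition tiles := enum tile.
Definition tl k := nth blk tiles k.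
Definition kd j := nth ((false, false), (blk, blk, blk, blk)) kinds j.

Definition allowed p (t : tile) : bool :=
  (t.2 == if p == off then Some (tm_start M) else None) &&
  (if p < off then t.1 == Blank
   else if p < off + N then t.1 == sym_of_bit (nth false x (p - off))
   else if p == off + N then t.1 == Sep
   else if p <= off + N + Y then t.1 != Sep
   else t.1 == Blank).

(** Windows determine the cells from [W + 1] on, so the initial constraints run up to [p = W], the
    blank that opens the second row. Forbidding a bit after a blank makes the guess a block of bits
    followed by blanks. *)
Definition enabled p (c : kind) : bool :=
  match c with
  | ((false, false), (k1, k2, k3, k4)) => (p + W + 1 < R) && (next_tile k1 k2 k3 != k4)
  | ((false, true), (k1, _, _, _)) => (p <= W) && ~~ allowed p k1
  | ((true, false), (k1, k2, _, _)) => [&& off + N < p, p < W, k1.1 == Blank & is_bit k2.1]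
  | ((true, true), (k1, k2, _, _)) =>
      [&& T * W <= p, p + 1 < R, k1.2 != None & (k1.1 != S1) || is_bit k2.1]
  end.

(** An acceptance conflict exists for each tile [k3] of cell [R]: any tile there enforces
    acceptance, and none there makes these conflicts harmless. *)
Definition lits p (c : kind) : seq (nat * tile) :=
  match c with
  | ((false, false), (k1, k2, k3, k4)) => [:: (p, k1); (p + 1, k2); (p + 2, k3); (p + W + 1, k4)]
  | ((false, true), (k1, _, _, _)) => [:: (p, k1)]
  | ((true, false), (k1, k2, _, _)) => [:: (p, k1); (p + 1, k2)]
  | ((true, true), (k1, k2, k3, _)) => [:: (p, k1); (p + 1, k2); (R, k3)]
  end.

(* A disabled constraint forbids choosing everything, which is harmless. *)
Definition conflict p (c : kind) q (t : tile) : bool := ~~ enabled p c || ((q, t) \in lits p c).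
Definition fmem q k j := conflict (j %/ size kinds) (kd (j %% size kinds)) q (tl k).

Let K := size tiles.
Let B := R * size kinds.

Lemma tiles_gt1 : 2 <= K.
Proof.
by apply: (@uniq_leq_size _ [:: blk; (S0, None)] tiles) => // t _; rewrite mem_enum.
Qed.

Lemma kinds_gt0 : 0 < size kinds.
Proof. by rewrite /kinds -cardE; apply/card_gt0P; exists ((false, false), (blk, blk, blk, blk)). Qed.

Lemma origin_horizon : off = T + 2. Proof. by []. Qed.

Lemma W_lt_R : W < R. Proof. by rewrite /R /ncells -/W; lia. Qed.

Lemma off_width (w : seq Sym) : size w <= N + 1 + Y -> off + size w + T + 3 <= W.
Proof. rewrite /W /width -/off -/Y -/T; lia. Qed.

Lemma tl_index t : tl (index t tiles) = t.
Proof. by rewrite /tl nth_index // mem_enum. Qed.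

Lemma index_tl t : index t tiles < K.
Proof. by rewrite /K index_mem mem_enum. Qed.

Lemma pair_enc_nth y p : nth Blank (pair_enc x y) p =
  if p < N then sym_of_bit (nth false x p) else if p == N then Sep else nth Blank (enc y) (p - N.+1).
Proof.
rewrite /pair_enc nth_cat size_map -/N; case: ltnP => H; first by rewrite (nth_map false).
case: eqP => [->|ne]; first by rewrite subnn.
by have -> : p - N = (p - N.+1).+1 by lia.
Qed.

Lemma size_pair_enc y : size (pair_enc x y) = N + 1 + size y.
Proof. by rewrite /pair_enc size_cat /= !size_map; lia. Qed.

Definition row0 y p : tile := tile_at (snap (pair_enc x y) 0) (p%:Z - off%:Z)%R.

Lemma row0E y p : row0 y p =
  (if p < off then Blank else nth Blank (pair_enc x y) (p - off),
   if p == off then Some (tm_start M) else None).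
Proof.
rewrite /row0 /tile_at /=; congr (_, _); last first.
  by case: (eqVneq p off) => [->|ne]; [rewrite subrr eqxx|case: eqP => //; move: ne; lia].
case: ltnP => H; first by case E : (p%:Z - off%:Z)%R => [j|j] //=; lia.
by have -> : (p%:Z - off%:Z)%R = Posz (p - off) by lia.
Qed.

Lemma allowed_row0 y p : size y <= Y -> allowed p (row0 y p).
Proof.
move=> Hy; rewrite row0E /allowed /= eqxx pair_enc_nth /=.
case: (ltnP p off) => H //; case: (ltnP p (off + N)) => H1.
  by have -> : p - off < N by lia.
have -> : (p - off < N) = false by lia.
case: (eqVneq p (off + N)) => [->|ne]; first by rewrite addKn eqxx.
have -> : (p - off == N) = false by lia.
case: (leqP p (off + N + Y)) => H2; last by rewrite nth_default // size_map; lia.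
have [H3|H3] := ltnP (p - off - N.+1) (size y); last by rewrite nth_default ?size_map.
by rewrite (nth_map false) //; case: (nth _ _ _).
Qed.

Lemma enc_shape y i : nth Blank (enc y) i = Blank -> ~~ is_bit (nth Blank (enc y) i.+1).
Proof.
have [H|H] := ltnP i (size y).
  by rewrite (nth_map false) //; case: (nth false y i).
by move=> _; rewrite nth_default // size_map ltnW.
Qed.

Lemma accepting_tiles y p : size y <= Y -> accepting (snap (pair_enc x y) T) -> T * W <= p -> p + 1 < R ->
  (cells (pair_enc x y) W off p).2 != None ->
  ((cells (pair_enc x y) W off p).1 == S1) && ~~ is_bit (cells (pair_enc x y) W off p.+1).1.
Proof.
move=> Hy Ha Hp HR.
have [i Ei Hi] : exists2 i, p = T * W + i & i < W.
  by exists (p - T * W); [lia|move: HR; rewrite /R /ncells -/W -/T; lia].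
have HW : off + size (pair_enc x y) + T + 3 <= W by apply: off_width; rewrite size_pair_enc; lia.
have [h1 h2 _] := snap_bounds (pair_enc x y) T.
rewrite Ei (cells_row origin_horizon HW) //; rewrite /tile_at [(_, _).2]/=.
case: (eqVneq (i%:Z - off%:Z)%R (snap (pair_enc x y) T).2) => [Eh _|//].
have Hi' : i.+1 < W by rewrite size_pair_enc in HW; lia.
rewrite -addnS (cells_row origin_horizon HW) //= /tile_at /= Eh.
by rewrite -addn1 PoszD addrAC Eh.
Qed.

(** [b] tells whether cell [R] receives a tile. With [b] false any computation qualifies, which
    yields the fallback. *)
Theorem tableau_complete y (b : bool) : size y <= Y -> (b -> accepting (snap (pair_enc x y) T)) ->
  exists ch : nat -> nat -> bool,
    (forall p k k', ch p k -> ch p k' -> k = k') /\ forbidden_sat R K B fmem (R + b) ch.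
Proof.
move=> Hy Hb; set w := pair_enc x y.
have HW : off + size w + T + 3 <= W by apply: off_width; rewrite size_pair_enc; lia.
pose r p := cells w W off p.
pose ch p k := if p < R then k == index (r p) tiles else (k == 0) && b.
have chR p t : p < R -> ch p (index t tiles) = (t == r p).
  move=> Hp; rewrite /ch Hp; apply/eqP/eqP => [E|-> //].
  by rewrite -(tl_index t) E tl_index.
exists ch; split; [|split].
- by move=> p k k'; rewrite /ch; case: ifP => _; [move=> /eqP -> /eqP ->|move=> /andP[/eqP -> _] /andP[/eqP -> _]].
- move=> p Hp; case: (ltnP p R) => H.
    by exists (index (r p) tiles); [apply: index_tl|rewrite chR // eqxx].
  exists 0; first exact: ltnW tiles_gt1.
  by rewrite /ch ltnNge H eqxx; case: b Hp {Hb chR} @ch => //; lia.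
move=> j Hj; set p := j %/ size kinds; set c := kd (j %% size kinds).
case En : (enabled p c); last first.
  (* A disabled conflict contains all tiles of cell 0; as there are at least two, one of them is not
     chosen. *)
  exists 0, (if index (r 0) tiles == 0 then 1 else 0); have := tiles_gt1; rewrite /fmem /conflict En.
  by rewrite /ch (leq_ltn_trans (leq0n W) W_lt_R); case: (index (r 0) tiles) => [|i] HK; split=> //=; lia.
suff [q [t [Hq Ht Hc]]] : exists q t, [/\ q <= R, (q, t) \in lits p c & ~~ ch q (index t tiles)].
  by exists q, (index t tiles); rewrite index_tl /fmem /conflict tl_index Ht orbT.
have Hlit q t : q < R -> (q, t) \in lits p c -> t != r q ->
    exists q t, [/\ q <= R, (q, t) \in lits p c & ~~ ch q (index t tiles)].
  by move=> Hq Ht Hn; exists q, t; rewrite chR // ltnW.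
case Ec : c (En) => [[[|] [|]] [[[k1 k2] k3] k4]] En1; rewrite -Ec; move: En1; rewrite /enabled.
- case/and4P => Hp HpR Hk1 Hk2.
  have [E1|n1] := eqVneq k1 (r p); last by apply: (Hlit p k1) => //; [lia|rewrite Ec inE eqxx].
  have [E2|n2] := eqVneq k2 (r (p + 1)); last by apply: (Hlit (p + 1) k2) => //; rewrite Ec !inE eqxx orbT.
  exists R, k3; rewrite leqnn Ec !inE eqxx !orbT; split=> //.
  rewrite /ch ltnn; case: b Hb {Hlit chR ch} => [|_]; last by rewrite andbF.
  move=> /(_ isT) Ha; have := accepting_tiles Hy Ha Hp HpR.
  rewrite -/w -/(r p) -addn1 -/(r (p + 1)) -E1 -E2 => /(_ Hk1) /andP[A1 A2].
  by move: Hk2; rewrite A1 (negbTE A2).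
- case/and4P => Hp HpW Hk1 Hk2; have HR := W_lt_R.
  have [E1|n1] := eqVneq k1 (r p); last by apply: (Hlit p k1) => //; [lia|rewrite Ec inE eqxx].
  apply: (Hlit (p + 1) k2); [lia|by rewrite Ec !inE eqxx orbT|].
  apply: contraTneq Hk2 => ->; move: Hk1; rewrite E1 /r (cells_init origin_horizon HW) 1?ltnW // -/(row0 y p).
  rewrite (cells_init origin_horizon HW); last by lia.
  rewrite -/(row0 y (p + 1)) !row0E /= !pair_enc_nth.
  have -> : (p < off) = false by lia.
  have -> : (p + 1 < off) = false by lia.
  have -> : (p - off < N) = false by lia.
  have -> : (p + 1 - off < N) = false by lia.
  have -> : (p - off == N) = false by lia.
  have -> : (p + 1 - off == N) = false by lia.
  have -> : p + 1 - off - N.+1 = (p - off - N.+1).+1 by lia.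
  by move=> /eqP/enc_shape.
- case/andP => HpW; have HR := W_lt_R => Hna.
  apply: (Hlit p k1); [lia|by rewrite Ec inE eqxx|].
  apply: contraNneq Hna => ->; rewrite /r (cells_init origin_horizon HW) //; exact: allowed_row0.
- case/andP => HpR Hne.
  have [E1|n1] := eqVneq k1 (r p); last by apply: (Hlit p k1) => //; [lia|rewrite Ec inE eqxx].
  have [E2|n2] := eqVneq k2 (r (p + 1)); last by apply: (Hlit (p + 1) k2) => //; [lia|rewrite Ec !inE eqxx orbT].
  have HW1 : 1 < W by lia.
  have [E3|n3] := eqVneq k3 (r (p + 2)); last by apply: (Hlit (p + 2) k3) => //; [lia|rewrite Ec !inE eqxx !orbT].
  apply: (Hlit (p + W + 1) k4) => //; first by rewrite Ec !inE eqxx !orbT.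
  apply: contraNneq Hne => ->; apply/eqP; rewrite E1 E2 E3 /r addn1 addn2; apply/esym.
  by apply: (cells_next origin_horizon HW) => //.
Qed.

Lemma read_bits_enc s : (forall a, a \in s -> a != Sep) ->
  (forall i, i.+1 < size s -> nth Blank s i = Blank -> ~~ is_bit (nth Blank s i.+1)) ->
  forall i, nth Blank (enc (read_bits s)) i = nth Blank s i.
Proof.
elim: s => [|a s IH] Hsep Hshape i; first by rewrite nth_nil.
have {}IH : forall i, nth Blank (enc (read_bits s)) i = nth Blank s i.
  apply: IH => [b Hb|j Hj]; first by apply: Hsep; rewrite inE Hb orbT.
  exact: (Hshape j.+1).
have := Hsep a (mem_head _ _); case: a Hsep Hshape => // Hsep Hshape _; try by case: i => /=.
have Hb : forall j, nth Blank s j = Blank.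
  elim=> [|j Ej].
    have [H|H] := ltnP 0 (size s); last by rewrite nth_default.
    have := Hshape 0 H (erefl _); have := Hsep (nth Blank s 0).
    by rewrite inE mem_nth // orbT /= => /(_ isT); case: (nth _ _ _).
  have [H|H] := ltnP j.+1 (size s); last by rewrite nth_default.
  have := Hshape j.+1 H Ej; have := Hsep (nth Blank s j.+1).
  by rewrite inE mem_nth // orbT /= => /(_ isT); case: (nth _ _ _).
by case: i => [|i] //=; rewrite nth_nil Hb.
Qed.

Lemma size_read_bits s : size (read_bits s) <= size s.
Proof. by elim: s => [|[] s IH]. Qed.

Theorem tableau_sound ch : forbidden_sat R K B fmem R.+1 ch ->
  exists y, size y <= Y /\ accepting (snap (pair_enc x y) T).
Proof.
(* A cell may hold several tiles. Keeping only the first is safe, since dropping choices creates no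
   conflict. *)
move=> [Hc Hf]; pose kk p := find (ch p) (iota 0 K); pose r p := tl (kk p).
have Hkk p : p <= R -> kk p < K /\ ch p (kk p).
  move=> Hp; have Hh : has (ch p) (iota 0 K).
    by have [k Hk Hck] := Hc p Hp; apply/hasP; exists k => //; rewrite mem_iota.
  have Hlt : kk p < K by rewrite -[X in _ < X](size_iota 0) -has_find.
  by split=> //; have := nth_find 0 Hh; rewrite nth_iota.
have conf p c : p < R -> enabled p c -> exists q t, [/\ q <= R, (q, t) \in lits p c & t != r q].
  move=> Hp En; have Hi : index c kinds < size kinds by rewrite index_mem mem_enum.
  have [|q [k [Hq Hk Hm Hn]]] := Hf (p * size kinds + index c kinds).
    by apply: (@leq_trans (p.+1 * size kinds)); [rewrite mulSn; lia|rewrite leq_mul2r Hp orbT].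
  have HL := kinds_gt0.
  move: Hm; rewrite /fmem divnMDl // divn_small // addn0 modnMDl modn_small // /kd nth_index ?mem_enum //.
  rewrite /conflict En /= => Hl; exists q, (tl k); split=> //.
  apply: contraNneq Hn => /eqP; rewrite /r /tl (nth_uniq _ _ _ (enum_uniq _)) //; last by case: (Hkk q Hq).
  by move=> /eqP ->; case: (Hkk q Hq).
have HWR := W_lt_R; have HL := off_width.
have A1 p : p <= W -> allowed p (r p).
  move=> Hp; apply/negPn/negP => Hn.
  have [||q [t [_ + +]]] := conf p ((false, true), (r p, blk, blk, blk)).
  - exact: leq_ltn_trans HWR.
  - by rewrite /enabled Hp.
  - by rewrite inE => /eqP[-> ->]; rewrite eqxx.
have A2 p : p + W + 1 < R -> next_tile (r p) (r p.+1) (r p.+2) = r (p + W + 1).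
  move=> Hp; apply/eqP/negPn/negP => Hn.
  have [||q [t [_ + +]]] := conf p ((false, false), (r p, r p.+1, r p.+2, r (p + W + 1))).
  - lia.
  - by rewrite /enabled Hp.
  - by rewrite !inE => /or4P[] /eqP[-> ->]; rewrite ?addn1 ?addn2 eqxx.
have A3 p : off + N < p < W -> (r p).1 = Blank -> ~~ is_bit (r p.+1).1.
  move=> Hp Hb; apply/negP => Hn.
  have [||q [t [_ + +]]] := conf p ((true, false), (r p, r p.+1, blk, blk)).
  - lia.
  - by rewrite /enabled Hb Hn; case/andP: Hp => -> ->.
  - by rewrite !inE => /orP[] /eqP[-> ->]; rewrite ?addn1 eqxx.
have A4 p : T * W <= p -> p + 1 < R -> (r p).2 != None -> ((r p).1 == S1) && ~~ is_bit (r p.+1).1.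
  move=> Hp HpR Hs; apply/negPn/negP => Hn.
  have [||q [t [_ + +]]] := conf p ((true, true), (r p, r p.+1, r R, blk)).
  - lia.
  - by rewrite /enabled Hp HpR Hs /=; move: Hn; rewrite negb_and negbK.
  - by rewrite !inE => /or3P[] /eqP[-> ->]; rewrite ?addn1 eqxx.
(* The certificate is what row 0 shows after the separator, up to its first non-bit; [A1] and [A3]
   force blanks from there on. *)
pose b i := (r (off + N + 1 + i)).1; pose s := mkseq b Y; pose y := read_bits s.
have Hy : size y <= Y by apply: leq_trans (size_read_bits _) _; rewrite size_mkseq.
have HW : off + size (pair_enc x y) + T + 3 <= W by apply: off_width; rewrite size_pair_enc; lia.
have HY : off + N + Y + 1 < W by rewrite /W /width -/off -/Y -/T; lia.
have yE i : i < Y -> nth Blank (enc y) i = b i.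
  move=> Hi; rewrite read_bits_enc ?nth_mkseq //.
    move=> a /mapP[j + ->]; rewrite mem_iota => Hj; have := A1 (off + N + 1 + j).
    rewrite /allowed -/(b j); have -> : off + N + 1 + j <= W by lia.
    have -> : (off + N + 1 + j < off) = false by lia.
    have -> : (off + N + 1 + j < off + N) = false by lia.
    have -> : (off + N + 1 + j == off + N) = false by lia.
    have -> : off + N + 1 + j <= off + N + Y by lia.
    by move=> /(_ isT)/andP[].
  rewrite size_mkseq => j Hj; rewrite !nth_mkseq //; last by lia.
  by rewrite /b (addnS _ j); apply: A3; lia.
have rE0 p : p <= W -> r p = row0 y p.
  move=> Hp; have := A1 p Hp; rewrite row0E /allowed pair_enc_nth.
  case Er : (r p) => [a o] /= /andP[/eqP -> Ha]; congr (_, _); move: Ha.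
  case: (ltnP p off) => H1; first by move/eqP.
  case: (ltnP p (off + N)) => H2.
    by rewrite ltn_subLR // H2 => /eqP.
  have -> : (p - off < N) = false by lia.
  case: (eqVneq p (off + N)) => [->|ne]; first by rewrite addKn eqxx => /eqP.
  have -> : (p - off == N) = false by lia.
  case: (leqP p (off + N + Y)) => H3 Ha.
    rewrite yE; last by lia.
    have Ep : off + N + 1 + (p - off - N.+1) = p by lia.
    by rewrite /b Ep Er.
  by rewrite (eqP Ha) nth_default // size_map; lia.
have rE p : p < R -> r p = cells (pair_enc x y) W off p.
  elim/ltn_ind: p => p IH Hp; have [H|H] := leqP p W.
    by rewrite rE0 // (cells_init origin_horizon HW).
  have [p0 Ep] : exists p0, p = p0 + W + 1 by exists (p - W - 1); lia.
  rewrite Ep in Hp IH *; rewrite -A2 // (cells_next origin_horizon HW) //.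
  by rewrite !IH //; lia.
exists y; split=> //.
have [h1 h2 _] := snap_bounds (pair_enc x y) T.
set h := (snap (pair_enc x y) T).2 in h1 h2 *.
have [i Ei] : exists i : nat, (i%:Z - off%:Z = h)%R.
  by exists `|(h + off%:Z)%R|%N; move: h1; rewrite origin_horizon; lia.
have Hi : i.+1 < W by move: h2 HW; lia.
have HR : T * W + i + 1 < R by rewrite /R /ncells -/W -/T; lia.
have := A4 (T * W + i) (leq_addr _ _) HR; rewrite !rE; [|lia..].
rewrite -addnS !(cells_row origin_horizon HW) //; last by lia.
have -> : (i.+1%:Z - off%:Z = h + 1)%R by lia.
by rewrite Ei /tile_at /= -/h eqxx => /(_ isT).
Qed.
End Encoding.
End Tableau.


(** * Writing the instance *)

Inductive bexpr :=
| BC of bool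
| BLe of expr & expr
| BLt of expr & expr
| BEq of expr & expr
| BBit of expr
| BNot of bexpr
| BAnd of bexpr & bexpr
| BOr of bexpr & bexpr
| BIf of bexpr & bexpr & bexpr.

Fixpoint beval x rho (b : bexpr) : bool :=
  match b with
  | BC b => b
  | BLe e1 e2 => eval x rho e1 <= eval x rho e2
  | BLt e1 e2 => eval x rho e1 < eval x rho e2
  | BEq e1 e2 => eval x rho e1 == eval x rho e2
  | BBit e => nth false x (eval x rho e)
  | BNot b => ~~ beval x rho b
  | BAnd b c => beval x rho b && beval x rho c
  | BOr b c => beval x rho b || beval x rho c
  | BIf a b c => if beval x rho a then beval x rho b else beval x rho c
  end.

Definition ENot e := ESub (EC 1) e.

Fixpoint bcomp (b : bexpr) : expr :=
  match b with
  | BC b => EC b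
  | BLe e1 e2 => ENot (ESub e1 e2)
  | BLt e1 e2 => ENot (ESub (EAdd e1 (EC 1)) e2)
  | BEq e1 e2 => EMul (ENot (ESub e1 e2)) (ENot (ESub e2 e1))
  | BBit e => EBit e
  | BNot b => ENot (bcomp b)
  | BAnd b c => EMul (bcomp b) (bcomp c)
  | BOr b c => ENot (EMul (ENot (bcomp b)) (ENot (bcomp c)))
  | BIf a b c => EAdd (EMul (bcomp a) (bcomp b)) (EMul (ENot (bcomp a)) (bcomp c))
  end.

Lemma bcompE x rho b : eval x rho (bcomp b) = beval x rho b.
Proof.
elim: b => //= [e1 e2|e1 e2|e1 e2|b ->|b -> c ->|b -> c ->|a -> b -> c ->].
- by case: leqP; lia.
- by case: ltnP; lia.
- by case: ltngtP; nia.
- by case: beval.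
- by case: beval; case: beval.
- by case: beval; case: beval.
- by case: beval; case: beval; case: beval.
Qed.

Fixpoint blead (l : seq expr) (a b : expr) : bexpr :=
  if l is s :: l' then BIf (BEq a s) (BNot (BEq b s)) (BIf (BEq b s) (BC false) (blead l' a b))
  else BLt a b.

Lemma blead_eval x rho l a b :
  beval x rho (blead l a b) = lead (map (eval x rho) l) (eval x rho a) (eval x rho b).
Proof.
by elim: l => //= s l ->.
Qed.

Fixpoint gcat (l : seq gen) : gen := if l is g :: l' then GSeq g (gcat l') else GNil.

Lemma gcat_den x rho l : gden x rho (gcat l) = flatten (map (gden x rho) l).
Proof. by elim: l => //= g l ->. Qed.

Fixpoint epow e n := if n is n'.+1 then EMul e (epow e n') else EC 1.
Definition epoly d e := EAdd (EMul (EC d) (epow e d)) (EC d).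
Lemma epoly_eval x rho d e : eval x rho (epoly d e) = Defs.poly d (eval x rho e).
Proof.
have H n : eval x rho (epow e n) = eval x rho e ^ n by elim: n => //= n ->; rewrite expnS.
by rewrite /Defs.poly /= H.
Qed.

Definition gunary e := GFor 2 e (GOut (EC 1)).
Lemma flatten_nseq1 T (b : T) (I : Type) (s : seq I) : flatten [seq [:: b] | _ <- s] = nseq (size s) b.
Proof. by elim: s => //= _ s ->. Qed.
Lemma gunary_den x rho e : gden x rho (gunary e) = nseq (eval x rho e) true.
Proof. by rewrite /= flatten_nseq1 size_iota. Qed.

Definition matrix_of m (r : nat -> nat -> bool) : seq bool :=
  flatten [seq [seq r a b | b <- iota 0 m] | a <- iota 0 m].

Definition gmat em (r : expr -> expr -> bexpr) : gen :=
  GFor 2 em (GFor 3 em (GOut (bcomp (r (EV 2) (EV 3))))).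

Lemma gmat_den x rho em m r f : (forall rho, eval x rho em = m) ->
  (forall a b, beval x (upd (upd rho 2 a) 3 b) (r (EV 2) (EV 3)) = f a b) ->
  gden x rho (gmat em r) = matrix_of m f.
Proof.
move=> Hm Hr; rewrite /gmat /matrix_of /= Hm; congr flatten; apply: eq_map => a.
rewrite Hm -[RHS]flatten_seq1 -map_comp; congr flatten; apply: eq_map => b /=.
by rewrite bcompE Hr; case: (f a b).
Qed.

Lemma size_flatten_const (T : Type) (ss : seq (seq T)) L :
  (forall s, s \in [seq size t | t <- ss] -> s = L) -> size (flatten ss) = size ss * L.
Proof.
elim: ss => //= s ss IH H; rewrite size_cat mulSn IH; last by move=> n Hn; apply: H; rewrite inE Hn orbT.
by rewrite (H (size s)) // mem_head.
Qed.

Lemma nth_flatten_const (T : Type) (x0 : T) (ss : seq (seq T)) L i j :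
  (forall s, s \in [seq size t | t <- ss] -> s = L) -> j < L ->
  nth x0 (flatten ss) (i * L + j) = nth x0 (nth [::] ss i) j.
Proof.
elim: ss i => [|s ss IH] i H Hj /=; first by rewrite !nth_nil.
have Hs : size s = L by apply: H; rewrite mem_head.
rewrite nth_cat Hs; case: i => [|i] /=; first by rewrite mul0n add0n Hj.
rewrite mulSn -addnA ltnNge leq_addr /= addKn; apply: IH => // n Hn.
by apply: H; rewrite inE Hn orbT.
Qed.

Lemma size_matrix_of m r : size (matrix_of m r) = m * m.
Proof.
rewrite /matrix_of (@size_flatten_const _ _ m) ?size_map ?size_iota // => s.
by rewrite -map_comp => /mapP[a _ ->]; rewrite /= size_map size_iota.
Qed.

Lemma nth_matrix_of m r a b : a < m -> b < m -> nth false (matrix_of m r) (a * m + b) = r a b.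
Proof.
move=> Ha Hb; rewrite /matrix_of (@nth_flatten_const _ _ _ m) //; last first.
  by move=> s; rewrite -map_comp => /mapP[a' _ ->]; rewrite /= size_map size_iota.
by rewrite (nth_map 0) ?size_iota // (nth_map 0) ?size_iota // !nth_iota.
Qed.

Definition encode m n (rs : seq (nat -> nat -> bool)) : seq bool :=
  nseq m true ++ false :: nseq n true ++ false :: flatten (map (matrix_of m) rs).

Lemma dec_unary_nseq m s : dec_unary (nseq m true ++ false :: s) = Some (m, s).
Proof. by elim: m => //= m ->. Qed.

Lemma nth_matrices m rs i a b : i < size rs -> a < m -> b < m ->
  nth false (flatten (map (matrix_of m) rs)) (i * (m * m) + (a * m + b)) =
  nth (fun _ _ => false) rs i a b.
Proof.
move=> Hi Ha Hb; rewrite (@nth_flatten_const _ _ _ (m * m)); last by nia.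
  by rewrite (nth_map (fun _ _ => false)) // nth_matrix_of.
by move=> s; rewrite -map_comp => /mapP[r _ ->]; apply: size_matrix_of.
Qed.

Lemma decode_encode m n rs : size rs = n.+1 ->
  decode (encode m n rs) = Some (@Inst m n
    (fun i a b => nth (fun _ _ => false) rs i a b) (fun a b => nth (fun _ _ => false) rs n a b)).
Proof.
move=> Hs; rewrite /decode /encode !dec_unary_nseq.
rewrite (@size_flatten_const _ _ (m * m)); last first.
  by move=> s; rewrite -map_comp => /mapP[r _ ->]; apply: size_matrix_of.
rewrite size_map Hs eqxx; congr Some; congr Inst.
  apply: functional_extensionality => i; apply: functional_extensionality => a.
  by apply: functional_extensionality => b; rewrite nth_matrices // Hs ltnW // ltnS.
apply: functional_extensionality => a.
by apply: functional_extensionality => b; rewrite nth_matrices // Hs.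
Qed.

Lemma flatten_map_pairs (A B C : Type) (F : A * B -> seq C) (s : seq A) (t : seq B) :
  flatten [seq F c | c <- [seq (a, b) | a <- s, b <- t]] =
  flatten [seq flatten [seq F (a, b) | b <- t] | a <- s].
Proof. by elim: s => //= a s IH; rewrite map_cat flatten_cat IH -map_comp. Qed.

Lemma flatten_map_radix (C : Type) (F : nat -> seq C) n b :
  flatten [seq F j | j <- iota 0 (n * b)] =
  flatten [seq flatten [seq F (a * b + c) | c <- iota 0 b] | a <- iota 0 n].
Proof.
elim: n => [|n IH]; first by rewrite mul0n.
rewrite mulSnr iotaD map_cat flatten_cat IH -[in iota 0 n.+1]addn1 iotaD map_cat flatten_cat /= cats0.
by rewrite !add0n -[in iota (n * b) b](addn0 (n * b)) iotaDl -map_comp.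
Qed.

Lemma gfor_den x rho v e g :
  gden x rho (GFor v e g) = flatten [seq gden x (upd rho v i) g | i <- iota 0 (eval x rho e)].
Proof. by []. Qed.

Lemma band_eval x rho b c : beval x rho (BAnd b c) = beval x rho b && beval x rho c.
Proof. by []. Qed.

Lemma gseq_den x rho g1 g2 : gden x rho (GSeq g1 g2) = gden x rho g1 ++ gden x rho g2.
Proof. by []. Qed.

Section Program.
Variables (M : TM) (d : nat) (eY eT eo eW eR : expr).

Definition allowedE (p : expr) (t : tile M) : bexpr :=
  BAnd (BIf (BEq p eo) (BC (t.2 == Some (tm_start M))) (BC (t.2 == None)))
    (BIf (BLt p eo) (BC (t.1 == Blank))
    (BIf (BLt p (EAdd eo ESize)) (BIf (BBit (ESub p eo)) (BC (t.1 == S1)) (BC (t.1 == S0)))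
    (BIf (BEq p (EAdd eo ESize)) (BC (t.1 == Sep))
    (BIf (BLe p (EAdd (EAdd eo ESize) eY)) (BC (t.1 != Sep)) (BC (t.1 == Blank)))))).

Definition enabledE (p : expr) (c : kind M) : bexpr :=
  match c with
  | ((false, false), (k1, k2, k3, k4)) =>
      BAnd (BLt (EAdd (EAdd p eW) (EC 1)) eR) (BC (next_tile k1 k2 k3 != k4))
  | ((false, true), (k1, _, _, _)) => BAnd (BLe p eW) (BNot (allowedE p k1))
  | ((true, false), (k1, k2, _, _)) =>
      BAnd (BLt (EAdd eo ESize) p) (BAnd (BLt p eW) (BC ((k1.1 == Blank) && is_bit k2.1)))
  | ((true, true), (k1, k2, _, _)) =>
      BAnd (BLe (EMul eT eW) p) (BAnd (BLt (EAdd p (EC 1)) eR)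
        (BC ((k1.2 != None) && ((k1.1 != S1) || is_bit k2.1))))
  end.

Definition litsE (p : expr) (c : kind M) : seq (expr * tile M) :=
  match c with
  | ((false, false), (k1, k2, k3, k4)) =>
      [:: (p, k1); (EAdd p (EC 1), k2); (EAdd p (EC 2), k3); (EAdd (EAdd p eW) (EC 1), k4)]
  | ((false, true), (k1, _, _, _)) => [:: (p, k1)]
  | ((true, false), (k1, k2, _, _)) => [:: (p, k1); (EAdd p (EC 1), k2)]
  | ((true, true), (k1, k2, k3, _)) => [:: (p, k1); (EAdd p (EC 1), k2); (eR, k3)]
  end.

Fixpoint memE (q : expr) (t : tile M) (l : seq (expr * tile M)) : bexpr :=
  if l is (p, u) :: l' then BOr (BAnd (BEq q p) (BC (t == u))) (memE q t l') else BC false.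

Definition conflictE (c : kind M) (t : tile M) : bexpr :=
  BOr (BNot (enabledE (EV 1) c)) (memE (EV 0) t (litsE (EV 1) c)).

Let K := size (tiles M).
Let L := size (kinds M).
Definition jE c := EAdd (EMul (EV 1) (EC L)) (EC c).
Definition BE := EMul eR (EC L).
Definition chainE k j := EAdd (EAdd (EC 3) BE) (EAdd (EMul (EAdd (EMul (EV 0) (EC K)) (EC k)) BE) j).
Definition baseE := EAdd (EAdd (EC 3) BE) (EMul (EMul (EAdd eR (EC 1)) (EC K)) BE).
Definition cellE := EAdd (EAdd baseE (EV 0)) (bcomp (BEq (EV 0) eR)).
Definition maltE := EAdd (EAdd baseE eR) (EC 2).

(** Only the cell and the position of the conflict are loop variables. Tiles and kinds, finite in
    number for a fixed machine, are unrolled, so the transition function enters through constants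
    and is never computed. The order of [coords] is kept: conflict [j] is [a * L + c], and copy [B]
    comes last. *)
Definition gloop (body : expr -> expr -> expr -> gen) : gen :=
  GFor 0 (EAdd eR (EC 1)) (gcat [seq
    GSeq (GFor 1 eR (gcat [seq body (chainE k (jE c))
             (EMul (bcomp (BLt (EC 0) (jE c))) (chainE k (ESub (jE c) (EC 1))))
             (EMul (bcomp (conflictE (kd M c) (tl M k))) (EAdd (EC 3) (jE c))) | c <- iota 0 L]))
         (body cellE (chainE k (ESub BE (EC 1))) (EC 0)) | k <- iota 0 K]).

Definition zE := ESub maltE (EC 2).
Definition topE := ESub maltE (EC 1).

Definition count_gen := gloop (fun _ _ _ => GOut (EC 1)).
Definition vote_gen := gloop (fun h b1 b2 => gmat maltE (fun a b =>
  BAnd (blead [:: h; b1; b2; zE] a b) (blead [:: b1; b2; zE; h] a b))).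
Definition mid_gen := gloop (fun h b1 b2 => gmat maltE (fun a b => blead [:: b1; b2; h; zE] b a)).
Definition lead_gen l := gmat maltE (blead l).
Definition flip_gen l := gmat maltE (fun a b => blead l b a).
Definition special_gen :=
  let e := EC 0 in let d := EC 1 in let w := EC 2 in
  gcat [:: lead_gen [:: e; w; d; zE]; flip_gen [:: w; d; zE; e];
           lead_gen [:: e; w; d; zE]; flip_gen [:: w; d; zE; e];
           lead_gen [:: topE; e]; flip_gen [:: e; topE];
           lead_gen [:: topE; e]; flip_gen [:: e; topE];
           lead_gen [:: zE; topE]; flip_gen [:: topE; zE]].
Definition vm_gen := gmat maltE (fun a b => BLt b a).
(** The number of votes is written in unary as three consecutive runs, one for each kind of vote. *)
Definition instance_gen : gen :=
  gcat [:: gunary maltE; GOut (EC 0); count_gen; count_gen; gunary (EC 10); GOut (EC 0);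
           vote_gen; mid_gen; special_gen; vm_gen].

Variable x : seq bool.
Hypotheses
  (HY : forall rho, eval x rho eY = guess_len d (size x))
  (HT : forall rho, eval x rho eT = horizon d (size x))
  (Ho : forall rho, eval x rho eo = origin d (size x))
  (HW : forall rho, eval x rho eW = width d (size x))
  (HR : forall rho, eval x rho eR = ncells d (size x)).

Lemma allowedE_eval rho p t : beval x rho (allowedE p t) = allowed d x (eval x rho p) t.
Proof.
rewrite /allowedE /allowed /= !Ho HY; congr (_ && _); first by case: eqP.
by case: ifP => // _; case: ifP => // _; case: (nth false x _).
Qed.

Lemma enabledE_eval rho p c : beval x rho (enabledE p c) = enabled d x (eval x rho p) c.
Proof.
by case: c => [[[|] [|]] [[[k1 k2] k3] k4]];
  rewrite /enabledE /enabled -?allowedE_eval /= ?HT ?HW ?HR ?Ho.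
Qed.

Lemma memE_eval rho q t l : beval x rho (memE q t l) =
  ((eval x rho q, t) \in [seq (eval x rho pu.1, pu.2) | pu <- l]).
Proof. by elim: l => //= -[p u] l IH /=; rewrite IH inE xpair_eqE. Qed.

Lemma litsE_eval rho p c :
  [seq (eval x rho pu.1, pu.2) | pu <- litsE p c] = lits d x (eval x rho p) c.
Proof. by case: c => [[[|] [|]] [[[k1 k2] k3] k4]]; rewrite /litsE /lits /= ?HW ?HR. Qed.

Lemma conflictE_eval rho c t : beval x rho (conflictE c t) = conflict d x (rho 1) c (rho 0) t.
Proof. by rewrite /conflictE /conflict [LHS]/= enabledE_eval memE_eval litsE_eval. Qed.

Let R := ncells d (size x).
Let B := R * L.
Let m := malt R K B.
Let gd0 := gad R K B (@fmem M d x).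

Lemma maltE_eval rho : eval x rho maltE = m.
Proof. by rewrite /maltE /baseE /BE /= !HR addn1. Qed.

Lemma zE_eval rho : eval x rho zE = m - 2.
Proof. by rewrite -(maltE_eval rho). Qed.
Lemma topE_eval rho : eval x rho topE = m - 1.
Proof. by rewrite -(maltE_eval rho). Qed.

(** The three expressions depend on variables 0 and 1 only, so their values survive in [gmat], which
    binds variables 2 and 3. *)
Lemma gloop_den body (bd : gadget -> seq bool) :
  (forall h b1 b2 (g : nat -> nat -> gadget),
     (forall rho, (eval x rho h, eval x rho b1, eval x rho b2) = g (rho 0) (rho 1)) ->
     forall rho, gden x rho (body h b1 b2) = bd (g (rho 0) (rho 1))) ->
  forall rho, gden x rho (gloop body) = flatten [seq bd g | g <- gads R K B (@fmem M d x)].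
Proof.
move=> Hb rho; rewrite /gads -map_comp /coords (flatten_map_pairs (bd \o gad R K B (@fmem M d x))).
rewrite (flatten_map_pairs (fun pk => flatten [seq (bd \o gad R K B (@fmem M d x)) (pk, j) | j <- iota 0 B.+1])).
rewrite gfor_den [eval _ _ _]/= HR addn1.
congr flatten; apply: eq_map => p; rewrite gcat_den -map_comp; congr flatten.
apply/eq_in_map => k; rewrite mem_iota add0n => /andP[_ Hk].
rewrite -[in iota 0 B.+1]addn1 iotaD map_cat flatten_cat {1}/B flatten_map_radix.
rewrite /comp gseq_den; congr (_ ++ _).
  rewrite gfor_den HR; congr flatten; apply/eq_in_map => a; rewrite mem_iota add0n => /andP[_ Ha].
  rewrite gcat_den -map_comp; congr flatten; apply/eq_in_map => c; rewrite mem_iota add0n => /andP[_ Hc].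
  have Hj : a * L + c < B.
    by rewrite /B; apply: (@leq_trans (a.+1 * L)); [rewrite mulSn; lia|rewrite leq_mul2r Ha orbT].
  pose g p a := (chain K B p k (a * L + c), (0 < a * L + c) * chain K B p k (a * L + c).-1,
    @fmem M d x p k (a * L + c) * (3 + (a * L + c))) : gadget.
  have -> : gad R K B (@fmem M d x) (p, k, a * L + c) = g p a by rewrite /gad Hj.
  rewrite /comp (Hb _ _ _ g) // => rho'; rewrite /g /fmem.
  rewrite divnMDl ?kinds_gt0 // divn_small // addn0 modnMDl modn_small //.
  rewrite -conflictE_eval -bcompE /= !HR !subn1 /chain.
  by have -> : 1 - (0 + 1 - (rho' 1 * L + c)) = (0 < rho' 1 * L + c) by case: (_ + c).
rewrite (Hb _ _ _ (fun p a => gd0 (p, k, B))); first by rewrite /= cats0.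
move=> rho'; rewrite /gd0 /gad ltnn.
rewrite -[eval _ _ cellE]/(eval x rho' (EAdd baseE (EV 0)) + eval x rho' (bcomp (BEq (EV 0) eR))).
by rewrite bcompE /= !HR addn1 subn1.
Qed.

Theorem instance_gen_den rho : gden x rho instance_gen =
  encode m (size (gads R K B (@fmem M d x)) + (size (gads R K B (@fmem M d x)) + 10))
    (votes m (gads R K B (@fmem M d x)) ++ [:: fun a b => b < a]).
Proof.
set gs := gads _ _ _ _.
have Hc rho' : gden x rho' count_gen = nseq (size gs) true.
  by rewrite (gloop_den (bd := fun _ => [:: true])) // flatten_nseq1.
have Hm rho' r f : (forall a b, beval x (upd (upd rho' 2 a) 3 b) (r (EV 2) (EV 3)) = f a b) ->
    gden x rho' (gmat maltE r) = matrix_of m f by apply: gmat_den; apply: maltE_eval.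
have EZ := zE_eval; have ET := topE_eval.
have Hv rho' : gden x rho' vote_gen = flatten (map (matrix_of m) (map (gvote m) gs)).
  rewrite (gloop_den (bd := fun g => matrix_of m (gvote m g))) -?map_comp //.
  move=> h b1 b2 g Hg rho1; apply: Hm => a b; rewrite band_eval !blead_eval /gvote /up /down.
  have := Hg (upd (upd rho1 2 a) 3 b); rewrite !map_cons EZ.
  by case: (g _ _) => [[h' b1'] b2'] [-> -> ->].
have Hi rho' : gden x rho' mid_gen = flatten (map (matrix_of m) (map (fun g => flip (mid m g)) gs)).
  rewrite (gloop_den (bd := fun g => matrix_of m (flip (mid m g)))) -?map_comp //.
  move=> h b1 b2 g Hg rho1; apply: Hm => a b; rewrite blead_eval /flip /mid.
  have := Hg (upd (upd rho1 2 a) 3 b); rewrite !map_cons EZ.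
  by case: (g _ _) => [[h' b1'] b2'] [-> -> ->].
have Hl rho' l l' : (forall rho1, map (eval x rho1) l = l') -> gden x rho' (lead_gen l) = matrix_of m (lead l').
  by move=> El; apply: Hm => a b; rewrite blead_eval El.
have Hf rho' l l' : (forall rho1, map (eval x rho1) l = l') -> gden x rho' (flip_gen l) = matrix_of m (flip (lead l')).
  by move=> El; apply: Hm => a b; rewrite blead_eval El.
have Hs rho' : gden x rho' special_gen = flatten (map (matrix_of m) (specials m)).
  rewrite gcat_den; congr flatten.
  by congr [:: _; _; _; _; _; _; _; _; _; _]; (apply: Hl || apply: Hf) => rho1; rewrite !map_cons ?EZ ?ET.
have Hvm rho' : gden x rho' vm_gen = matrix_of m (fun a b => b < a) by apply: Hm.
rewrite /encode /instance_gen gcat_den !map_cons Hc Hv Hi Hs Hvm !gunary_den maltE_eval.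
rewrite /votes !map_cat !flatten_cat map_cons [map _ [::]]/= -[X in _ = X]/(_ ++ false :: _).
move: (flatten (map _ (map (gvote m) gs))) (flatten (map _ (map (fun g => flip _) gs)))
  (flatten (map _ (specials m))) (matrix_of m _) => A1 A2 A3 A4.
by rewrite /= cats0 !nseqD -!catA.
Qed.
End Program.


(** * NP-hardness *)

Lemma leq_poly d n n' : n <= n' -> Defs.poly d n <= Defs.poly d n'.
Proof. by move=> H; rewrite /Defs.poly leq_add2r leq_mul2l leq_expl ?orbT. Qed.

Section Reduction.
Variables (M : TM) (d : nat).

Definition guessE := epoly d ESize.
Definition horizonE := epoly d (EAdd ESize guessE).
Definition originE := EAdd horizonE (EC 2).
Definition widthE := EAdd (EAdd (EAdd originE (EAdd (EAdd ESize (EC 1)) guessE)) horizonE) (EC 3).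
Definition ncellsE := EAdd (EMul (EAdd horizonE (EC 1)) widthE) (EC 1).

Definition reduction (x : seq bool) : seq bool :=
  gden x (fun=> 0) (instance_gen M guessE horizonE originE widthE ncellsE).

Lemma reduction_polytime : polytime_computable reduction.
Proof. exact: gen_polytime. Qed.

Variable x : seq bool.
Let R := ncells d (size x).
Let K := size (tiles M).
Let B := R * size (kinds M).
Let gs := gads R K B (@fmem M d x).
Let m := malt R K B.
Let n := size gs + (size gs + 10).

Lemma reductionE : reduction x = encode m n (votes m gs ++ [:: fun a b => b < a]).
Proof.
have HY rho : eval x rho guessE = guess_len d (size x) by apply: epoly_eval.
have HT rho : eval x rho horizonE = horizon d (size x).
  by rewrite /horizonE epoly_eval -[eval _ _ (EAdd _ _)]/(size x + eval x rho guessE) HY.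
have Ho rho : eval x rho originE = origin d (size x) by rewrite -[LHS]/(eval x rho horizonE + 2) HT.
have HW rho : eval x rho widthE = width d (size x).
  rewrite -[LHS]/(eval x rho originE + (size x + 1 + eval x rho guessE) + eval x rho horizonE + 3).
  by rewrite Ho HY HT.
have HR rho : eval x rho ncellsE = ncells d (size x).
  by rewrite -[LHS]/((eval x rho horizonE + 1) * eval x rho widthE + 1) HT HW (addn1 (horizon _ _)).
exact: instance_gen_den HY HT Ho HW HR _.
Qed.

Lemma B_gt0 : 0 < B.
Proof. by rewrite muln_gt0 kinds_gt0 andbT /R /ncells addn1. Qed.

Lemma K_gt0 : 0 < K. Proof. exact: ltnW (tiles_gt1 M). Qed.

Lemma m_ge5 : 5 <= m.
Proof. by rewrite /m /malt /base; have := B_gt0; lia. Qed.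

Lemma gs_ok : all (gadget_ok m) gs.
Proof. exact: gads_ok K_gt0 B_gt0. Qed.

Lemma DM_reduction : DM_maximin_4 (reduction x) <-> dominating_manipulation (@po m gs) (@VM m).
Proof.
have Hsize : size (votes m gs) = n by rewrite /votes !size_cat (size_map (gvote m)) (size_map (fun g => flip (mid m g))).
rewrite /DM_maximin_4 reductionE decode_encode; last by rewrite size_cat Hsize addn1.
have -> : (fun (i : 'I_n) (a b : 'I_m) =>
    nth (fun _ _ => false) (votes m gs ++ [:: fun a b => b < a]) i a b) = @po m gs.
  apply: functional_extensionality => i; apply: functional_extensionality => a.
  by apply: functional_extensionality => b; rewrite nth_cat Hsize ltn_ord.
have -> : (fun a b : 'I_m =>
    nth (fun _ _ => false) (votes m gs ++ [:: fun a b => b < a]) n a b) = @VM m.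
  apply: functional_extensionality => a.
  by apply: functional_extensionality => b; rewrite nth_cat Hsize ltnn subnn.
split=> [[I [[<-] [_ [_ //]]]]|H].
eexists; split; first by []; split; first split.
- exact: po_partial.
- exact: VM_linear.
- by split=> // i; apply: (po_unknown m_ge5 gs_ok).
Qed.

Lemma dominating_iff : dominating_manipulation (@po m gs) (@VM m) <->
  exists y, size y <= guess_len d (size x) /\
    accepting (snap M (pair_enc x y) (horizon d (size x))).
Proof.
split=> [Hdom|[y [Hy Ha]]].
  (* The fallback is the computation on the empty certificate with cell [R] left empty; whether it
     accepts does not matter. *)
  have [//|//|ch [Hu Hf]] := @tableau_complete M d x [::] false.
  rewrite addn0 in Hf.
  have [||sg Hsg] := sat_of_dominating m_ge5 gs_ok (sr := sg_of R K B ch) _ _ Hdom.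
  - move=> c Hc ct; apply: (sat_of_forbidden K_gt0 B_gt0 _ Hf Hc) => // p Hp Ec.
    rewrite ltn_neqAle Hp andbT; apply: contraNneq ct => Ep.
    by rewrite Ec Ep /cellc eqxx /m /malt addn2 subn1 addn1.
  - by move=> a b i j Ha _; apply: (flips_unique K_gt0 B_gt0 Hu Ha).
  have [ch' Hch'] := forbidden_of_sat K_gt0 B_gt0 Hsg.
  exact: tableau_sound Hch'.
have [ch [_ Hf]] := @tableau_complete M d x y true Hy (fun _ => Ha).
rewrite addn1 in Hf.
apply: (dominating_of_sat m_ge5 gs_ok); exists (sg_of R K B ch) => c Hc.
by apply: (sat_of_forbidden K_gt0 B_gt0 _ Hf Hc).
Qed.
End Reduction.

Theorem theorem7 : NP_hard DM_maximin_4.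
Proof.
move=> L' [M [d [Hhalt HL]]]; exists (reduction M d); split; first exact: reduction_polytime.
move=> x; rewrite DM_reduction dominating_iff HL.
have Hacc y : size y <= guess_len d (size x) ->
    accepts M (pair_enc x y) <-> accepting (snap M (pair_enc x y) (horizon d (size x))).
  move=> Hy; apply: accepts_snap; have [k [c [Hk H]]] := Hhalt x y.
  exists k, c; split=> //; apply: leq_trans Hk _; apply: leq_poly; rewrite leq_add2l //.
by split=> -[y [Hy Ha]]; exists y; split=> //; apply/(Hacc y Hy).
Qed.
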